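(* Let $g \in L^2(\mathbb{R}^d)$ and let $\Lambda \subseteq \mathbb{R}^{2d}$ be a lattice with adjoint lattice $\Lambda^\circ$. Then the following are equivalent: (i) $\mathcal{G}(g,\Lambda)$ is a frame for $L^2(\mathbb{R}^d)$. (ii) $\mathcal{G}(g,\Lambda^\circ)$ is a Bessel sequence and there exists $\gamma \in L^2(\mathbb{R}^d)$ such that $\mathcal{G}(\gamma,\Lambda^\circ)$ is a Bessel sequence satisfying $$\langle \gamma, \pi(\mu) g\rangle = \operatorname{vol}(\Lambda)\,\delta_{\mu,0} \qquad \text{for all } \mu \in \Lambda^\circ .$$ (iii) $\mathcal{G}(g,\Lambda^\circ)$ is a Riesz sequence in $L^2(\mathbb{R}^d)$.
   Context: For $z=(x,\xi)\in\mathbb{R}^{d}\times\mathbb{R}^d=\mathbb{R}^{2d}$ the time-frequency shift $\pi(z)$ acts on $f\in L^2(\mathbb{R}^d)$ by $\pi(z)f(t)=e^{2\pi i \xi\cdot t}f(t-x)$. A lattice is a set $\Lambda=A\mathbb{Z}^{2d}$ with $A$ an invertible real $2d\times 2d$ matrix; its volume is $\operatorname{vol}(\Lambda)=|\det A|$. Its adjoint lattice is $\Lambda^\circ=\mathcal{I}(A^T)^{-1}\mathbb{Z}^{2d}$, where $\mathcal{I}=\begin{pmatrix}0&I_d\\-I_d&0\end{pmatrix}$. For a lattice $\Lambda$, $\mathcal{G}(g,\Lambda)=\{\pi(\lambda)g:\lambda\in\Lambda\}$ (indexed by $\Lambda$). $\mathcal{G}(g,\Lambda)$ is a frame for $L^2(\mathbb{R}^d)$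 if there are $A,B>0$ with $A\|f\|^2\le\sum_{\lambda\in\Lambda}|\langle f,\pi(\lambda)g\rangle|^2\le B\|f\|^2$ for all $f\in L^2(\mathbb{R}^d)$; it is a Bessel sequence if the upper inequality holds for some $B>0$. It is a Riesz sequence in $L^2(\mathbb{R}^d)$ if there are $A,B>0$ with $A\|c\|_{\ell^2}^2\le\|\sum_{\lambda\in\Lambda}c_\lambda\pi(\lambda)g\|_{L^2}^2\le B\|c\|_{\ell^2}^2$ for all $c\in\ell^2(\Lambda)$. *)

(* Defs.v *)
From HB Require Import structures.
From mathcomp Require Import all_boot all_order all_algebra finmap.
From mathcomp Require Import all_classical all_reals all_analysis.
From mathcomp Require Import summability.
From mathcomp Require Import complex.
Set Implicit Arguments.
Unset Strict Implicit.
Unset Printing Implicit Defensive.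
Import Order.TTheory GRing.Theory Num.Theory.
Import numFieldNormedType.Exports.
Local Open Scope classical_set_scope.
Local Open Scope ring_scope.

(** Product sigma-algebra on matrices, generated by the entries; on ['cV[R]_n]
    with [R : realType] this is the Borel sigma-algebra of R^n. *)

Definition measure_matrix_display : measure_display -> measure_display.
Proof. exact. Qed.

Section measurable_matrix.
Context d (T : measurableType d) (m n : nat).

Definition mx_cylinder : set (set 'M[T]_(m, n)) :=
  [set (fun M : 'M[T]_(m, n) => M ij.1 ij.2) @^-1` B
     | ij in [set: 'I_m * 'I_n] & B in measurable].

HB.instance Definition _ :=
  @isMeasurable.Build (measure_matrix_display d) 'M[T]_(m, n)
    <<s mx_cylinder >> (@sigma_algebra0 _ _ _) (@sigma_algebraC _ _)
    (@sigma_algebra_bigcup _ _ _).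

Lemma measurable_entry (i : 'I_m) (j : 'I_n) :
  measurable_fun [set: 'M[T]_(m, n)] (fun M : 'M[T]_(m, n) => M i j).
Proof.
move=> _ B mB; rewrite setTI; apply: sub_sigma_algebra.
by exists (i, j) => //; exists B.
Qed.

Lemma measurable_fun_mxP d' (T' : measurableType d') (f : T' -> 'M[T]_(m, n)) :
  measurable_fun [set: T'] f <->
  forall i j, measurable_fun [set: T'] (fun x => f x i j).
Proof.
split=> [mf i j|mf]; first exact: (measurableT_comp (measurable_entry i j) mf).
apply: measurability => // _ [_ [[i j] _ [B mB <-]] <-].
exact: mf.
Qed.

End measurable_matrix.

(** Lebesgue measure on R^n, by recursion on n: R^0 is a point of mass 1, and
    R^(n+1) carries the product measure transported along [cV_cons]. *)

Section lebesgue_cV.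
Context {R : realType}.

Definition cV_cons n (p : R * 'cV[R]_n) : 'cV[R]_n.+1 :=
  col_mx (const_mx p.1 : 'cV_1) p.2.

Definition cV_uncons n (v : 'cV[R]_n.+1) : R * 'cV[R]_n :=
  (v ord0 ord0, dsubmx (v : 'cV_(1 + n))).

Lemma cV_consK n : cancel (@cV_cons n) (@cV_uncons n).
Proof.
move=> [x v]; rewrite /cV_uncons /cV_cons /= col_mxKd; congr pair.
by rewrite mxE; case: splitP => // j _; rewrite mxE.
Qed.

Lemma cV_unconsK n : cancel (@cV_uncons n) (@cV_cons n).
Proof.
move=> v; rewrite /cV_uncons /cV_cons /= -[RHS](@vsubmxK _ 1 n 1 v).
congr (@col_mx _ 1 n 1 _ _); apply/matrixP => i j; rewrite !mxE !ord1.
by congr (v _ _); apply: val_inj.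
Qed.

Lemma measurable_cV_cons n : measurable_fun setT (@cV_cons n).
Proof.
apply/measurable_fun_mxP => i j; case: (@split_ordP 1 n i) => k ->.
- rewrite (_ : (fun p => _) = fst); first exact: measurable_fst.
  by apply/funext => p; rewrite /cV_cons (@col_mxEu _ 1 n 1) mxE.
- rewrite (_ : (fun p => _) = (fun v : 'cV[R]_n => v k j) \o snd).
    exact: (measurableT_comp (measurable_entry k j) measurable_snd).
  by apply/funext => p; rewrite /cV_cons (@col_mxEd _ 1 n 1).
Qed.

Lemma measurable_cV_uncons n : measurable_fun setT (@cV_uncons n).
Proof.
apply/measurable_fun_pairP; split; first exact: measurable_entry.
apply/measurable_fun_mxP => i j /=.
by under eq_fun do rewrite mxE; exact: measurable_entry.
Qed.

Section step.
Variables (n : nat) (mu : {sigma_finite_measure set 'cV[R]_n -> \bar R}).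

Definition lebesgue_cV_step : set 'cV[R]_n.+1 -> \bar R :=
  pushforward (@lebesgue_measure R \x mu)%E (@cV_cons n).

Let step0 : lebesgue_cV_step set0 = 0%E.
Proof. by rewrite /lebesgue_cV_step /pushforward preimage_set0 measure0. Qed.

Let step_ge0 A : (0 <= lebesgue_cV_step A)%E.
Proof. exact: (measure_ge0 (@lebesgue_measure R \x mu)%E). Qed.

Let step_sigma_additive : semi_sigma_additive lebesgue_cV_step.
Proof.
have mpre A : measurable A -> measurable (@cV_cons n @^-1` A).
  by move=> mA; rewrite -[X in measurable X]setTI; exact: measurable_cV_cons.
move=> F mF tF mUF; rewrite /lebesgue_cV_step /pushforward preimage_bigcup.
apply: measure_semi_sigma_additive => [k||].
- exact: mpre.
- apply/trivIsetP => i j _ _ ij; rewrite -preimage_setI.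
  by move/trivIsetP : tF => /(_ _ _ I I ij) ->; rewrite preimage_set0.
- by rewrite -preimage_bigcup; exact: mpre.
Qed.

HB.instance Definition _ := isMeasure.Build _ _ _ lebesgue_cV_step
  step0 step_ge0 step_sigma_additive.

Let step_sigma_finite : sigma_finite setT lebesgue_cV_step.
Proof.
have /sigma_finiteP[F [FT ndF Foo]] := sigma_finiteT (@lebesgue_measure R).
have /sigma_finiteP[G [GT ndG Goo]] := sigma_finiteT mu.
exists (fun k => @cV_uncons n @^-1` (F k `*` G k)).
  rewrite -preimage_bigcup -(@preimage_setT _ _ (@cV_uncons n)).
  congr (_ @^-1` _); apply/esym/seteqP; split => // -[x v] _.
  have [i _ Fx] : (\bigcup_i F i) x by rewrite -FT.
  have [j _ Gv] : (\bigcup_j G j) v by rewrite -GT.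
  exists (maxn i j) => //; split.
    by move: x Fx; exact/subsetPset/ndF/leq_maxl.
  by move: v Gv; exact/subsetPset/ndG/leq_maxr.
move=> k; have [mF Fk] := Foo k; have [mG Gk] := Goo k; split.
  rewrite -[X in measurable X]setTI.
  by apply: measurable_cV_uncons => //; exact: measurableX.
rewrite /lebesgue_cV_step /pushforward -comp_preimage.
rewrite (_ : _ \o _ = id); last by apply/funext => x /=; rewrite cV_consK.
by rewrite preimage_id product_measure1E// lte_mul_pinfty// ge0_fin_numE.
Qed.

HB.instance Definition _ := Measure_isSigmaFinite.Build _ _ _
  lebesgue_cV_step step_sigma_finite.

End step.

Fixpoint lebesgue_cV (n : nat) : {sigma_finite_measure set 'cV[R]_n -> \bar R} :=
  match n with
  | 0 => \d_(0 : 'cV[R]_0)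
  | n'.+1 => lebesgue_cV_step (lebesgue_cV n')
  end.

Lemma lebesgue_cV_box n (B : 'I_n -> set R) : (forall i, measurable (B i)) ->
  lebesgue_cV n [set v : 'cV[R]_n | forall i, B i (v i ord0)] =
  (\prod_(i < n) lebesgue_measure (B i))%E.
Proof.
elim: n B => [|n IHn] B mB.
  by rewrite big_ord0 /= diracE mem_set// => -[].
rewrite big_ord_recl /= /lebesgue_cV_step /pushforward.
set B' := fun i => B (lift ord0 i).
pose Bn := [set v : 'cV[R]_n | forall i, B' i (v i ord0)].
rewrite (_ : _ @^-1` _ = B ord0 `*` Bn); last first.
  apply/seteqP; split => -[x v] /=.
  - move=> h; split.
      by have := h ord0; rewrite mxE; case: splitP => // j _; rewrite mxE.
    move=> i; rewrite /B' (_ : lift ord0 i = @rshift 1 n i); last exact: val_inj.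
    by have := h (@rshift 1 n i); rewrite /cV_cons (@col_mxEd _ 1 n 1).
  - move=> [Bx Bv] i; case: (@split_ordP 1 n i) => k ->.
      rewrite /cV_cons (@col_mxEu _ 1 n 1) mxE ord1.
      by rewrite (_ : lshift n ord0 = ord0)//; apply: val_inj.
    rewrite /cV_cons (@col_mxEd _ 1 n 1); have := Bv k; rewrite /B'.
    by rewrite (_ : lift ord0 k = @rshift 1 n k)//; apply: val_inj.
have mBn : measurable Bn.
  rewrite (_ : Bn = \bigcap_(i in [set: 'I_n])
      ((fun v : 'cV[R]_n => v i ord0) @^-1` B' i)); last first.
    by apply/seteqP; split => [v h i _|v h i]; exact: h.
  apply: fin_bigcap_measurable => // i _; rewrite -[X in measurable X]setTI.
  by apply: measurable_entry => //; exact: mB.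
rewrite product_measure1E//=; last exact: mB.
by congr (_ * _)%E; apply: (IHn B') => i; exact: mB.
Qed.

End lebesgue_cV.

(** Complex-valued functions on R^d are compared through representatives: [L2]
    is a predicate on functions, and everything below is invariant under
    almost-everywhere equality. *)

Section L2.
Context {R : realType} {d : nat}.
Implicit Types f g : 'cV[R]_d -> R[i].

Definition L2norm f : \bar R :=
  'N[lebesgue_cV d]_2%:E [EFin \o @Normc.normc R \o f]%E.

Definition L2 f : Prop :=
  [/\ measurable_fun [set: 'cV[R]_d] (fun t => complex.Re (f t)),
      measurable_fun [set: 'cV[R]_d] (fun t => complex.Im (f t))
    & (L2norm f < +oo)%E].

(* linear in the first argument *)
Definition L2inner f g : R[i] :=
  ((\int[lebesgue_cV d]_t complex.Re (f t * (g t)^*)) +i*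
   (\int[lebesgue_cV d]_t complex.Im (f t * (g t)^*)))%C.

End L2.

Section sequences_in_L2.
Context {R : realType} {d : nat} {I : choiceType}.
Implicit Types (S : set I) (e : I -> 'cV[R]_d -> R[i]) (c : I -> R[i]).

Definition frame_lower S e (A : R) : Prop := forall f, L2 f ->
  (A%:E * L2norm f ^+ 2 <=
   \esum_(i in S) ((Normc.normc (L2inner f (e i)) ^+ 2)%R)%:E)%E.

Definition frame_upper S e (B : R) : Prop := forall f, L2 f ->
  (\esum_(i in S) ((Normc.normc (L2inner f (e i)) ^+ 2)%R)%:E <=
   B%:E * L2norm f ^+ 2)%E.

Definition is_frame S e : Prop :=
  exists A B : R, [/\ 0 < A, 0 < B, frame_lower S e A & frame_upper S e B].

Definition is_bessel S e : Prop := exists2 B : R, 0 < B & frame_upper S e B.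

(* squared l^2(S)-norm; only the values of [c] on [S] matter *)
Definition l2normsq S c : \bar R :=
  \esum_(i in S) ((Normc.normc (c i) ^+ 2)%R)%:E.

(* [s] is the sum of [c i *: e i] over [i] in [S]: the net of finite partial
   sums converges to [s] in the L2 norm *)
Definition L2sum S e c (s : 'cV[R]_d -> R[i]) : Prop :=
  L2norm (fun t => s t - \sum_(i <- F | i \in S) c i * e i t)
    @[F --> totally] --> 0%E.

(* The existence of the sum of the series, implicit in the notation
   sum_i c_i e_i, is part of the definition. *)
Definition is_riesz_sequence S e : Prop :=
  exists A B : R, [/\ 0 < A, 0 < B &
    forall c, (l2normsq S c < +oo)%E ->
      exists s, [/\ L2 s, L2sum S e c s,
        (A%:E * l2normsq S c <= L2norm s ^+ 2)%E &
        (L2norm s ^+ 2 <= B%:E * l2normsq S c)%E]].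

End sequences_in_L2.

Section gabor.
Context {R : realType} {d : nat}.

(* exp(2 pi i theta) *)
Definition expi2pi (theta : R) : R[i] :=
  (cos (2 * pi * theta) +i* sin (2 * pi * theta))%C.

(* [z] is the column of [x = usubmx z] and [xi = dsubmx z] *)
Definition tf_shift (z : 'cV[R]_(d + d)) (f : 'cV[R]_d -> R[i]) :
    'cV[R]_d -> R[i] :=
  fun t => expi2pi (((dsubmx z)^T *m t) ord0 ord0) * f (t - usubmx z).

(* [G(g, S)] is the family [gabor g] indexed by [S] *)
Definition gabor (g : 'cV[R]_d -> R[i]) (z : 'cV[R]_(d + d)) := tf_shift z g.

Definition lattice n (A : 'M[R]_n) : set 'cV[R]_n :=
  [set A *m map_mx intr k | k in [set: 'cV[int]_n]].

Definition lattice_vol n (A : 'M[R]_n) : R := `|\det A|.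

Definition sympl_mx : 'M[R]_(d + d) := block_mx 0 1%:M (- 1%:M) 0.

Definition adjoint_lattice (A : 'M[R]_(d + d)) : set 'cV[R]_(d + d) :=
  lattice (sympl_mx *m invmx A^T).

End gabor.

(* Main.v *)
(** All three conditions are equivalent to uniform two-sided bounds
    [a * sum |c_mu|^2 <= ||sum c_mu pi(mu) g||^2 <= b * sum |c_mu|^2] over finite
    subsets of the adjoint lattice.

    For the frame property the link is Moyal's identity, in the form
    [int_(R^2d) |sum_i <w_i, pi(z) g_i>|^2 dz = int int |sum_i w_i(t) conj(g_i(u))|^2 dt du],
    which follows from Plancherel's theorem (obtained by inserting the weight
    [prod_i exp(-eps |xi_i|)], whose Fourier transform is the Poisson kernel).
    For [mu] in the adjoint lattice, [pi(mu)] commutes with [pi(lambda)],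
    [lambda] in the lattice, and with [pi(z)] up to the character
    [e(symp z mu)].  Hence a trigonometric sum [a(z)] over the adjoint lattice is
    periodic, and unfolding [R^2d] into translates of a cell gives
    [int_cell |a(z)|^2 sum_lambda |<f, pi(z + lambda) g>|^2 dz =
     int ||sum_mu conj(b_mu pi(mu) f(t)) pi(mu) g||^2 dt].
    When the coefficients [c_mu] are given, the frame bounds applied to
    [sum_mu conj(c_mu) e(-symp z mu) pi(mu)^* u], together with Parseval's identity
    on the cell, yield the finite bounds.  Conversely the finite bounds control
    the average on the left, and letting
    [|a|^2 = prod_i cos(pi s_i)^(2M)] concentrate at [z = 0] recovers the frame
    inequalities, because [z |-> pi(z)^* f] is continuous.

    A biorthogonal Bessel window gives the lower bound by Bessel's inequality for
    [sum_mu c_mu pi(mu) g].  Conversely the component of [g] orthogonal to the other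
    [pi(mu) g] is nonzero by the lower bound; rescaled, it is biorthogonal, and
    it is Bessel because it lies in the closed span of the [pi(mu) g]. *)

From HB Require Import structures.
Require Import Defs.
From mathcomp Require Import all_boot all_order all_algebra finmap.
From mathcomp Require Import all_classical all_reals all_analysis.
From mathcomp Require Import measurable_realfun summability complex ring lra.
Set Implicit Arguments.
Unset Strict Implicit.
Unset Printing Implicit Defensive.
Import Order.TTheory GRing.Theory Num.Theory.
Import numFieldNormedType.Exports.
Local Open Scope classical_set_scope.
Local Open Scope ring_scope.

(** For a merely square-integrable [g], the periodic function [z |-> sum_lambda |<f, pi(z + lambda)
    g>|^2] is only known to be integrable over a cell, so it cannot be evaluated at [z = 0] through
    its Fourier series. It is therefore tested against the nonnegative weights [|a|^2]: both sides
    are then integrals of nonnegative functions, Tonelli's theorem applies even where a value might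
    be infinite, and no summability over either lattice is assumed beforehand. Passing from the
    averages back to [z = 0] has to follow a fixed order. The upper frame bound comes first, on
    finite sets of lattice points, where Cauchy-Schwarz gives a crude bound for the contribution
    away from [0]; the lower bound then uses the upper one for that purpose. Comparing [f] with its
    small shifts costs a factor 2 in each bound, which is harmless since only the existence of
    bounds is claimed. Of a cell, only the fact that its mass is positive and finite enters, so this
    mass is never computed from [A]; the volume appears solely as the normalisation of the dual
    window. *)

Section measurability.
Context d (T : measurableType d) (R : realType).
Implicit Types f g : T -> R.

Lemma measD f g : measurable_fun setT f -> measurable_fun setT g ->
  measurable_fun setT (fun x => f x + g x).
Proof. exact: measurable_funD. Qed.

Lemma measB f g : measurable_fun setT f -> measurable_fun setT g ->
  measurable_fun setT (fun x => f x - g x).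
Proof. exact: measurable_funB. Qed.

Lemma measN f : measurable_fun setT f -> measurable_fun setT (fun x => - f x).
Proof. exact: measurable_funN. Qed.

Lemma measM f g : measurable_fun setT f -> measurable_fun setT g ->
  measurable_fun setT (fun x => f x * g x).
Proof. exact: measurable_funM. Qed.

Lemma measX n f : measurable_fun setT f -> measurable_fun setT (fun x => f x ^+ n).
Proof. exact: measurable_funX. Qed.

Lemma measabs f : measurable_fun setT f -> measurable_fun setT (fun x => `|f x|).
Proof. by move=> ?; exact: measurableT_comp. Qed.

Lemma meascos f : measurable_fun setT f -> measurable_fun setT (fun x => cos (f x)).
Proof.
move=> ?; apply: (measurableT_comp (f := cos)) => //.
by apply: continuous_measurable_fun; exact: continuous_cos.
Qed.

Lemma meassin f : measurable_fun setT f -> measurable_fun setT (fun x => sin (f x)).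
Proof.
move=> ?; apply: (measurableT_comp (f := sin)) => //.
by apply: continuous_measurable_fun; exact: continuous_sin.
Qed.

Lemma measexp f : measurable_fun setT f -> measurable_fun setT (fun x => expR (f x)).
Proof. by move=> ?; apply: (measurableT_comp (f := expR)). Qed.

Lemma meassum (I : Type) (s : seq I) (P : pred I) (h : I -> T -> R) :
  (forall i, P i -> measurable_fun setT (h i)) ->
  measurable_fun setT (fun x => \sum_(i <- s | P i) h i x).
Proof.
move=> mh; elim: s => [|i s IH].
  by under eq_fun do rewrite big_nil; exact: measurable_cst.
case HP: (P i); under eq_fun do rewrite big_cons HP //.
  by apply: measD => //; exact: mh.
by [].
Qed.

Lemma measprod (I : Type) (s : seq I) (P : pred I) (h : I -> T -> R) :
  (forall i, P i -> measurable_fun setT (h i)) ->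
  measurable_fun setT (fun x => \prod_(i <- s | P i) h i x).
Proof.
move=> mh; elim: s => [|i s IH].
  by under eq_fun do rewrite big_nil; exact: measurable_cst.
case HP: (P i); under eq_fun do rewrite big_cons HP //.
  by apply: measM => //; exact: mh.
by [].
Qed.

Lemma measEFin f : measurable_fun setT f -> measurable_fun setT (fun x => (f x)%:E).
Proof. by move=> ?; apply/measurable_EFinP. Qed.

End measurability.

Ltac mfun_step :=
  match goal with
  | |- measurable_fun _ (fun _ => ?c) => exact: measurable_cst
  | |- measurable_fun _ (fun x => (@?f x)%:E) => apply: measEFin
  | |- measurable_fun _ (EFin \o _) => apply: measEFin
  | |- measurable_fun _ (fun x => Algebra.add _ _) =>
      first [apply: measB | apply: measD | apply: emeasurable_funD]
  | |- measurable_fun _ (fun x => (- (@?f x))%R) => apply: measN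
  | |- measurable_fun _ (fun x => GRing.mul _ _) => first [apply: measM | apply: measurable_funeM]
  | |- measurable_fun _ (fun x => ((@?f x) ^+ ?n)%R) => apply: measX
  | |- measurable_fun _ (fun x => `|@?f x|%R) => apply: measabs
  | |- measurable_fun _ (fun x => cos (@?f x)) => apply: meascos
  | |- measurable_fun _ (fun x => sin (@?f x)) => apply: meassin
  | |- measurable_fun _ (fun x => expR (@?f x)) => apply: measexp
  | |- measurable_fun _ (fun x => (\sum_(i <- _ | _) _)%R) => apply: meassum => ? ?
  | |- measurable_fun _ (fun x => (\prod_(i <- _ | _) _)%R) => apply: measprod => ? ?
  | |- measurable_fun _ (fun x => mule _ _) => apply: measurable_funeM
  | |- measurable_fun _ (fun x => x) => exact: measurable_id
  | |- measurable_fun _ (fun x => x.1) => exact: measurable_fst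
  | |- measurable_fun _ (fun x => x.2) => exact: measurable_snd
  end.

Ltac mfun := repeat first [assumption | mfun_step | exact: measurable_cst
  | exact: measurable_id | exact: measurable_fst | exact: measurable_snd].

Ltac ge0 := intros;
  repeat first [ done | rewrite lee_fin | apply: adde_ge0 | apply: mule_ge0
    | apply: sqr_ge0 | apply: normr_ge0 | apply: addr_ge0 | apply: mulr_ge0
    | apply: expR_ge0 | (apply: integral_ge0 => ? ?) ].

(** * Integrals under measure-preserving maps *)

Lemma ge0_integral_preserving d1 d2 (T1 : measurableType d1)
    (T2 : measurableType d2) (R : realType) (m1 : {measure set T1 -> \bar R})
    (m2 : {measure set T2 -> \bar R}) (phi : T1 -> T2) (f : T2 -> \bar R) :
  measurable_fun setT phi ->
  (forall A, measurable A -> m1 (phi @^-1` A) = m2 A) ->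
  measurable_fun setT f -> (forall x, 0 <= f x)%E ->
  (\int[m2]_x f x = \int[m1]_x f (phi x))%E.
Proof.
move=> mphi m12 mf f0.
transitivity (\int[pushforward m1 phi]_x f x)%E.
  by apply: eq_measure_integral => A mA _; rewrite -m12.
by rewrite ge0_integral_pushforward.
Qed.

Lemma integral_preserving d1 d2 (T1 : measurableType d1)
    (T2 : measurableType d2) (R : realType) (m1 : {measure set T1 -> \bar R})
    (m2 : {measure set T2 -> \bar R}) (phi : T1 -> T2) (f : T2 -> \bar R) :
  measurable_fun setT phi ->
  (forall A, measurable A -> m1 (phi @^-1` A) = m2 A) ->
  measurable_fun setT f ->
  (\int[m2]_x f x = \int[m1]_x f (phi x))%E.
Proof.
move=> mphi m12 mf; rewrite [LHS]integralE [RHS]integralE.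
rewrite (ge0_integral_preserving mphi m12 (measurable_funepos mf))//.
rewrite (ge0_integral_preserving mphi m12 (measurable_funeneg mf))//.
have -> : (\int[m1]_x f^\+ (phi x) = \int[m1]_x (fun y => f (phi y))^\+ x)%E.
  by apply: eq_integral => x _; rewrite !funeposE.
have -> // : (\int[m1]_x f^\- (phi x) = \int[m1]_x (fun y => f (phi y))^\- x)%E.
by apply: eq_integral => x _; rewrite !funenegE.
Qed.

(** * Invariance of Lebesgue measure *)

Section lebesgue1.
Context {R : realType}.
Local Notation leb := (@lebesgue_measure R).

Lemma lebesgue_measure_translation (a : R) (A : set R) : measurable A ->
  leb ((fun x => x + a) @^-1` A) = leb A.
Proof.
have ma : measurable_fun setT (fun x : measurableTypeR R => (x + a : measurableTypeR R)).
  by apply: measD => //.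
move=> mA; apply/esym.
apply: (@lebesgue_measure_unique _ (pushforward leb (fun x : measurableTypeR R => (x +
    a : measurableTypeR R)))) => //= _ [[b c]] _ <-.
rewrite /pushforward (_ : _ @^-1` _ = `](b - a), (c - a)]%classic); last first.
  by apply/seteqP; split => x /=; rewrite !in_itv/= ltrBlDr lerBrDr.
rewrite !lebesgue_measure_itv/= !lte_fin ltrD2r; case: ifPn => // _.
by rewrite -!EFinB opprB addrA subrK.
Qed.

Lemma ge0_integral_translation1 (a : R) (f : R -> \bar R) :
  measurable_fun setT f -> (forall x, 0 <= f x)%E ->
  (\int[leb]_x f (x + a)%R = \int[leb]_x f x)%E.
Proof.
move=> mf f0; have ma : measurable_fun setT (fun x : measurableTypeR R => (x +
    a : measurableTypeR R)).
  by mfun.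
by rewrite [RHS](ge0_integral_preserving (m1 := leb) ma)// => A;
    exact: lebesgue_measure_translation.
Qed.

(** [c] times the image of Lebesgue measure under multiplication by [c] agrees with Lebesgue measure
    on half-open intervals, hence on all measurable sets. *)
Lemma ge0_integral_scale (c : R) (f : R -> \bar R) : 0 < c ->
  measurable_fun setT f -> (forall x, 0 <= f x)%E ->
  (\int[leb]_x f x = c%:E * \int[leb]_x f (c * x)%R)%E.
Proof.
move=> c0 mf f0.
have mc : measurable_fun setT (fun x : measurableTypeR R => (c * x : measurableTypeR R)).
  by apply: measM => //.
pose phi := (fun x : measurableTypeR R => (c * x : measurableTypeR R)).
have c0' : 0 <= c by exact: ltW.
pose m : {measure set (measurableTypeR R) -> \bar R} := mscale (NngNum c0')
    (measure_function_pushforward__canonical__measure_function_Measure leb mc).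
transitivity (\int[m]_x f x)%E.
  apply: eq_measure_integral => A mA _.
  apply: (@lebesgue_measure_unique _ m) => //= _ [[a b]] _ <-.
  rewrite /m /mscale /= /pushforward (_ : _ @^-1` _ = `](a / c), (b / c)]%classic); last first.
    apply/seteqP; split => x /=; rewrite !in_itv/= ltr_pdivrMr// ler_pdivlMr//;
    by rewrite (mulrC c).
  rewrite !lebesgue_measure_itv/= !lte_fin ltr_pM2r ?invr_gt0//.
  case: ifPn => // _; last by rewrite mule0.
  by rewrite -!EFinB -EFinM -mulrBl mulrC divfK// gt_eqF.
rewrite ge0_integral_mscale//=; congr (_ * _)%E.
by rewrite ge0_integral_pushforward.
Qed.

End lebesgue1.

Section lebesgue_n.
Context {R : realType}.
Local Notation leb := (@lebesgue_measure R).
Local Notation lam := (@lebesgue_cV R).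

Lemma ge0_integral_cV_cons n (f : 'cV[R]_n.+1 -> \bar R) :
  measurable_fun setT f -> (forall x, 0 <= f x)%E ->
  (\int[lam n.+1]_v f v = \int[leb]_x \int[lam n]_v f (cV_cons (x, v)))%E.
Proof.
move=> mf f0.
rewrite (ge0_integral_preserving (m1 := (leb \x lam n)%E) (@measurable_cV_cons R n))//.
by rewrite fubini_tonelli1//; apply: measurableT_comp => //; exact: measurable_cV_cons.
Qed.

Lemma ge0_integral_cV_cons2 n (f : 'cV[R]_n.+1 -> \bar R) :
  measurable_fun setT f -> (forall x, 0 <= f x)%E ->
  (\int[lam n.+1]_v f v = \int[lam n]_v \int[leb]_x f (cV_cons (x, v)))%E.
Proof.
move=> mf f0.
rewrite (ge0_integral_preserving (m1 := (leb \x lam n)%E) (@measurable_cV_cons R n))//.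
by rewrite fubini_tonelli2//; apply: measurableT_comp => //; exact: measurable_cV_cons.
Qed.

Lemma cV_consD n (x y : R) (v w : 'cV[R]_n) :
  cV_cons (x, v) + cV_cons (y, w) = cV_cons (x + y, v + w).
Proof.
rewrite /cV_cons /= (@add_col_mx _ 1 n 1); congr (@col_mx _ 1 n 1 _ _).
by apply/matrixP => i j; rewrite !mxE.
Qed.

Lemma measurable_translation n (a : 'cV[R]_n) : measurable_fun setT (fun v : 'cV[R]_n => v + a).
Proof.
apply/measurable_fun_mxP => i j; under eq_fun do rewrite mxE.
by apply: measD; [exact: measurable_entry|exact: measurable_cst].
Qed.

Lemma ge0_integral_translation n (a : 'cV[R]_n) (f : 'cV[R]_n -> \bar R) :
  measurable_fun setT f -> (forall x, 0 <= f x)%E ->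
  (\int[lam n]_v f (v + a)%R = \int[lam n]_v f v)%E.
Proof.
elim: n a f => [|n IH] a f mf f0.
  by apply: eq_integral => v _; congr f; apply/matrixP => -[].
have mfa : measurable_fun setT (fun v : 'cV[R]_n.+1 => f (v + a)).
  by apply: (measurableT_comp mf); exact: measurable_translation.
rewrite (ge0_integral_cV_cons mf f0).
rewrite (ge0_integral_cV_cons mfa (fun v => f0 (v + a))).
rewrite -(cV_unconsK a); case: (cV_uncons a) => x w.
have mI : measurable_fun setT (fun y => \int[lam n]_v f (cV_cons (y, v)))%E.
  apply: (@measurable_fun_fubini_tonelli_F _ _ _ _ _ _ (f \o @cV_cons R n)) => //.
    by apply: measurableT_comp => //; exact: measurable_cV_cons.
  by move=> p; exact: f0.
have mx : measurable_fun setT (fun y : R => y + x) by mfun.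
rewrite -(@ge0_integral_translation1 _ x _ mI); last first.
  by move=> y; apply: integral_ge0.
apply: eq_integral => y _; under eq_integral do rewrite cV_consD.
apply: (IH w (fun v => f (cV_cons (y + x, v)))) => //.
apply: (measurableT_comp mf).
apply: (measurableT_comp (@measurable_cV_cons R n)).
by apply/measurable_fun_pairP; split; mfun.
Qed.

Lemma lebesgue_cV_indic n (A : set 'cV[R]_n) : measurable A ->
  (lam n A = \int[lam n]_v (\1_A v)%:E)%E.
Proof. by move=> mA; rewrite integral_indic// setIT. Qed.

Lemma lebesgue_cV_translation n (a : 'cV[R]_n) (A : set 'cV[R]_n) : measurable A ->
  lam n ((fun v => v + a) @^-1` A) = lam n A.
Proof.
move=> mA; have mA' : measurable ((fun v => v + a) @^-1` A).
  by rewrite -[X in measurable X]setTI; exact: measurable_translation.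
rewrite !lebesgue_cV_indic// -[RHS](@ge0_integral_translation _ a)//.
by apply/measurable_EFinP; exact: measurable_indic.
Qed.

Lemma integral_translation n (a : 'cV[R]_n) (f : 'cV[R]_n -> \bar R) :
  measurable_fun setT f ->
  (\int[lam n]_v f (v + a)%R = \int[lam n]_v f v)%E.
Proof.
move=> mf; rewrite [RHS](integral_preserving (m1 := lam n) (@measurable_translation _ a))//.
exact: lebesgue_cV_translation.
Qed.

Lemma cV_consZ n (c x : R) (v : 'cV[R]_n) :
  c *: cV_cons (x, v) = cV_cons (c * x, c *: v).
Proof.
rewrite /cV_cons /= (@scale_col_mx _ 1 n 1); congr (@col_mx _ 1 n 1 _ _).
by apply/matrixP => i j; rewrite !mxE.
Qed.

End lebesgue_n.

(** * Convergence to zero of nonnegative integrals *)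

Lemma cvge0P (R : realType) (a : (\bar R)^nat) : (forall k, 0 <= a k)%E ->
  a @ \oo --> 0%E <-> forall e : R, 0 < e -> \forall k \near \oo, (a k <= e%:E)%E.
Proof.
move=> a0; split=> [/fine_cvgP[afin /cvgrPdist_le ca] e e0|h].
  near=> k; have afk : a k \is a fin_num by near: k.
  have : `|0 - fine (a k)| <= e by near: k; exact: ca.
  rewrite sub0r normrN ger0_norm ?fine_ge0// => le.
  by rewrite -(fineK afk) lee_fin.
apply/fine_cvgP; split.
  have := h 1 ltr01; apply: filterS => k ak.
  by rewrite ge0_fin_numE// (le_lt_trans ak)// ltry.
apply/cvgrPdist_le => e e0; have := h e e0; apply: filterS => k ak.
have afk : a k \is a fin_num by rewrite ge0_fin_numE// (le_lt_trans ak)// ltry.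
by rewrite sub0r normrN ger0_norm ?fine_ge0// -lee_fin fineK.
Unshelve. all: end_near. Qed.

Lemma cvg_eq1 (T : Type) (U : nbhsType) (F : set_system T) (u v : T -> U) (l : U) :
  u =1 v -> u @ F --> l -> v @ F --> l.
Proof. by move=> /funext ->. Qed.

Section integral_tools.
Context d (T : measurableType d) (R : realType) (mu : {measure set T -> \bar R}).

Lemma ge0_dominated_cvg0 (f_ : nat -> T -> \bar R) (g : T -> \bar R) :
  (forall n, measurable_fun setT (f_ n)) -> (forall n x, 0 <= f_ n x)%E ->
  measurable_fun setT g -> (forall n x, f_ n x <= g x)%E ->
  (\int[mu]_x g x < +oo)%E -> {ae mu, forall x, f_ ^~ x @ \oo --> 0%E} ->
  (\int[mu]_x f_ n x)%E @[n --> \oo] --> 0%E.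
Proof.
move=> mf f0 mg fg gy cf.
have g0 x : (0 <= g x)%E by exact: le_trans (f0 0%N x) (fg _ _).
have ig : mu.-integrable setT g.
  by apply/integrableP; split => //; under eq_integral do rewrite gee0_abs//.
have [||||] := @dominated_convergence _ _ _ mu setT measurableT f_ (cst 0%E) g mf.
- exact: measurable_cst.
- by apply: filterS cf => x.
- exact: ig.
- by apply: aeW => x n _; rewrite gee0_abs.
- by rewrite integral0.
Qed.

Lemma ge0_le_integralT (f g : T -> \bar R) : measurable_fun setT f ->
  measurable_fun setT g -> (forall x, 0 <= f x)%E -> (forall x, f x <= g x)%E ->
  (\int[mu]_x f x <= \int[mu]_x g x)%E.
Proof. by move=> mf mg f0 fg; apply: ge0_le_integral. Qed.

Lemma ge0_integralDT (f g : T -> \bar R) : measurable_fun setT f ->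
  measurable_fun setT g -> (forall x, 0 <= f x)%E -> (forall x, 0 <= g x)%E ->
  (\int[mu]_x (f x + g x) = \int[mu]_x f x + \int[mu]_x g x)%E.
Proof. by move=> mf mg f0 g0; rewrite ge0_integralD. Qed.

Lemma ge0_integralZT (c : R) (f : T -> \bar R) : measurable_fun setT f ->
  (forall x, 0 <= f x)%E -> 0 <= c ->
  (\int[mu]_x (c%:E * f x) = c%:E * \int[mu]_x f x)%E.
Proof. by move=> mf f0 c0; rewrite ge0_integralZl. Qed.

Definition sqint (f : T -> R) : \bar R := (\int[mu]_x (f x ^+ 2)%:E)%E.

Lemma sqint_ge0 f : (0 <= sqint f)%E.
Proof. by apply: integral_ge0 => x _; rewrite lee_fin sqr_ge0. Qed.

Lemma sqintD (f g : T -> R) : measurable_fun setT f -> measurable_fun setT g ->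
  (sqint (fun x => f x + g x)%R <= 2%:E * (sqint f + sqint g))%E.
Proof.
move=> mf mg; rewrite /sqint -ge0_integralD//; last 4 first.
- by move=> x _; rewrite lee_fin sqr_ge0.
- by mfun.
- by move=> x _; rewrite lee_fin sqr_ge0.
- by mfun.
rewrite -ge0_integralZl//.
- apply: ge0_le_integralT => //; first by mfun.
  + by apply: measurable_funeM; apply: emeasurable_funD; mfun.
  + by move=> x; rewrite lee_fin sqr_ge0.
  + move=> x; rewrite -EFinD -EFinM lee_fin -subr_ge0.
    by rewrite (_ : _ - _ = (f x - g x) ^+ 2) ?sqr_ge0//; ring.
- by apply: emeasurable_funD; mfun.
- by move=> x _; rewrite -EFinD lee_fin addr_ge0// sqr_ge0.
Qed.

(** Dominated convergence with majorant the square of [f]: each integrand vanishes as soon as [x]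
    lies in [A n]. This reduces square-integrable functions to bounded ones of bounded support. *)
Lemma sqint_truncation (f : T -> R) (A : nat -> set T) :
  measurable_fun setT f -> (sqint f < +oo)%E -> (forall n, measurable (A n)) ->
  (forall x, \forall n \near \oo, A n x) ->
  sqint (fun x => f x - f x * \1_(A n) x) @[n --> \oo] --> 0%E.
Proof.
move=> mf fy mA cA.
apply: (@ge0_dominated_cvg0 (fun n x => ((f x - f x * \1_(A n) x) ^+ 2)%:E)
  (fun x => (f x ^+ 2)%:E)) => //.
- by move=> n; mfun; exact: measurable_indic.
- by move=> n x; rewrite lee_fin sqr_ge0.
- by mfun.
- move=> n x; rewrite lee_fin indicE; case: (x \in A n) => /=.
    by rewrite mulr1 subrr expr0n/= sqr_ge0.
  by rewrite mulr0 subr0.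
- apply: aeW => x; apply: cvg_near_cst; have := cA x; apply: filterS => n An.
  by rewrite indicE mem_set// mulr1 subrr expr0n.
Qed.

End integral_tools.

Lemma ge0_ae_lty d (T : measurableType d) (R : realType)
    (mu : {measure set T -> \bar R}) (f : T -> \bar R) :
  measurable_fun setT f -> (forall x, 0 <= f x)%E -> (\int[mu]_x f x < +oo)%E ->
  {ae mu, forall x, (f x < +oo)%E}.
Proof.
move=> mf f0 fy; have : mu.-integrable setT f.
  by apply/integrableP; split => //; under eq_integral do rewrite gee0_abs//.
move/(integrable_ae measurableT); apply: filterS => x /(_ I).
by rewrite ge0_fin_numE.
Qed.

(** * Continuity of translations in L2 *)

Section continuity_of_translation.
Context {R : realType}.
Local Notation leb := (@lebesgue_measure R).
Implicit Types (u : nat -> R).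

Lemma lebesgue_itv_lty (a b : R) : (leb `[a, b]%classic < +oo)%E.
Proof. by rewrite lebesgue_measure_itv/=; case: ifP => // _; rewrite -EFinB ltry. Qed.

(** Continuity gives pointwise convergence. Since [|u k| <= 1], all integrands live on
    [[-(L + 1), L + 1]] and are bounded by [2 * C], so dominated convergence applies. *)
Lemma translation_cvg_continuous (q : R -> R) (L C : R) u :
  continuous q -> (forall x, `|q x| <= C) -> (forall x, L < `|x| -> q x = 0) ->
  (forall k, `|u k| <= 1) -> u @ \oo --> 0 ->
  (\int[leb]_x `|q (x + u k) - q x|%:E)%E @[k --> \oo] --> 0%E.
Proof.
move=> cq qC q0 u1 cu.
have mq : measurable_fun setT q by exact: continuous_measurable_fun.
have C0 : 0 <= C by apply: le_trans (qC 0).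
have cqu (x : R) : `|q (x + u k) - q x| @[k --> \oo] --> 0.
  rewrite -[X in _ --> X](normr0 R) -(subrr (q x)); apply: cvg_norm.
  apply: cvgB; last exact: cvg_cst.
  have cx : x + u k @[k --> \oo] --> (x + 0 : R) by apply: cvgD => //; exact: cvg_cst.
  rewrite addr0 in cx.
  by apply: continuous_cvg => //; exact: cq.
pose E := `[(- (L + 1)), (L + 1)]%classic : set R.
apply: (@ge0_dominated_cvg0 _ (measurableTypeR R) R leb (fun k x => `|q (x + u k) - q x|%:E)
  (fun x => (2 * C)%:E * (\1_E x)%:E)%E).
- by move=> k; mfun; apply: (measurableT_comp mq); mfun.
- by move=> k x; rewrite lee_fin.
- apply: measurable_funeM; apply/measurable_EFinP; apply: measurable_indic.
  exact: measurable_itv.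
- move=> k x; rewrite indicE; case: (boolP (x \in E)) => xE /=.
    rewrite mule1 lee_fin (le_trans (ler_normB _ _))//.
    by rewrite mulr_natl mulr2n lerD.
  rewrite mule0 lee_fin; have xL : L + 1 < `|x|.
    rewrite ltNge; apply/negP => h; move/negP: xE; apply.
    by rewrite inE /E /= in_itv/= -ler_norml.
  rewrite !q0 ?subr0 ?normr0//.
    by apply: lt_trans xL; rewrite ltrDl.
  rewrite -(ltrD2r 1); apply: (lt_le_trans xL).
  rewrite -[X in `|X|](addrK (u k)) (le_trans (ler_normB _ _))// lerD2l.
  exact: u1.
- rewrite ge0_integralZl//.
  + rewrite integral_indic// ?setIT; last exact: measurable_itv.
    rewrite lte_mul_pinfty// ?lee_fin ?mulr_ge0//; exact: lebesgue_itv_lty.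
  + apply/measurable_EFinP; apply: measurable_indic; exact: measurable_itv.
  + by rewrite lee_fin mulr_ge0.
- apply: aeW => x /=; apply: cvg_EFin; first exact: nearW.
  exact: cqu.
Qed.

(** A continuous approximation on [[-(M + 1), M + 1]] is multiplied by the trapezoid [chi], equal to
    1 on [[-M, M]] and to 0 outside the larger interval. As [f] vanishes outside [[-M, M]], the
    cutoff does not increase the error. *)
Lemma integrable_approx_compact (f : R -> R) (M e : R) : 0 < e -> 0 <= M ->
  measurable_fun setT f -> (forall x, `|f x| <= M) ->
  (forall x, M < `|x| -> f x = 0) ->
  exists q : R -> R, [/\ continuous q, exists C : R, forall x, `|q x| <= C,
    exists L : R, forall x, L < `|x| -> q x = 0 &
    (\int[leb]_x `|f x - q x|%:E <= e%:E)%E].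
Proof.
move=> e0 M0 mf fM f0.
pose E := `[(- (M + 1)), (M + 1)]%classic : set R.
have mE : measurable E by exact: measurable_itv.
have Ey : (leb E < +oo)%E by exact: lebesgue_itv_lty.
have fE : leb.-integrable E (EFin \o f).
  apply: (@le_integrable _ _ _ leb E mE _ (EFin \o cst M)).
  - by apply: measurable_funTS; apply/measurable_EFinP.
  - by move=> x _ /=; rewrite lee_fin (le_trans (fM x))// ler_norm.
  - apply/integrableP; split; first by apply/measurable_EFinP.
    under eq_integral do rewrite /= ger0_norm//.
    by rewrite integral_cst// lte_mul_pinfty// lee_fin.
have [g [cg _ /cvge0P gcv]] := approximation_continuous_integrable mE Ey fE.
have /gcv : 0 < e by [].
have g0 : forall k, (0 <= \int[leb]_(z in E) `|(f z - g k z)%:E|)%E.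
  by move=> k; apply: integral_ge0.
move=> /(_ g0)[n _ /(_ n (leqnn n)) /= gn].
pose chi := fun x : R => Num.max 0 (Num.min 1 (M + 1 - `|x|)).
have cchi : continuous chi.
  have c1 : continuous (fun x : R => M + 1 - `|x|).
    move=> x; apply: cvgB; first exact: cvg_cst.
    exact: norm_continuous.
  have c2 : continuous ((cst 1 : R -> R) \min (fun x : R => M + 1 - `|x|)).
    by apply: min_fun_continuous => // x; exact: cvg_cst.
  by apply: max_fun_continuous => // x; exact: cvg_cst.
have chi01 x : 0 <= chi x <= 1.
  by rewrite /chi le_max lexx/= ge_max ler01 ge_min lexx.
have chi1 x : `|x| <= M -> chi x = 1.
  move=> xM; rewrite /chi min_l; last by rewrite lerBrDr addrC lerD2r.
  by rewrite max_r.
have chi0 x : M + 1 < `|x| -> chi x = 0.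
  by move=> xM; rewrite /chi max_l// ge_min subr_le0 (ltW xM) orbT.
pose q := fun x => g n x * chi x.
have cq : continuous q by move=> x; apply: cvgM; [exact: cg|exact: cchi].
exists q; split => //.
- have M1 : - (M + 1) <= M + 1 by lra.
  have cgn : {within `[(- (M + 1)), (M + 1)], continuous (fun x => `|q x|)}.
    apply: continuous_subspaceT => x; apply: cvg_norm; exact: cq.
  have [c _ hc] := EVT_max M1 cgn; exists `|q c| => x.
  have [xM|xM] := leP `|x| (M + 1).
    by apply: hc; rewrite in_itv/= -ler_norml.
  by rewrite {1}/q chi0// mulr0 normr0.
- by exists (M + 1) => x xM; rewrite /q chi0// mulr0.
- apply: le_trans gn.
  rewrite [leRHS]integral_mkcond; apply: ge0_le_integralT => //.
  + by mfun; exact: continuous_measurable_fun.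
  + apply/(measurable_restrictT _ mE)/measurable_funTS.
    apply: measurableT_comp => //; apply/measurable_EFinP.
    by mfun; exact: continuous_measurable_fun.
  + move=> x; rewrite patchE; case: ifPn => xE.
      rewrite lee_fin; have [xM|xM] := leP `|x| M.
        by rewrite /q chi1// mulr1.
      rewrite f0// !sub0r !normrN /q normrM ler_piMr//.
      by have /andP[a b] := chi01 x; rewrite ger0_norm.
    have xL : M + 1 < `|x|.
      rewrite ltNge; apply/negP => h; move/negP: xE; apply.
      by rewrite inE /E /= in_itv/= -ler_norml.
    rewrite /q chi0// mulr0 f0 ?subr0 ?normr0//.
    by apply: lt_trans xL; rewrite ltrDl.
Qed.

(** Three-term comparison with a continuous [q] of compact support: the translated error equals the
    untranslated one, and [3 * (e / 4) <= e]. *)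
Lemma translation_cvg_L1 (f : R -> R) (M : R) u : 0 <= M ->
  measurable_fun setT f -> (forall x, `|f x| <= M) ->
  (forall x, M < `|x| -> f x = 0) ->
  (forall k, `|u k| <= 1) -> u @ \oo --> 0 ->
  (\int[leb]_x `|f (x + u k) - f x|%:E)%E @[k --> \oo] --> 0%E.
Proof.
move=> M0 mf fM f0 u1 cu; apply/cvge0P.
  by move=> k; apply: integral_ge0 => x _; rewrite lee_fin.
move=> e e0; have e4 : 0 < e / 4 by rewrite divr_gt0.
have [q [cq [C qC] [L q0] fq]] := integrable_approx_compact e4 M0 mf fM f0.
have mq : measurable_fun setT q by exact: continuous_measurable_fun.
have /cvge0P := translation_cvg_continuous cq qC q0 u1 cu.
have h0 k : (0 <= \int[leb]_x `|q (x + u k) - q x|%:E)%E.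
  by apply: integral_ge0 => x _; rewrite lee_fin.
move=> /(_ h0 _ e4); apply: filterS => k hk.
have mt (h : R -> R) : measurable_fun setT h -> measurable_fun setT (fun x : R => h (x + u k)).
  by move=> mh; apply: (measurableT_comp mh); mfun.
have mft := mt _ mf; have mqt := mt _ mq.
apply: (@le_trans _ _ (\int[leb]_x (`|f (x + u k) - q (x + u k)|%:E +
    (`|q (x + u k) - q x|%:E + `|f x - q x|%:E)))%E).
  apply: ge0_le_integralT => //.
  - by mfun.
  - by apply: emeasurable_funD; [mfun|apply: emeasurable_funD; mfun].
  - move=> x; rewrite -!EFinD lee_fin (distrC (f x)).
    apply: (le_trans (ler_distD (q (x + u k)) _ _)); rewrite lerD2l.
    exact: ler_distD.
rewrite !ge0_integralDT; try (by mfun); try ge0.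
rewrite (@ge0_integral_translation1 _ (u k) (fun x => `|f x - q x|%:E)); try (by mfun); try ge0.
apply: (le_trans (leeD fq (leeD hk fq))).
by rewrite -!EFinD lee_fin; lra.
Qed.

(** [p] is truncated to the points where [|x|] and [|p x|] are at most [n]. For the truncated [f],
    the square of [f (x + u k) - f x] is at most [2 * n] times its modulus, so convergence in mean
    suffices. *)
Lemma translation_cvg1_bounded (p : R -> R) u : measurable_fun setT p ->
  (sqint leb p < +oo)%E -> (forall k, `|u k| <= 1) -> u @ \oo --> 0 ->
  sqint leb (fun x => p (x + u k) - p x) @[k --> \oo] --> 0%E.
Proof.
move=> mp py u1 cu.
apply/cvge0P; first by move=> k; exact: sqint_ge0.
move=> e e0.
pose A (n : nat) := [set x : R | `|x| <= n%:R] `&` [set x | `|p x| <= n%:R].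
have mA n : measurable (A n).
  apply: measurableI.
    rewrite -[X in measurable X]setTI; apply: measurable_fun_le => //.
  rewrite -[X in measurable X]setTI; apply: measurable_fun_le => //.
  exact: measabs.
have cA x : \forall n \near \oo, A n x.
  exists (maxn (Num.truncn `|x|).+1 (Num.truncn `|p x|).+1) => // n /=.
  rewrite geq_max => /andP[n1 n2]; split => /=.
    by rewrite ltW// (lt_le_trans (truncnS_gt _))// ler_nat.
  by rewrite ltW// (lt_le_trans (truncnS_gt _))// ler_nat.
have /cvge0P := @sqint_truncation _ (measurableTypeR R) R leb p A mp py mA cA.
have s0 n : (0 <= sqint leb (fun x => p x - p x * \1_(A n) x)%R)%E by exact: sqint_ge0.
have e12 : 0 < e / 12 by rewrite divr_gt0.
move=> /(_ s0 _ e12)[n _ /(_ n (leqnn n)) /= sn].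
pose f x := p x * \1_(A n) x.
have mf : measurable_fun setT f by rewrite /f; mfun; exact: measurable_indic.
have fM x : `|f x| <= n%:R.
  rewrite /f indicE; case: (boolP (x \in A n)); last by rewrite mulr0 normr0.
  by rewrite inE mulr1 => -[].
have f0 x : n%:R < `|x| -> f x = 0.
  move=> nx; rewrite /f indicE memNset ?mulr0// => -[/=].
  by rewrite leNgt nx.
have {}sn : (sqint leb (fun x => p x - f x)%R <= (e / 12)%:E)%E by exact: sn.
clearbody f.
have n0 : 0 <= n%:R :> R by [].
have /cvge0P := translation_cvg_L1 n0 mf fM f0 u1 cu.
have h0 k : (0 <= \int[leb]_x `|f (x + u k) - f x|%:E)%E.
  by apply: integral_ge0 => x _; rewrite lee_fin.
(* Chosen so that [2 * n * r <= e / 8]; the added 1 covers [n = 0]. The final budget is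
   [2 * (e / 12 + 2 * (e / 8 + e / 12)) = e]. *)
pose r := e / (8 * (2 * n%:R + 1)).
have r0 : 0 < r by rewrite divr_gt0// mulr_gt0// ltr_wpDl// mulr_ge0.
move=> /(_ h0 _ r0); apply: filterS => k hk.
have mt (h : R -> R) : measurable_fun setT h -> measurable_fun setT (fun x : R => h (x + u k)).
  by move=> mh; apply: (measurableT_comp mh); mfun.
have mft := mt _ mf; have mpt := mt _ mp.
have hf : (sqint leb (fun x => f (x + u k) - f x)%R <= (e / 8)%:E)%E.
  apply: (@le_trans _ _ (\int[leb]_x ((2 * n%:R)%:E * `|f (x + u k) - f x|%:E))%E).
    apply: ge0_le_integralT.
    - by mfun.
    - by apply: measurable_funeM; mfun.
    - by move=> x; rewrite lee_fin sqr_ge0.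
    - move=> x; rewrite -EFinM lee_fin -real_normK ?num_real// expr2 ler_pM//.
      rewrite mulr_natl mulr2n (le_trans (ler_normB _ _))// lerD//.
  rewrite ge0_integralZT; try (by mfun); try ge0.
  apply: (@le_trans _ _ ((2 * n%:R)%:E * r%:E)%E).
    by apply: lee_wpmul2l => //; rewrite lee_fin mulr_ge0.
  rewrite -EFinM lee_fin /r mulrA ler_pdivrMr ?mulr_gt0// ?ltr_wpDl ?mulr_ge0//.
  have : 0 <= n%:R * e :> R by rewrite mulr_ge0// ltW.
  nra.
have tp : (sqint leb (fun x => p (x + u k) - f (x + u k))%R <= (e / 12)%:E)%E.
  rewrite /sqint (@ge0_integral_translation1 _ (u k) (fun x => ((p x - f x) ^+ 2)%:E))//.
    by mfun.
  by move=> x; rewrite lee_fin sqr_ge0.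
rewrite (_ : (fun x => _) = (fun x => (p (x + u k) - f (x + u k)) +
   ((f (x + u k) - f x) + - (p x - f x)))); last by apply/funext => x; ring.
apply: (le_trans (sqintD _ _ _)); [by mfun|by mfun|].
apply: (@le_trans _ _ (2%:E * ((e / 12)%:E + 2%:E * ((e / 8)%:E + (e / 12)%:E)))%E).
  apply: lee_wpmul2l => //; apply: leeD => //.
  apply: (le_trans (sqintD _ _ _)); [by mfun|by mfun|].
  apply: lee_wpmul2l => //; apply: leeD => //.
  rewrite /sqint; under eq_integral do rewrite sqrrN.
  exact: sn.
by rewrite -!(EFinD, EFinM) lee_fin; lra.
Qed.

Lemma translation_cvg1 (p : R -> R) u : measurable_fun setT p ->
  (sqint leb p < +oo)%E -> u @ \oo --> 0 ->
  sqint leb (fun x => p (x + u k) - p x) @[k --> \oo] --> 0%E.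
Proof.
move=> mp py cu.
have [N _ uN] : \forall k \near \oo, `|u k| <= 1.
  move/cvgrPdist_le : cu => /(_ 1 ltr01); apply: filterS => k.
  by rewrite sub0r normrN.
rewrite -(cvg_shiftn N); apply: (@translation_cvg1_bounded p (fun k => u (k + N)%N)) => //.
  by move=> k; apply: uN; rewrite /= leq_addl.
by rewrite (cvg_shiftn N).
Qed.

Local Notation lam := (@lebesgue_cV R).

Lemma sqint_translation n (p : 'cV[R]_n -> R) (a : 'cV[R]_n) :
  measurable_fun setT p -> sqint (lam n) (fun v => p (v + a)) = sqint (lam n) p.
Proof.
move=> mp; rewrite /sqint (ge0_integral_translation a (f := fun v => (p v ^+ 2)%:E))//.
  by mfun.
by move=> x; rewrite lee_fin sqr_ge0.
Qed.

Lemma sqint_cV_cons n (p : 'cV[R]_n.+1 -> R) : measurable_fun setT p ->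
  sqint (lam n.+1) p = (\int[leb]_x sqint (lam n) (fun v => p (cV_cons (x, v))))%E.
Proof.
move=> mp; rewrite /sqint (@ge0_integral_cV_cons _ _ (fun v => (p v ^+ 2)%:E))//.
  by mfun.
by move=> x; rewrite lee_fin sqr_ge0.
Qed.

Lemma sqint_cV_cons2 n (p : 'cV[R]_n.+1 -> R) : measurable_fun setT p ->
  sqint (lam n.+1) p = (\int[lam n]_v sqint leb (fun x => p (cV_cons (x, v))))%E.
Proof.
move=> mp; rewrite /sqint (@ge0_integral_cV_cons2 _ _ (fun v => (p v ^+ 2)%:E))//.
  by mfun.
by move=> x; rewrite lee_fin sqr_ge0.
Qed.

Lemma measurable_cons2 n (p : 'cV[R]_n.+1 -> R) (v : 'cV[R]_n) :
  measurable_fun setT p -> measurable_fun setT (fun x : R => p (cV_cons (x, v))).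
Proof.
move=> mp; apply: (measurableT_comp mp).
apply: (measurableT_comp (@measurable_cV_cons R n)).
by apply/measurable_fun_pairP; split; mfun.
Qed.

Lemma measurable_cons1 n (p : 'cV[R]_n.+1 -> R) (x : R) :
  measurable_fun setT p -> measurable_fun setT (fun v : 'cV[R]_n => p (cV_cons (x, v))).
Proof.
move=> mp; apply: (measurableT_comp mp).
apply: (measurableT_comp (@measurable_cV_cons R n)).
by apply/measurable_fun_pairP; split; mfun.
Qed.

Lemma measurable_sqint_cons1 n (p : 'cV[R]_n.+1 -> R) : measurable_fun setT p ->
  measurable_fun setT (fun x => sqint (lam n) (fun v => p (cV_cons (x, v)))).
Proof.
move=> mp; apply: (@measurable_fun_fubini_tonelli_F _ _ _ _ _ _
  (fun xv => (p (@cV_cons R n xv) ^+ 2)%:E)).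
  by mfun; apply: measurableT_comp => //; exact: measurable_cV_cons.
by move=> x; rewrite lee_fin sqr_ge0.
Qed.

Lemma measurable_sqint_cons2 n (p : 'cV[R]_n.+1 -> R) : measurable_fun setT p ->
  measurable_fun setT (fun v => sqint leb (fun x => p (cV_cons (x, v)))).
Proof.
move=> mp; apply: (@measurable_fun_fubini_tonelli_G _ _ _ _ _ leb
  (fun xv => (p (@cV_cons R n xv) ^+ 2)%:E)).
  by mfun; apply: measurableT_comp => //; exact: measurable_cV_cons.
by move=> x; rewrite lee_fin sqr_ge0.
Qed.

Lemma sqintB_le d (T : measurableType d) (mu : {measure set T -> \bar R})
    (f g : T -> R) : measurable_fun setT f -> measurable_fun setT g ->
  (sqint mu (fun x => f x - g x)%R <= 2%:E * (sqint mu f + sqint mu g))%E.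
Proof.
move=> mf mg; have -> : sqint mu g = sqint mu (fun x => - g x).
  by rewrite /sqint; under [RHS]eq_integral do rewrite sqrrN.
by apply: sqintD => //; mfun.
Qed.

(** Induction on the dimension: a translation is one in the first coordinate followed by one in the
    others. For each, the slices converge almost everywhere, by the one-dimensional case or the
    induction hypothesis, and are dominated by 4 times the square integral of the slice of [p]. *)
Lemma translation_cvg n (p : 'cV[R]_n -> R) (v : nat -> 'cV[R]_n) :
  measurable_fun setT p -> (sqint (lam n) p < +oo)%E ->
  (forall i, v k i ord0 @[k --> \oo] --> 0) ->
  sqint (lam n) (fun x => p (x + v k) - p x) @[k --> \oo] --> 0%E.
Proof.
elim: n p v => [|n IH] p v mp py cv.
  have -> : (fun k => sqint (lam 0) (fun x => p (x + v k) - p x)) = cst 0%E.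
    apply/funext => k; rewrite /sqint; under eq_integral => x _.
      by rewrite (_ : x + v k = x) ?subrr ?expr0n//; [over|apply/matrixP => -[]].
    by rewrite integral0.
  exact: cvg_cst.
pose a k : R := v k ord0 ord0; pose w k : 'cV[R]_n := (cV_uncons (v k)).2.
have vE k : v k = cV_cons (a k, w k) by rewrite -[LHS]cV_unconsK.
have ca : a @ \oo --> 0 by exact: cv.
have cw i : w k i ord0 @[k --> \oo] --> 0.
  rewrite (_ : (fun k => _) = (fun k => v k (@rshift 1 n i) ord0)).
    exact: cv.
  by apply/funext => k; rewrite /w mxE.
have mpa (u : 'cV[R]_n.+1) : measurable_fun setT (fun x : 'cV[R]_n.+1 => p (x + u)).
  by apply: (measurableT_comp mp); exact: measurable_translation.
pose P (u x : 'cV[R]_n.+1) := p (x + u) - p x.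
have mP (u : 'cV[R]_n.+1) : measurable_fun setT (P u).
  by rewrite /P; exact: (measB (mpa u) mp).
have c1 : (\int[lam n]_y sqint leb (fun x => P (cV_cons (a k, 0%R)) (cV_cons (x, y))))%E
    @[k --> \oo] --> 0%E.
  apply: (@ge0_dominated_cvg0 _ _ _ _ _ (fun y => 4%:E * sqint leb (fun x => p (cV_cons (x,
      y))))%E).
  - by move=> k; exact: (measurable_sqint_cons2 (mP _)).
  - by move=> k x; exact: sqint_ge0.
  - by apply: measurable_funeM; exact: measurable_sqint_cons2.
  - move=> k y; have m1 := measurable_cons2 y mp.
    have m2 : measurable_fun setT (fun x : R => p (cV_cons (x + a k, y))).
      by apply: (measurableT_comp m1); mfun.
    have -> : (fun x => P (cV_cons (a k, 0)) (cV_cons (x, y))) =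
        (fun x => p (cV_cons (x + a k, y)) - p (cV_cons (x, y))).
      by apply/funext => x; rewrite /P cV_consD addr0.
    apply: (le_trans (@sqintB_le _ (measurableTypeR R) leb _ _ m2 m1)).
    have -> : sqint leb (fun x => p (cV_cons (x + a k, y))) = sqint leb (fun x => p (cV_cons (x,
        y))).
      apply: (@ge0_integral_translation1 _ (a k) (fun x => (p (cV_cons (x, y)) ^+ 2)%:E)).
        by mfun.
      by ge0.
    by rewrite -mule2n -mule_natl muleA -EFinM (_ : 2 * 2%:R = 4 :> R)//; lra.
  - rewrite (ge0_integralZT _ (measurable_sqint_cons2 mp))//; last by move=> ?; exact: sqint_ge0.
    by rewrite -sqint_cV_cons2// lte_mul_pinfty.
  - have := ge0_ae_lty (measurable_sqint_cons2 mp) (fun=> sqint_ge0 _ _).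
    move=> /(_ (lam n)); rewrite -sqint_cV_cons2// => /(_ py); apply: filterS => y yy.
    apply: cvg_eq1 (translation_cvg1 (measurable_cons2 y mp) yy ca).
    by move=> k; congr sqint; apply/funext => x; rewrite /P cV_consD addr0.
have c2 : (\int[leb]_x sqint (lam n) (fun y => P (cV_cons (0%R, w k)) (cV_cons (x, y))))%E
    @[k --> \oo] --> 0%E.
  apply: (@ge0_dominated_cvg0 _ (measurableTypeR R) _ leb _ (fun x =>
      4%:E * sqint (lam n) (fun y => p (cV_cons (x, y))))%E).
  - by move=> k; exact: (measurable_sqint_cons1 (mP _)).
  - by move=> k x; exact: sqint_ge0.
  - by apply: measurable_funeM; exact: measurable_sqint_cons1.
  - move=> k x; have m1 := measurable_cons1 x mp.
    have m2 : measurable_fun setT (fun y : 'cV[R]_n => p (cV_cons (x, y + w k))).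
      by apply: (measurableT_comp m1); exact: measurable_translation.
    have -> : (fun y => P (cV_cons (0, w k)) (cV_cons (x, y))) =
        (fun y => p (cV_cons (x, y + w k)) - p (cV_cons (x, y))).
      by apply/funext => y; rewrite /P cV_consD addr0.
    apply: (le_trans (sqintB_le _ m2 m1)).
    rewrite (sqint_translation (w k) m1).
    by rewrite -mule2n -mule_natl muleA -EFinM (_ : 2 * 2%:R = 4 :> R)//; lra.
  - rewrite (@ge0_integralZT _ (measurableTypeR R) R leb _ _ (measurable_sqint_cons1 mp))//;
      last by move=> ?; exact: sqint_ge0.
    by rewrite -sqint_cV_cons// lte_mul_pinfty.
  - have := @ge0_ae_lty _ (measurableTypeR R) R leb _ (measurable_sqint_cons1 mp) (fun=>
      sqint_ge0 _ _).
    rewrite -sqint_cV_cons// => /(_ py); apply: filterS => x xx.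
    apply: cvg_eq1 (IH _ w (measurable_cons1 x mp) xx cw).
    by move=> k; congr sqint; apply/funext => y; rewrite /P cV_consD addr0.
pose f1 k := sqint (lam n.+1) (P (cV_cons (a k, 0))).
pose f2 k := sqint (lam n.+1) (P (cV_cons (0, w k))).
have {}c1 : f1 @ \oo --> 0%E.
  by apply: cvg_eq1 c1 => k; rewrite /f1 sqint_cV_cons2.
have {}c2 : f2 @ \oo --> 0%E.
  by apply: cvg_eq1 c2 => k; rewrite /f2 sqint_cV_cons.
apply: (@squeeze_cvge _ _ _ _ (cst 0%E) _ (fun k => 2%:E * (f1 k + f2 k))%E _ 0%E); last first.
- have c12 : (fun k => f1 k + f2 k)%E @ \oo --> 0%E.
    by rewrite -[X in _ --> X]adde0; apply: cvgeD.
  by rewrite -[X in _ --> X](mule0 2%:E); apply: cvgeZl.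
- exact: cvg_cst.
apply: nearW => k; rewrite sqint_ge0 andTb.
rewrite (_ : (fun x => _) = (fun x => P (cV_cons (a k, 0)) (x + cV_cons (0, w k)) +
   P (cV_cons (0, w k)) x)); last first.
  apply/funext => x; rewrite /P.
  have -> : x + v k = x + cV_cons (0, w k) + cV_cons (a k, 0).
    by rewrite vE -addrA cV_consD add0r addr0.
  by ring.
have mPa : measurable_fun setT (fun x : 'cV[R]_n.+1 => P (cV_cons (a k, 0)) (x + cV_cons (0, w k))).
  by apply: (measurableT_comp (mP _)); exact: measurable_translation.
apply: (le_trans (sqintD _ mPa (mP _))).
by rewrite (sqint_translation (cV_cons (0, w k)) (mP _)).
Qed.

End continuity_of_translation.

(** * Continuity of elementary expressions *)

Section continuity.
Context {R : realType}.
Implicit Types f g : R -> R.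

Lemma ctsD (x : R) f g : continuous_at x f -> continuous_at x g ->
  continuous_at x (fun x => f x + g x).
Proof. exact: cvgD. Qed.

Lemma ctsN (x : R) f : continuous_at x f -> continuous_at x (fun x => - f x).
Proof. exact: cvgN. Qed.

Lemma ctsM (x : R) f g : continuous_at x f -> continuous_at x g ->
  continuous_at x (fun x => f x * g x).
Proof. exact: cvgM. Qed.

Lemma ctsX n (x : R) f : continuous_at x f -> continuous_at x (fun x => f x ^+ n).
Proof.
move=> cf; elim: n => [|n IH].
  by under eq_fun do rewrite expr0; exact: cvg_cst.
rewrite (_ : (fun x => _) = (fun x => f x * f x ^+ n)); first exact: ctsM.
by apply/funext => y; rewrite exprS.
Qed.

Lemma cts_comp (x : R) f g : continuous f -> continuous_at x g ->
  continuous_at x (fun x => f (g x)).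
Proof. by move=> cf cg; exact: (continuous_comp cg (cf _)). Qed.

End continuity.

Ltac cts_step :=
  match goal with
  | |- continuous_at _ (fun _ => ?c) => exact: cvg_cst
  | |- continuous_at _ (fun x => Algebra.add _ _) => apply: ctsD
  | |- continuous_at _ (fun x => Algebra.opp _) => apply: ctsN
  | |- continuous_at _ (fun x => GRing.mul _ _) => apply: ctsM
  | |- continuous_at _ (fun x => GRing.exp _ _) => apply: ctsX
  | |- continuous_at _ (fun x => expR _) => apply: (cts_comp (@continuous_expR _))
  | |- continuous_at _ (fun x => cos _) => apply: (cts_comp (@continuous_cos _))
  | |- continuous_at _ (fun x => sin _) => apply: (cts_comp (@continuous_sin _))
  | |- continuous_at _ (fun x => x) => exact: cvg_id
  | |- continuous_at _ (GRing.mul _) => exact: mulrl_continuous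
  | |- continuous_at _ _ => exact: norm_continuous
  end.

Ltac cts := intro; repeat cts_step.

(** * The Poisson kernel *)

Section poisson_kernel1.
Context {R : realType}.
Local Notation leb := (@lebesgue_measure R).

Lemma ge0_integral_opp (f : R -> \bar R) : measurable_fun setT f ->
  (forall x, 0 <= f x)%E -> (\int[leb]_x f (- x)%R = \int[leb]_x f x)%E.
Proof.
move=> mf f0.
have mN : measurable_fun setT (fun x : measurableTypeR R => (- x : measurableTypeR R)).
  by mfun.
by rewrite [RHS](ge0_integral_preserving (m1 := leb) mN)// => A; exact: lebesgue_measureN.
Qed.

(** The summand 1 and [|c| <= 1] keep the integrand nonnegative, as the fundamental theorem of
    calculus on a half-line is applied here to nonnegative functions. [F] is the explicit primitive,
    tending to 0 at infinity. *)
Lemma integral_exp_cos_half (e b c : R) : 0 < e -> `|c| <= 1 ->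
  (\int[leb]_(x in `[0%R, +oo[) (expR (- (e * x)) * (1 + c * cos (b * x)))%:E =
   (e^-1 + c * (e / (e ^+ 2 + b ^+ 2)))%:E)%E.
Proof.
move=> e0 c1; set D := e ^+ 2 + b ^+ 2.
have D0 : D != 0 by rewrite gt_eqF// /D ltr_wpDr ?sqr_ge0// exprn_gt0.
pose F (x : R) := expR (- (e * x)) * (- e^-1 + (c / D) * (b * sin (b * x) - e * cos (b * x))).
have dF (x : R) : is_derive x 1 F (expR (- (e * x)) * (1 + c * cos (b * x))).
  have d1 : is_derive x 1 (fun x : R => - (e * x)) (- e).
    rewrite (_ : (fun x => _) = (fun x : R => (- e) * x)); last first.
      by apply/funext => y; rewrite mulNr.
    by apply: is_derive_eq; rewrite /= -[- e *: 1]/(- e * 1) mulr1.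
  have d2 : is_derive x 1 (fun x : R => b * x) b.
    by apply: is_derive_eq; rewrite /= -[b *: 1]/(b * 1) mulr1.
  have d3 : is_derive x 1 (fun x : R => expR (- (e * x))) (expR (- (e * x)) * - e).
    exact: (is_derive1_comp (is_derive_expR _) d1).
  have d4 : is_derive x 1 (fun x : R => sin (b * x)) (cos (b * x) * b).
    exact: (is_derive1_comp (is_derive_sin _) d2).
  have d5 : is_derive x 1 (fun x : R => cos (b * x)) (- sin (b * x) * b).
    exact: (is_derive1_comp (is_derive_cos _) d2).
  have d6 : is_derive x 1 (fun x : R => b * sin (b * x) - e * cos (b * x))
      (b * (cos (b * x) * b) - e * (- sin (b * x) * b)).
    by apply: is_derive_eq.
  have d7 : is_derive x 1 (fun x : R => - e^-1 + (c / D) * (b * sin (b * x) - e * cos (b * x)))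
      ((c / D) * (b * (cos (b * x) * b) - e * (- sin (b * x) * b))).
    apply: (is_derive_eq (is_deriveD (is_derive_cst (- e^-1) x 1) (is_deriveZ (c / D) d6))).
    by rewrite add0r.
  apply: is_derive_eq (is_deriveM d3 d7) _.
  rewrite -[LHS]/(expR (- (e * x)) * (c / D * (b * (cos (b * x) * b) -
    e * (- sin (b * x) * b))) + (- e^-1 + c / D * (b * sin (b * x) -
    e * cos (b * x))) * (expR (- (e * x)) * - e)).
  have e0' : e != 0 by rewrite gt_eqF.
  by move: D0; rewrite /D => D0; field; rewrite D0 e0'.
have -> : (e^-1 + c * (e / D))%:E = (0%:E - (F 0)%:E)%E.
  rewrite -EFinB sub0r /F !mulr0 oppr0 expR0 sin0 cos0; congr EFin.
  by field; rewrite D0 gt_eqF.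
apply: ge0_continuous_FTC2y.
- move=> x _; rewrite mulr_ge0 ?expR_ge0//.
  have : `|c * cos (b * x)| <= 1.
    by rewrite normrM mulr_ile1// ler_norml cos_geN1 cos_le1.
  by rewrite ler_norml => /andP[]; lra.
- by apply: continuous_subspaceT; cts.
- pose C := e^-1 + `|c / D| * (`|b| + `|e|).
  have C0 : 0 <= C by rewrite addr_ge0// ?invr_ge0 ?(ltW e0)// mulr_ge0// addr_ge0.
  have FC x : `|F x| <= C * expR (- (e * x)).
    rewrite /F normrM ger0_norm ?expR_ge0// mulrC ler_wpM2r ?expR_ge0//.
    rewrite (le_trans (ler_normD _ _))// normrN ger0_norm ?invr_ge0 ?(ltW e0)// lerD2l.
    rewrite normrM ler_wpM2l// (le_trans (ler_normB _ _))// !normrM lerD//.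
      by rewrite ler_piMr// ler_norml sin_geN1 sin_le1.
    by rewrite ler_piMr// ler_norml cos_geN1 cos_le1.
  have cE : C * expR (- (e * x)) @[x --> +oo] --> 0.
    rewrite -(mulr0 C); apply: cvgM; first exact: cvg_cst.
    apply: (@cvg_comp _ _ _ (fun x => e * x) (fun x => expR (- x))); last exact: cvgr_expR.
    by apply: gt0_cvgMry => //; exact: cvg_id.
  apply/cvgrPdist_le => d d0; move/cvgrPdist_le : cE => /(_ d d0).
  apply: filterS => x; rewrite !sub0r !normrN => h; apply: le_trans (FC x) _.
  by apply: le_trans h; rewrite ler_norm.
- by move=> x _; have [] := dF x.
- apply: cvg_at_right_filter.
  by have [/derivable1_diffP/differentiable_continuous] := dF 0.
- by move=> x _; rewrite derive1E; have [_ ->] := dF x.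
Qed.

(** Averaging over [x] and [-x] replaces [cos (b * x + t)] by [cos t * cos (b * x)], which is even,
    and leaves twice the integral over the half-line. *)
Lemma integral_exp_abs (e b t : R) : 0 < e ->
  (\int[leb]_x (expR (- (e * `|x|)) * (1 + cos (b * x + t)))%:E =
   (2 / e + cos t * (2 * e / (e ^+ 2 + b ^+ 2)))%:E)%E.
Proof.
move=> e0.
pose f (x : R) := expR (- (e * `|x|)) * (1 + cos (b * x + t)).
pose h (x : R) := expR (- (e * `|x|)) * (1 + cos t * cos (b * x)).
have mf : measurable_fun setT f by rewrite /f; mfun.
have mh : measurable_fun setT h by rewrite /h; mfun.
have cb (x y : R) : -1 <= cos x * cos y <= 1.
  by rewrite -ler_norml normrM mulr_ile1// ler_norml cos_geN1 cos_le1.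
have f0 x : 0 <= f x.
  by have := cos_geN1 (b * x + t); rewrite /f mulr_ge0 ?expR_ge0//; lra.
have h0 x : 0 <= h x.
  by have /andP[] := cb t (b * x); rewrite /h mulr_ge0 ?expR_ge0//; lra.
have fh x : f x + f (- x) = h x + h x.
  by rewrite /f /h normrN mulrN !cosD cosN sinN; ring.
have E : (\int[leb]_x (f x)%:E = \int[leb]_x (h x)%:E)%E.
  have e1 : (\int[leb]_x (f x)%:E + \int[leb]_x (f x)%:E =
             \int[leb]_x (h x)%:E + \int[leb]_x (h x)%:E)%E.
    rewrite -{2}(@ge0_integral_opp (fun x => (f x)%:E)); [|by mfun|by move=> x; rewrite lee_fin].
    have mfN : measurable_fun setT (fun x : R => f (- x)).
      by apply: (measurableT_comp mf); mfun.
    rewrite -!ge0_integralDT; try (by mfun); try (by move=> x; rewrite lee_fin).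
    by apply: eq_integral => x _; rewrite -!EFinD fh.
  have i0 (u : R -> R) : (forall x, 0 <= u x) -> (0 <= \int[leb]_x (u x)%:E)%E.
    by move=> u0; apply: integral_ge0 => x _; rewrite lee_fin.
  move: e1 (i0 _ f0) (i0 _ h0).
  case: (\int[leb]_x (f x)%:E)%E => [r| |]//; case: (\int[leb]_x (h x)%:E)%E => [s| |]//=.
  by rewrite -!EFinD => -[rs] _ _; congr EFin; lra.
rewrite -[LHS]/(\int[leb]_x (f x)%:E)%E E ge0_symfun_integralT//; last 2 first.
- by rewrite /h; cts.
- by move=> x; rewrite /h /= normrN mulrN cosN.
rewrite (_ : [set x | _] = `[0, +oo[%classic); last first.
  by apply/seteqP; split => x/=; rewrite in_itv/= andbT.
transitivity (2%:E * (e^-1 + cos t * (e / (e ^+ 2 + b ^+ 2)))%:E)%E.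
  rewrite -(@integral_exp_cos_half e b (cos t) e0); last first.
    by rewrite ler_norml cos_geN1 cos_le1.
  congr (_ * _)%E.
  by apply: eq_integral => x; rewrite inE/= in_itv/= andbT => x0; rewrite /h ger0_norm.
by rewrite -EFinM; congr EFin; ring.
Qed.

(** The Fourier transform of [exp(- e |x|)]: a kernel of mass 1 and width proportional to [e]. *)
Definition poisson1 (e x : R) : R := 2 * e / (e ^+ 2 + (2 * pi * x) ^+ 2).

Lemma continuous_poisson1 e : 0 < e -> continuous (poisson1 e).
Proof.
move=> e0 x; apply: ctsM; first exact: cvg_cst.
have c : continuous (fun x : R => e ^+ 2 + (2 * pi * x) ^+ 2) by cts.
apply: cvgV; last exact: c.
by rewrite gt_eqF// ltr_wpDr ?sqr_ge0// exprn_gt0.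
Qed.

Lemma measurable_poisson1 e : 0 < e -> measurable_fun setT (poisson1 e).
Proof. by move=> e0; apply: continuous_measurable_fun; exact: continuous_poisson1. Qed.

Lemma poisson1_ge0 e x : 0 < e -> 0 <= poisson1 e x.
Proof.
move=> e0; rewrite /poisson1 divr_ge0// ?mulr_ge0// ?(ltW e0)//.
by rewrite addr_ge0// sqr_ge0.
Qed.

Lemma poisson1_le e x : 0 < e -> poisson1 e x <= 2 / e.
Proof.
move=> e0; rewrite /poisson1 ler_pdivrMr; last by rewrite ltr_wpDr ?sqr_ge0// exprn_gt0.
rewrite mulrDr expr2 [2 / e * (e * e)]mulrA divfK ?gt_eqF// lerDl mulr_ge0 ?sqr_ge0//.
by rewrite divr_ge0// ltW.
Qed.

Lemma poisson1_scale e x : 0 < e -> e * poisson1 e (e * x) = poisson1 1 x.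
Proof.
move=> e0; rewrite /poisson1 expr1n mulr1 (mulrCA (2 * pi)).
move: (2 * pi * x) => y.
have -> : e ^+ 2 + (e * y) ^+ 2 = e ^+ 2 * (1 + y ^+ 2) by ring.
have y0 : 1 + y ^+ 2 != 0 by rewrite gt_eqF// ltr_wpDr ?sqr_ge0.
have e0' : e != 0 by rewrite gt_eqF.
by field; rewrite y0 e0'.
Qed.

Lemma integral_poisson1 : (\int[leb]_x (poisson1 1 x)%:E = 1)%E.
Proof.
have p0 : 0 < 2 * pi :> R by rewrite mulr_gt0// pi_gt0.
have i0 : 0 < (2 * pi)^-1 :> R by rewrite invr_gt0.
have mp := measurable_poisson1 (ltr01 : 0 < 1 :> R).
rewrite (ge0_integral_scale i0); [|by mfun|by move=> x; rewrite lee_fin poisson1_ge0].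
under eq_integral => x _.
  rewrite (_ : poisson1 1 ((2 * pi)^-1 * x) = 2 * (oneDsqr x)^-1); last first.
    by rewrite /poisson1 /oneDsqr mulVKf ?gt_eqF// expr1n mulr1.
  over.
have mV : measurable_fun setT (fun x : R => (oneDsqr x)^-1).
  by apply: continuous_measurable_fun; exact: continuous_oneDsqrV.
have V0 (x : R) : 0 <= (oneDsqr x)^-1 by rewrite invr_ge0 (le_trans ler01)// oneDsqr_ge1.
under eq_integral do rewrite EFinM.
rewrite (@ge0_integralZT _ (measurableTypeR R) R leb 2 (fun x => ((oneDsqr x)^-1)%:E));
    last 3 first.
- by mfun.
- by move=> x; rewrite lee_fin.
- by [].
rewrite (@ge0_symfun_integralT R (fun x => (oneDsqr x)^-1)) //; last 2 first.
- exact: continuous_oneDsqrV.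
- by move=> x; rewrite /= /oneDsqr sqrrN.
rewrite (_ : [set x | _] = `[0, +oo[%classic); last first.
  by apply/seteqP; split => x/=; rewrite in_itv/= andbT.
rewrite integral0y_oneDsqr -!EFinM; congr EFin.
move: (gt_eqF (pi_gt0 R)); move: (pi : R) => y /negbT y0.
by field; rewrite y0.
Qed.

End poisson_kernel1.

Section poisson_kernel.
Context {R : realType}.
Local Notation leb := (@lebesgue_measure R).
Local Notation lam := (@lebesgue_cV R).

Definition dot n (x y : 'cV[R]_n) : R := \sum_(i < n) x i ord0 * y i ord0.

(** A product weight rather than a radial one: its transform is again a product, so every fact about
    it follows by induction on the dimension. *)
Definition expw (e : R) n (x : 'cV[R]_n) : R :=
  \prod_(i < n) expR (- (e * `|x i ord0|)).

Definition poisson (e : R) n (r : 'cV[R]_n) : R := \prod_(i < n) poisson1 e (r i ord0).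

Lemma cV_cons0 n (x : R) (v : 'cV[R]_n) : cV_cons (x, v) ord0 ord0 = x.
Proof.
by rewrite (_ : ord0 = @lshift 1 n ord0) ?(@col_mxEu _ 1 n 1) ?mxE//; exact: val_inj.
Qed.

Lemma cV_consS n (x : R) (v : 'cV[R]_n) i : cV_cons (x, v) (lift ord0 i) ord0 = v i ord0.
Proof.
by rewrite (_ : lift ord0 i = @rshift 1 n i) ?(@col_mxEd _ 1 n 1)//; exact: val_inj.
Qed.

Lemma dot_cons n x y (v w : 'cV[R]_n) : dot (cV_cons (x, v)) (cV_cons (y, w)) = x * y + dot v w.
Proof.
rewrite /dot big_ord_recl !cV_cons0; congr (_ + _).
by apply: eq_bigr => i _; rewrite !cV_consS.
Qed.

Lemma expw_cons e n x (v : 'cV[R]_n) : expw e (cV_cons (x, v)) = expR (- (e * `|x|)) * expw e v.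
Proof.
rewrite /expw big_ord_recl !cV_cons0; congr (_ * _).
by apply: eq_bigr => i _; rewrite !cV_consS.
Qed.

Lemma poisson_cons e n x (v : 'cV[R]_n) : poisson e (cV_cons (x, v)) = poisson1 e x * poisson e v.
Proof.
rewrite /poisson big_ord_recl !cV_cons0; congr (_ * _).
by apply: eq_bigr => i _; rewrite !cV_consS.
Qed.

Lemma measurable_dot n d (T : measurableType d) (f g : T -> 'cV[R]_n) :
  measurable_fun setT f -> measurable_fun setT g ->
  measurable_fun setT (fun x => dot (f x) (g x)).
Proof.
move=> mf mg; apply: meassum => i _.
by apply: measM; [exact: (measurableT_comp (measurable_entry i ord0) mf)
  |exact: (measurableT_comp (measurable_entry i ord0) mg)].
Qed.

Lemma measurable_expw e n : measurable_fun setT (@expw e n).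
Proof.
apply: measprod => i _; apply: measexp; apply: measN; apply: measM; first exact: measurable_cst.
by apply: measabs; exact: measurable_entry.
Qed.

Lemma measurable_poisson e n : 0 < e -> measurable_fun setT (@poisson e n).
Proof.
move=> e0; apply: measprod => i _.
exact: (measurableT_comp (measurable_poisson1 e0) (measurable_entry i ord0)).
Qed.

Lemma expw_ge0 e n (x : 'cV[R]_n) : 0 <= expw e x.
Proof. by apply: prodr_ge0 => i _; exact: expR_ge0. Qed.

Lemma poisson_ge0 e n (x : 'cV[R]_n) : 0 < e -> 0 <= poisson e x.
Proof. by move=> e0; apply: prodr_ge0 => i _; exact: poisson1_ge0. Qed.

Lemma poisson_le e n (x : 'cV[R]_n) : 0 < e -> poisson e x <= (2 / e) ^+ n.
Proof.
move=> e0; rewrite -[n in _ ^+ n]card_ord -prodr_const; apply: ler_prod => i _.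
by rewrite poisson1_ge0//= poisson1_le.
Qed.

Lemma ge0_integral_cV0 (f : 'cV[R]_0 -> \bar R) : (\int[lam 0]_x f x = f 0%R)%E.
Proof.
rewrite /= integral_dirac//.
  by rewrite diracT mul1e.
move=> _ Y mY; have [f0|f0] := pselect (Y (f 0)).
  rewrite (_ : _ `&` _ = setT)//; apply/seteqP; split => // x _; split => //=.
  by rewrite (_ : x = 0)//; apply/matrixP => -[].
rewrite (_ : _ `&` _ = set0)//; apply/seteqP; split => // x [_ /=].
by rewrite (_ : x = 0)//; apply/matrixP => -[].
Qed.

Lemma integral_exp_abs0 (e : R) : 0 < e ->
  (\int[leb]_x (expR (- (e * `|x|)))%:E = (2 / e)%:E)%E.
Proof.
move=> e0; have := integral_exp_abs 0 (pi / 2) e0.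
rewrite cos_pihalf mul0r addr0 => <-; apply: eq_integral => x _.
by rewrite mul0r add0r cos_pihalf addr0 mulr1.
Qed.

(** Peeling off a coordinate moves its share of the dot product into the phase, which is why the
    induction carries an arbitrary [t]. *)
Lemma integral_expw_cos (e : R) n (r : 'cV[R]_n) (t : R) : 0 < e ->
  (\int[lam n]_x (expw e x * (1 + cos (2 * pi * dot x r + t)))%:E =
   ((2 / e) ^+ n + cos t * poisson e r)%:E)%E.
Proof.
move=> e0; elim: n r t => [|n IH] r t.
  by rewrite ge0_integral_cV0 /expw /dot /poisson !big_ord0 mulr0 add0r mul1r mulr1 expr0.
have c1 y : 0 <= 1 + cos y :> R by have := cos_geN1 y; lra.
rewrite -(cV_unconsK r); case: (cV_uncons r) => r0 v.
rewrite ge0_integral_cV_cons; last 2 first.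
- apply: measEFin; apply: measM; first exact: measurable_expw.
  mfun; apply: measurable_dot; mfun.
- by move=> x; rewrite lee_fin mulr_ge0// expw_ge0.
set C := (2 / e) ^+ n; set K := poisson e v.
have KC : 0 <= C - K by rewrite subr_ge0 poisson_le.
have K0 : 0 <= K by exact: poisson_ge0.
(* [C + K cos] is split as [(C - K) + K (1 + cos)]: since [0 <= K <= C], both summands stay
   nonnegative. *)
transitivity (\int[leb]_x ((C - K)%:E * (expR (- (e * `|x|)))%:E +
   K%:E * (expR (- (e * `|x|)) * (1 + cos (2 * pi * r0 * x + t)))%:E))%E.
  apply: eq_integral => x _.
  transitivity (\int[lam n]_w ((expR (- (e * `|x|)))%:E *
     (expw e w * (1 + cos (2 * pi * dot w v + (2 * pi * r0 * x + t))))%:E))%E.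
    apply: eq_integral => w _; rewrite expw_cons dot_cons -EFinM; congr EFin.
    by rewrite mulrA; congr (_ * (1 + cos _)); ring.
  rewrite ge0_integralZT; last 3 first.
  - apply: measEFin; apply: measM; first exact: measurable_expw.
    mfun; apply: measurable_dot; mfun.
  - by move=> w; rewrite lee_fin mulr_ge0// expw_ge0.
  - exact: expR_ge0.
  by rewrite IH -!EFinM -EFinD; congr EFin; rewrite -/C -/K; ring.
rewrite ge0_integralDT; last 4 first.
- by mfun.
- by mfun.
- by move=> x; rewrite -EFinM lee_fin mulr_ge0// expR_ge0.
- by move=> x; rewrite -EFinM lee_fin !mulr_ge0// expR_ge0.
rewrite !ge0_integralZT; try (by mfun);
  try (by move=> x; rewrite lee_fin ?mulr_ge0 ?expR_ge0); try done.
rewrite integral_exp_abs0// integral_exp_abs// -!EFinM -EFinD; congr EFin.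
rewrite (exprS _ n) -/C poisson_cons -/K /poisson1.
by ring.
Qed.

Lemma integral_expw (e : R) n : 0 < e ->
  (\int[lam n]_x (expw e x)%:E = ((2 / e) ^+ n)%:E)%E.
Proof.
move=> e0; have := integral_expw_cos (0 : 'cV[R]_n) (pi / 2) e0.
rewrite cos_pihalf mul0r addr0 => <-; apply: eq_integral => x _.
rewrite /dot big1 ?mulr0 ?add0r ?cos_pihalf ?addr0 ?mulr1// => i _.
by rewrite mxE mulr0.
Qed.

(** Trades the shrinking kernel for a fixed one, so that the limit [e -> 0] acts on the argument of
    [H] and dominated convergence becomes available. *)
Lemma integral_poisson_scale (e : R) n (H : 'cV[R]_n -> \bar R) : 0 < e ->
  measurable_fun setT H -> (forall x, 0 <= H x)%E ->
  (\int[lam n]_r ((poisson e r)%:E * H r) = \int[lam n]_r ((poisson 1 r)%:E * H (e *: r)%R))%E.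
Proof.
move=> e0; elim: n H => [|n IH] H mH H0.
  by rewrite !ge0_integral_cV0 /poisson !big_ord0 scaler0.
have mZ m : measurable_fun setT (fun r : 'cV[R]_m => e *: r).
  apply/measurable_fun_mxP => i j; rewrite (_ : (fun x => _) = (fun x : 'cV[R]_m => e * x i j)).
    by apply: measM; [exact: measurable_cst|exact: measurable_entry].
  by apply/funext => x; rewrite mxE.
have mP m (a : R) : 0 < a -> measurable_fun setT (fun r : 'cV[R]_m => (poisson a r)%:E).
  by move=> a0; apply: measEFin; exact: measurable_poisson.
have mPH m (a : R) (K : 'cV[R]_m -> \bar R) : 0 < a -> measurable_fun setT K ->
    measurable_fun setT (fun r : 'cV[R]_m => ((poisson a r)%:E * K r)%E).
  by move=> a0 mK; apply: emeasurable_funM => //; exact: mP.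
rewrite ge0_integral_cV_cons; last 2 first.
- exact: mPH.
- by move=> x; rewrite mule_ge0// lee_fin poisson_ge0.
rewrite ge0_integral_cV_cons; last 2 first.
- by apply: mPH => //; apply: (measurableT_comp mH); exact: mZ.
- by move=> x; rewrite mule_ge0// lee_fin poisson_ge0.
have mH1 x : measurable_fun setT (fun v : 'cV[R]_n => H (cV_cons (x, v))).
  apply: (measurableT_comp mH); apply: (measurableT_comp (@measurable_cV_cons R n)).
  by apply/measurable_fun_pairP; split; mfun.
pose G x := (\int[lam n]_v ((poisson 1 v)%:E * H (cV_cons (x, e *: v))))%E.
have mG : measurable_fun setT G.
  apply: (@measurable_fun_fubini_tonelli_F _ _ _ _ _ _
    (fun xv : R * 'cV[R]_n => ((poisson 1 xv.2)%:E * H (cV_cons (xv.1, e *: xv.2)))%E)).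
    apply: emeasurable_funM.
      by apply: (measurableT_comp (mP _ _ ltr01)); exact: measurable_snd.
    apply: (measurableT_comp mH); apply: (measurableT_comp (@measurable_cV_cons R n)).
    apply/measurable_fun_pairP; split; first exact: measurable_fst.
    by apply: (measurableT_comp (mZ _)); exact: measurable_snd.
  by move=> x; rewrite mule_ge0// lee_fin poisson_ge0.
have G0 x : (0 <= G x)%E.
  by apply: integral_ge0 => v _; rewrite mule_ge0// lee_fin poisson_ge0.
transitivity (\int[leb]_x ((poisson1 e x)%:E * G x))%E.
  apply: eq_integral => x _; rewrite /G -(IH _ (mH1 x))// -ge0_integralZT; last 3 first.
  - exact: mPH.
  - by move=> v; rewrite mule_ge0// lee_fin poisson_ge0.
  - exact: poisson1_ge0.
  by apply: eq_integral => v _; rewrite poisson_cons EFinM muleA.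
have mp a : 0 < a -> measurable_fun setT (fun x : R => (poisson1 a x)%:E).
  by move=> a0; apply: measEFin; exact: measurable_poisson1.
have ms : measurable_fun setT (fun x : R => e * x) by mfun.
rewrite (ge0_integral_scale e0); last 2 first.
- by apply: emeasurable_funM => //; exact: mp.
- by move=> x; rewrite mule_ge0// lee_fin poisson1_ge0.
rewrite -ge0_integralZT; last 3 first.
- by apply: emeasurable_funM; [exact: (measurableT_comp (mp _ e0)
    ms)|exact: (measurableT_comp mG ms)].
- by move=> x; rewrite mule_ge0// lee_fin poisson1_ge0.
- exact: ltW.
apply: eq_integral => x _; rewrite muleA -EFinM poisson1_scale// /G -ge0_integralZT; last 3 first.
- apply: mPH => //; apply: (measurableT_comp (mH1 _)); exact: mZ.
- by move=> v; rewrite mule_ge0// lee_fin poisson_ge0.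
- exact: poisson1_ge0.
by apply: eq_integral => v _; rewrite poisson_cons EFinM muleA cV_consZ.
Qed.

Lemma integral_poisson (e : R) n : 0 < e -> (\int[lam n]_r (poisson e r)%:E = 1)%E.
Proof.
move=> e0; transitivity (\int[lam n]_r (poisson 1 r)%:E)%E.
  have c0 (x : 'cV[R]_n) : (0 <= cst 1%E x :> \bar R)%E by rewrite lee_fin.
  have := @integral_poisson_scale e n (cst 1%E) e0 (measurable_cst _) c0.
  under eq_integral do rewrite mule1.
  by under [in RHS]eq_integral do rewrite mule1.
elim: n => [|n IH]; first by rewrite ge0_integral_cV0 /poisson big_ord0.
rewrite ge0_integral_cV_cons; last 2 first.
- by apply: measEFin; exact: measurable_poisson.
- by move=> x; rewrite lee_fin poisson_ge0.
rewrite -integral_poisson1; apply: eq_integral => x _.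
under eq_integral do rewrite poisson_cons EFinM.
rewrite ge0_integralZT; last 3 first.
- by apply: measEFin; exact: measurable_poisson.
- by move=> v; rewrite lee_fin poisson_ge0.
- exact: poisson1_ge0.
by rewrite IH mule1.
Qed.

End poisson_kernel.

(** * Plancherel's theorem *)

Section real_integrals.
Context d (T : measurableType d) (R : realType) (mu : {measure set T -> \bar R}).
Implicit Types f g : T -> R.

Definition intg f := mu.-integrable setT (EFin \o f).

Lemma intgP f : measurable_fun setT f -> (\int[mu]_x `|f x|%:E < +oo)%E -> intg f.
Proof. by move=> mf fy; apply/integrableP; split => //; exact/measurable_EFinP. Qed.

Lemma intg_measurable f : intg f -> measurable_fun setT f.
Proof. by move=> /measurable_int/measurable_EFinP. Qed.

Lemma le_intg f g : measurable_fun setT f -> (forall x, `|f x| <= g x) -> intg g -> intg f.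
Proof.
move=> mf fg ig; apply: le_integrable ig => //; first exact/measurable_EFinP.
by move=> x _ /=; rewrite lee_fin (le_trans (fg x))// ler_norm.
Qed.

Lemma intgD f g : intg f -> intg g -> intg (fun x => f x + g x).
Proof. by move=> fi gi; exact: (integrableD measurableT fi gi). Qed.

Lemma intgZ (c : R) f : intg f -> intg (fun x => c * f x).
Proof. by move=> fi; exact: (integrableZl measurableT c fi). Qed.

Lemma intgN f : intg f -> intg (fun x => - f x).
Proof.
by move/(intgZ (-1)); rewrite (_ : (fun x => -1 * _) = (fun x => - f x))//; apply/funext => x;
    rewrite mulN1r.
Qed.

Lemma intgB f g : intg f -> intg g -> intg (fun x => f x - g x).
Proof. by move=> mf mg; apply: intgD => //; exact: intgN. Qed.

Lemma intg_sum (I : Type) (s : seq I) (h : I -> T -> R) :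
  (forall i, intg (h i)) -> intg (fun x => \sum_(i <- s) h i x).
Proof.
move=> ih; elim: s => [|i s IH].
  under eq_fun do rewrite big_nil.
  exact: integrable0.
by under eq_fun do rewrite big_cons; exact: intgD.
Qed.

Lemma EFin_Rint f : intg f -> (\int[mu]_x f x)%:E = (\int[mu]_x (f x)%:E)%E.
Proof. by move=> fi; rewrite /Rintegral fineK// integrable_fin_num. Qed.

Lemma RintD f g : intg f -> intg g ->
  \int[mu]_x (f x + g x) = \int[mu]_x f x + \int[mu]_x g x.
Proof. by move=> ? ?; exact: RintegralD. Qed.

Lemma RintZ c f : intg f -> \int[mu]_x (c * f x) = c * \int[mu]_x f x.
Proof. by move=> ?; exact: RintegralZl. Qed.

Lemma RintN f : intg f -> \int[mu]_x (- f x) = - \int[mu]_x f x.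
Proof. by move=> fi; rewrite -mulN1r -RintZ//; apply: eq_Rintegral => x _; rewrite mulN1r. Qed.

Lemma RintB f g : intg f -> intg g ->
  \int[mu]_x (f x - g x) = \int[mu]_x f x - \int[mu]_x g x.
Proof. by move=> fi gi; rewrite RintD//; [rewrite RintN|exact: intgN]. Qed.

Lemma Rint_sum (I : Type) (s : seq I) (h : I -> T -> R) :
  (forall i, intg (h i)) ->
  \int[mu]_x (\sum_(i <- s) h i x) = \sum_(i <- s) \int[mu]_x h i x.
Proof.
move=> ih; elim: s => [|i s IH].
  rewrite big_nil; under eq_Rintegral do rewrite big_nil.
  by rewrite /Rintegral integral0.
rewrite big_cons -IH -RintD//; last exact: intg_sum.
by apply: eq_Rintegral => x _; rewrite big_cons.
Qed.

Lemma ge0_intg f : measurable_fun setT f -> (forall x, 0 <= f x) ->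
  (\int[mu]_x (f x)%:E < +oo)%E -> intg f.
Proof.
move=> mf f0 fy; apply: intgP => //.
by under eq_integral do rewrite ger0_norm//.
Qed.

End real_integrals.

Section parametric.
Context d1 d2 (T1 : measurableType d1) (T2 : measurableType d2) (R : realType).
Variables (m1 : {sigma_finite_measure set T1 -> \bar R})
  (m2 : {sigma_finite_measure set T2 -> \bar R}).
Implicit Type f : T1 * T2 -> R.

Lemma measurable_Rint f : measurable_fun setT f ->
  measurable_fun setT (fun x => \int[m2]_y f (x, y)).
Proof.
move=> mf; apply: (measurableT_comp (@fine_measurable _ setT measurableT)).
have mF : measurable_fun setT (EFin \o f) by exact/measurable_EFinP.
rewrite (_ : (fun x => _) = (fun x => (\int[m2]_y (EFin \o f)^\+ (x, y) -
  \int[m2]_y (EFin \o f)^\- (x, y))%E)).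
  by apply: emeasurable_funB; apply: measurable_fun_fubini_tonelli_F => //;
    [exact: measurable_funepos|exact: measurable_funeneg].
apply/funext => x; rewrite integralE; congr (_ - _)%E.
  by apply: eq_integral => y _; rewrite !funeposE.
by apply: eq_integral => y _; rewrite !funenegE.
Qed.

Lemma intg_prodP f : measurable_fun setT f ->
  (\int[m1]_x \int[m2]_y `|f (x, y)|%:E < +oo)%E -> intg (m1 \x m2)%E f.
Proof.
by move=> mf fy; apply/integrable12ltyP => //; exact/measurable_EFinP.
Qed.

Lemma intg_tensor (f : T1 -> R) (g : T2 -> R) : intg m1 f -> intg m2 g ->
  intg (m1 \x m2)%E (fun z => f z.1 * g z.2).
Proof.
move=> fi gi; have mf := intg_measurable fi; have mg := intg_measurable gi.
have [_ fy] := integrableP _ _ _ fi; have [_ gy] := integrableP _ _ _ gi.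
have mff : measurable_fun setT (fun z : T1 * T2 => f z.1).
  by apply: (measurableT_comp mf); exact: measurable_fst.
have mgg : measurable_fun setT (fun z : T1 * T2 => g z.2).
  by apply: (measurableT_comp mg); exact: measurable_snd.
apply: intg_prodP; first by mfun.
under eq_integral => x _.
  under eq_integral do rewrite /= normrM EFinM.
  rewrite ge0_integralZT//; last by mfun.
  over.
have gg : (\int[m2]_y `|g y|%:E)%E = (\int[m2]_y `|g y|)%:E.
  by rewrite EFin_Rint//; apply: intgP; [mfun|under eq_integral do rewrite normr_id].
rewrite gg; under eq_integral do rewrite muleC.
rewrite ge0_integralZT//; last 2 first.
- by mfun.
- by apply: Rintegral_ge0.
by rewrite lte_mul_pinfty// lee_fin Rintegral_ge0.
Qed.

End parametric.

(** With [fourier_im], the real and imaginary parts of the Fourier transform of [p + i q] for the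
    kernel [exp(- 2 pi i xi.t)]. *)
Definition fourier_re {R : realType} n (p q : 'cV[R]_n -> R) xi : R :=
  \int[lebesgue_cV n]_t (p t * cos (2 * pi * dot xi t) + q t * sin (2 * pi * dot xi t)).

Definition fourier_im {R : realType} n (p q : 'cV[R]_n -> R) xi : R :=
  \int[lebesgue_cV n]_t (q t * cos (2 * pi * dot xi t) - p t * sin (2 * pi * dot xi t)).

Section plancherel.
Context {R : realType} (n : nat).
Local Notation T := 'cV[R]_n.
Local Notation lam := (@lebesgue_cV R n).
Variables (p q : T -> R).
Hypotheses (mp : measurable_fun setT p) (mq : measurable_fun setT q).
Hypotheses (ip : intg lam p) (iq : intg lam q).
Hypotheses (p2 : (sqint lam p < +oo)%E) (q2 : (sqint lam q < +oo)%E).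

Let arg (xi t : T) := 2 * pi * dot xi t.
Let a xi t := p t * cos (arg xi t) + q t * sin (arg xi t).
Let b xi t := q t * cos (arg xi t) - p t * sin (arg xi t).
Let A xi := \int[lam]_t a xi t.
Let B xi := \int[lam]_t b xi t.
Let m t := `|p t| + `|q t|.

Let marg d (S : measurableType d) (f g : S -> T) :
  measurable_fun setT f -> measurable_fun setT g ->
  measurable_fun setT (fun x => arg (f x) (g x)).
Proof. by move=> mf mg; rewrite /arg; mfun; exact: measurable_dot. Qed.

Let ma d (S : measurableType d) (f g : S -> T) :
  measurable_fun setT f -> measurable_fun setT g ->
  measurable_fun setT (fun x => a (f x) (g x)).
Proof.
move=> mf mg; have h := marg mf mg; rewrite /a.
have := measurableT_comp mp mg; have := measurableT_comp mq mg.
by move=> h1 h2; mfun.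
Qed.

Let mb d (S : measurableType d) (f g : S -> T) :
  measurable_fun setT f -> measurable_fun setT g ->
  measurable_fun setT (fun x => b (f x) (g x)).
Proof.
move=> mf mg; have h := marg mf mg; rewrite /b.
have := measurableT_comp mp mg; have := measurableT_comp mq mg.
by move=> h1 h2; mfun.
Qed.

Let cs1 (x : R) : `|cos x| <= 1. Proof. by rewrite ler_norml cos_geN1 cos_le1. Qed.
Let sn1 (x : R) : `|sin x| <= 1. Proof. by rewrite ler_norml sin_geN1 sin_le1. Qed.

Let a_le xi t : `|a xi t| <= m t.
Proof.
rewrite /a /m (le_trans (ler_normD _ _))// !normrM lerD//; rewrite ler_piMr//.
Qed.

Let b_le xi t : `|b xi t| <= m t.
Proof.
by rewrite /b /m (le_trans (ler_normB _ _))// !normrM addrC lerD//; rewrite ler_piMr.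
Qed.

Let im : intg lam m.
Proof.
have abs f : intg lam f -> intg lam (fun x => `|f x|).
  move=> fi; have [mf fy] := integrableP _ _ _ fi; apply: intgP.
    by apply: measabs; exact: intg_measurable fi.
  by under eq_integral do rewrite normr_id.
by apply: intgD; exact: abs.
Qed.

Let ia xi : intg lam (a xi).
Proof. by apply: le_intg im => //; apply: ma; mfun. Qed.

Let ib xi : intg lam (b xi).
Proof. by apply: le_intg im => //; apply: mb; mfun. Qed.

Let mA : measurable_fun setT A.
Proof. by apply: (@measurable_Rint _ _ _ _ _ lam (fun z => a z.1 z.2)); apply: ma; mfun. Qed.

Let mB : measurable_fun setT B.
Proof. by apply: (@measurable_Rint _ _ _ _ _ lam (fun z => b z.1 z.2)); apply: mb; mfun. Qed.

(** Squared norm of the increment of [p + i q] under translation by [r]; [N] below is the squared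
    norm of [p + i q] itself. *)
Let D (r : T) : \bar R := (sqint lam (fun t => (p (t + r) - p t)%R) +
  sqint lam (fun t => (q (t + r) - q t)%R))%E.

Let F2 t := p t ^+ 2 + q t ^+ 2.
Let E r t := (p (t + r) - p t) ^+ 2 + (q (t + r) - q t) ^+ 2.

Let mF2 : measurable_fun setT F2. Proof. by rewrite /F2; mfun. Qed.

Let maddT : measurable_fun setT (fun z : T * T => z.1 + z.2).
Proof.
apply/measurable_fun_mxP => i j; rewrite (_ : (fun w => _) = (fun w : T * T => w.1 i j + w.2 i j)).
  by apply: measD; apply: (measurableT_comp (measurable_entry i j)); mfun.
by apply/funext => w; rewrite !mxE.
Qed.

Let mE2 : measurable_fun setT (fun z : T * T => E z.2 z.1).
Proof.
have := measurableT_comp mp maddT; have := measurableT_comp mq maddT => h1 h2.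
have := measurableT_comp mp (@measurable_fst _ _ T T) => h3.
have := measurableT_comp mq (@measurable_fst _ _ T T) => h4.
by rewrite /E; mfun.
Qed.

Let N : \bar R := (sqint lam p + sqint lam q)%E.

Let intF2 : (\int[lam]_t (F2 t)%:E = N)%E.
Proof.
by rewrite /N /sqint -ge0_integralDT; try (by mfun); try ge0.
Qed.

Let iF2 : intg lam F2.
Proof.
apply: ge0_intg => //; first by move=> t; rewrite addr_ge0// sqr_ge0.
by rewrite intF2 lte_add_pinfty.
Qed.

Let intE r : (\int[lam]_t (E r t)%:E = D r)%E.
Proof.
have tr : measurable_fun setT (fun t : T => t + r) by exact: measurable_translation.
have := measurableT_comp mp tr; have := measurableT_comp mq tr => h1 h2.
by rewrite /D /sqint -ge0_integralDT; try (by mfun); try ge0.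
Qed.

Let N0 : (0 <= N)%E. Proof. by rewrite adde_ge0// sqint_ge0. Qed.
Let Ny : (N < +oo)%E. Proof. by rewrite lte_add_pinfty. Qed.

Let mD : measurable_fun setT D.
Proof.
rewrite (_ : D = fun r => \int[lam]_t (E r t)%:E)%E; last by apply/funext => r; rewrite intE.
apply: (@measurable_fun_fubini_tonelli_G _ _ T T _ lam (fun z => (E z.2 z.1)%:E)).
  by apply: measEFin.
by move=> z; rewrite lee_fin addr_ge0// sqr_ge0.
Qed.

Let D0 r : (0 <= D r)%E. Proof. by rewrite adde_ge0// sqint_ge0. Qed.

Let D_le r : (D r <= 4%:E * N)%E.
Proof.
have tr : measurable_fun setT (fun t : T => t + r) by exact: measurable_translation.
have := measurableT_comp mp tr; have := measurableT_comp mq tr => h1 h2.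
apply: (le_trans (leeD (sqintB_le _ h2 mp) (sqintB_le _ h1 mq))).
rewrite !sqint_translation// /N -!mule2n -!mule_natl !muleA -!EFinM.
rewrite (_ : 2 * 2%:R = 4 :> R); last by lra.
by rewrite -ge0_muleDr ?sqint_ge0.
Qed.

Section mollified.
Let h (s t : T) := p s * p t + q s * q t.

Variable e : R.
Hypothesis e0 : 0 < e.

Let iexpw : intg lam (@expw R e n).
Proof.
apply: ge0_intg; [exact: measurable_expw|by move=> x; exact: expw_ge0|].
by rewrite integral_expw// ltry.
Qed.

Let G t xi s := expw e xi * (a xi s * a xi t + b xi s * b xi t).

Let iG t : intg (lam \x lam)%E (fun z => G t z.1 z.2).
Proof.
have i1 := intgZ (2 * m t) (intg_tensor iexpw im).
have m1 : measurable_fun setT (fun z : T * T => z.1) by mfun.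
have m2 : measurable_fun setT (fun z : T * T => z.2) by mfun.
have mt : measurable_fun setT (fun z : T * T => t) by mfun.
apply: le_intg i1.
  have := ma m1 m2; have := ma m1 mt; have := mb m1 m2; have := mb m1 mt => h1 h2 h3 h4.
  apply: measM; first exact: (measurableT_comp (measurable_expw e (n := n)) m1).
  by mfun.
move=> [xi s]; rewrite /G /= normrM ger0_norm ?expw_ge0// mulrCA ler_wpM2l ?expw_ge0//.
rewrite (le_trans (ler_normD _ _))// mulrAC -mulrA mulr_natl mulr2n !normrM.
by apply: lerD; apply: ler_pM.
Qed.

Let A_le xi : `|A xi| <= \int[lam]_t m t.
Proof.
have iabs : intg lam (fun t => `|a xi t|).
  by apply: le_intg im => //; [apply: measabs; apply: ma; mfun|move=> x; rewrite normr_id].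
apply: (le_trans (le_normr_Rintegral measurableT (ia xi))).
by apply: (le_Rintegral measurableT iabs im) => x _; exact: a_le.
Qed.

Let B_le xi : `|B xi| <= \int[lam]_t m t.
Proof.
have iabs : intg lam (fun t => `|b xi t|).
  by apply: le_intg im => //; [apply: measabs; apply: mb; mfun|move=> x; rewrite normr_id].
apply: (le_trans (le_normr_Rintegral measurableT (ib xi))).
by apply: (le_Rintegral measurableT iabs im) => x _; exact: b_le.
Qed.

Let H xi t := expw e xi * (A xi * a xi t + B xi * b xi t).

Let iH : intg (lam \x lam)%E (fun z => H z.1 z.2).
Proof.
have i1 := intgZ (2 * \int[lam]_t m t) (intg_tensor iexpw im).
have m1 : measurable_fun setT (fun z : T * T => z.1) by mfun.
have m2 : measurable_fun setT (fun z : T * T => z.2) by mfun.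
apply: le_intg i1.
  have := ma m1 m2; have := mb m1 m2.
  have := measurableT_comp mA m1; have := measurableT_comp mB m1 => h1 h2 h3 h4.
  apply: measM; first exact: (measurableT_comp (measurable_expw e (n := n)) m1).
  by mfun.
move=> [xi s]; rewrite /H /= normrM ger0_norm ?expw_ge0// mulrCA ler_wpM2l ?expw_ge0//.
rewrite (le_trans (ler_normD _ _))// -mulrA mulr_natl mulr2n !normrM.
by apply: lerD; apply: ler_pM.
Qed.

Let Rint_expw_cos (r : T) t :
  intg lam (fun x => expw e x * cos (2 * pi * dot x r + t)) /\
      \int[lam]_x (expw e x * cos (2 * pi * dot x r + t)) = cos t * poisson e r.
Proof.
have mc : measurable_fun setT (fun x : T => cos (2 * pi * dot x r + t)).
  by mfun; apply: measurable_dot; mfun.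
have mw := @measurable_expw R e n.
have i1 : intg lam (fun x => expw e x * cos (2 * pi * dot x r + t)).
  apply: le_intg iexpw; first by mfun.
  by move=> x; rewrite normrM ger0_norm ?expw_ge0// ler_piMr ?expw_ge0.
split => //; apply: EFin_inj; rewrite EFin_Rint//.
have := integral_expw_cos r t e0.
have -> : (\int[lam]_x (expw e x * (1 + cos (2 * pi * dot x r + t)))%:E =
    \int[lam]_x ((expw e x)%:E + (expw e x * cos (2 * pi * dot x r + t))%:E))%E.
  by apply: eq_integral => x _; rewrite mulrDr mulr1 EFinD.
rewrite integralD//= integral_expw// -EFin_Rint// -EFinD => -[].
by move/addrI => ->.
Qed.

(** With [theta = 2 pi xi.(s - t)], the bracket in [G] equals [h cos theta + k sin theta]. The sine,
    written as a cosine of phase [- pi / 2], integrates to 0 because the weight is even. *)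
Let intG t s : \int[lam]_xi G t xi s = h s t * poisson e (s - t).
Proof.
pose k := q s * p t - p s * q t.
have [i1 e1] := Rint_expw_cos (s - t) 0.
have [i2 e2] := Rint_expw_cos (s - t) (- (pi / 2)).
transitivity (\int[lam]_xi (h s t * (expw e xi * cos (2 * pi * dot xi (s - t) + 0)) +
   k * (expw e xi * cos (2 * pi * dot xi (s - t) + - (pi / 2))))).
  apply: eq_Rintegral => xi _; rewrite /G /= /a /b.
  have -> : 2 * pi * dot xi (s - t) = arg xi s - arg xi t.
    rewrite /arg -mulrBr; congr (_ * _); rewrite /dot -sumrB; apply: eq_bigr => i _.
    by rewrite !mxE mulrBr.
  rewrite addr0 [cos (_ - pi / 2)]cosB cos_pihalf sin_pihalf mulr0 add0r mulr1 cosB sinB.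
  by rewrite /h /k; ring.
rewrite RintD; [|exact: intgZ..].
by rewrite !RintZ// e1 e2 cosN cos_pihalf cos0 mul0r mulr0 mul1r addr0.
Qed.

Let iG1 t xi : intg lam (G t xi).
Proof.
have := ia xi; have := ib xi => i1 i2; apply: intgZ; apply: intgD.
  by under eq_fun do rewrite mulrC; exact: intgZ.
by under eq_fun do rewrite mulrC; exact: intgZ.
Qed.

Let iG2 t s : intg lam (fun xi => G t xi s).
Proof.
apply: (@le_intg _ _ _ _ _ (fun xi => 2 * (m s * m t) * expw e xi)).
- apply: measM; first exact: measurable_expw.
  by apply: measD; apply: measM; first [apply: ma; mfun | apply: mb; mfun].
- move=> xi; rewrite /G /= normrM ger0_norm ?expw_ge0// mulrC ler_wpM2r ?expw_ge0//.
  rewrite (le_trans (ler_normD _ _))// mulr_natl mulr2n !normrM.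
  by apply: lerD; apply: ler_pM.
- exact: intgZ.
Qed.

Let iH1 xi : intg lam (H xi).
Proof. by apply: intgZ; apply: intgD; exact: intgZ. Qed.

(** [H] is [G] integrated in [s]. Fubini's theorem is used twice, on the pairs [(xi, t)] and
    [(xi, s)], which avoids an integral over triples. *)
Let mollified : (\int[lam]_xi (expw e xi * (A xi ^+ 2 + B xi ^+ 2))%:E =
  \int[lam]_t \int[lam]_s (h s t * poisson e (s - t))%:E)%E.
Proof.
transitivity (\int[lam]_xi \int[lam]_t (H xi t)%:E)%E.
  apply: eq_integral => xi _; rewrite -EFin_Rint//; congr EFin.
  rewrite RintZ; last by apply: intgD; exact: intgZ.
  by rewrite RintD; [rewrite !RintZ// !expr2|exact: intgZ..].
rewrite (Fubini iH); apply: eq_integral => t _ /=.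
transitivity (\int[lam]_xi \int[lam]_s (G t xi s)%:E)%E.
  apply: eq_integral => xi _; rewrite -EFin_Rint//; congr EFin.
  have i1 : intg lam (fun s => a xi s * a xi t).
    by under eq_fun do rewrite mulrC; exact: intgZ.
  have i2 : intg lam (fun s => b xi s * b xi t).
    by under eq_fun do rewrite mulrC; exact: intgZ.
  rewrite RintZ; last exact: intgD.
  congr (_ * _); rewrite RintD//; congr (_ + _).
    by under eq_Rintegral do rewrite mulrC; rewrite RintZ// mulrC.
  by under eq_Rintegral do rewrite mulrC; rewrite RintZ// mulrC.
rewrite (Fubini (iG t)); apply: eq_integral => s _ /=.
by rewrite -intG EFin_Rint.
Qed.

Let K (r : T) : R := poisson e r.
Let mK : measurable_fun setT K. Proof. exact: measurable_poisson. Qed.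
Let K0 r : 0 <= K r. Proof. exact: poisson_ge0. Qed.

(** With [f = p + i q], [h s t] is half of [|f(s)|^2 + |f(t)|^2 - |f(s) - f(t)|^2]. Integrated
    against a kernel of mass 1, the first two terms give [N] and the third half the mean of [D]. The
    identity is stated as a sum to avoid subtracting extended reals. *)
Lemma plancherel_mollified :
  (\int[lam]_xi (expw e xi * (A xi ^+ 2 + B xi ^+ 2))%:E +
   2^-1%:E * \int[lam]_r ((poisson e r)%:E * D r) = N)%E.
Proof.
rewrite mollified.
have shift (f : T -> R) t : measurable_fun setT f -> measurable_fun setT (fun r : T => f (t + r)).
  move=> mf; under eq_fun do rewrite addrC.
  by apply: (measurableT_comp mf); exact: measurable_translation.
pose u t := \int[lam]_r (K r * F2 (t + r)).
pose w t := \int[lam]_r (K r * E r t).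
have iKu t : intg lam (fun r => K r * F2 (t + r)).
  apply: (@le_intg _ _ _ _ _ (fun r => (2 / e) ^+ n * F2 (t + r))).
  - by apply: measM => //; exact: shift.
  - move=> r; have F0 : 0 <= F2 (t + r) by rewrite addr_ge0// sqr_ge0.
    by rewrite ger0_norm ?mulr_ge0// ler_wpM2r// poisson_le.
  - apply: intgZ; apply: ge0_intg; first exact: shift.
      by move=> r; rewrite addr_ge0// sqr_ge0.
    under eq_integral do rewrite addrC.
    rewrite (@ge0_integral_translation _ _ t (fun r => (F2 r)%:E)); first by rewrite intF2.
      exact: measEFin.
    by move=> r; rewrite lee_fin addr_ge0// sqr_ge0.
have iK : intg lam K.
  by apply: ge0_intg => //; rewrite integral_poisson// ltry.
have E0 r t : 0 <= E r t by rewrite addr_ge0// sqr_ge0.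
have mEt t : measurable_fun setT (fun r => E r t).
  by have := shift _ t mp; have := shift _ t mq => h1 h2; rewrite /E; mfun.
have iKw t : intg lam (fun r => K r * E r t).
  apply: (@le_intg _ _ _ _ _ (fun r => 2 * (K r * F2 (t + r)) + 2 * F2 t * K r)).
  - by apply: measM.
  - move=> r; rewrite ger0_norm ?mulr_ge0//.
    rewrite (_ : _ + _ = K r * (2 * F2 (t + r) + 2 * F2 t)); last by ring.
    rewrite ler_wpM2l// /E /F2.
    rewrite -subr_ge0 (_ : _ - _ = (p (t + r) + p t) ^+ 2 + (q (t + r) + q t) ^+ 2); last by ring.
    by rewrite addr_ge0// sqr_ge0.
  - by apply: intgD; apply: intgZ.
have inner t : (\int[lam]_s (h s t * poisson e (s - t))%:E = (2^-1 * (u t + F2 t - w t))%:E)%E.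
  have ms : measurable_fun setT (fun s => (h s t * poisson e (s - t))%:E).
    have := measurableT_comp (@measurable_poisson _ e n e0) (@measurable_translation _ _ (- t)).
    by move=> h1; apply: measEFin; rewrite /h; mfun.
  rewrite -(integral_translation t ms).
  have -> : u t + F2 t - w t = \int[lam]_r (K r * F2 (t + r) + F2 t * K r - K r * E r t).
    rewrite RintB//; last by apply: intgD => //; exact: intgZ.
    rewrite RintD//; last exact: intgZ.
    congr (_ + _ - _); rewrite RintZ//.
    have -> : \int[lam]_r K r = 1 by rewrite /Rintegral integral_poisson.
    by rewrite mulr1.
  rewrite -RintZ; last by apply: intgB => //; apply: intgD => //; exact: intgZ.
  rewrite EFin_Rint; last by apply: intgZ; apply: intgB => //; apply: intgD => //; exact: intgZ.
  apply: eq_integral => r _; congr EFin; rewrite addrK (addrC r t) /h /K /F2 /E.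
  by field.
under eq_integral do rewrite inner.
have mKr : measurable_fun setT (fun z : T * T => K z.2).
  by apply: (measurableT_comp mK); mfun.
have intu : (\int[lam]_t (u t)%:E = N)%E.
  under eq_integral do rewrite EFin_Rint//.
  rewrite (@fubini_tonelli _ _ T T _ lam lam (fun z => (K z.2 * F2 (z.1 + z.2))%:E)); last 2 first.
  - apply: measEFin; apply: measM => //; exact: (measurableT_comp mF2 maddT).
  - by move=> z; rewrite lee_fin mulr_ge0// addr_ge0// sqr_ge0.
  rewrite /fubini_G /=; under eq_integral => r _.
    under eq_integral do rewrite EFinM.
    rewrite ge0_integralZT//; last 2 first.
    - by apply: measEFin; apply: (measurableT_comp mF2); exact: measurable_translation.
    - by move=> t; rewrite lee_fin addr_ge0// sqr_ge0.
    rewrite (@ge0_integral_translation _ _ r (fun r => (F2 r)%:E)); last 2 first.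
    - exact: measEFin.
    - by move=> t; rewrite lee_fin addr_ge0// sqr_ge0.
    rewrite intF2 muleC -(@fineK _ N) ?ge0_fin_numE//; over.
  rewrite ge0_integralZT//; last 2 first.
  - exact: measEFin.
  - exact: fine_ge0.
  by rewrite integral_poisson// mule1 fineK ?ge0_fin_numE.
have intw : (\int[lam]_t (w t)%:E = \int[lam]_r ((poisson e r)%:E * D r))%E.
  under eq_integral do rewrite EFin_Rint//.
  rewrite (@fubini_tonelli _ _ T T _ lam lam (fun z => (K z.2 * E z.2 z.1)%:E)); last 2 first.
  - by apply: measEFin; apply: measM.
  - by move=> z; rewrite lee_fin mulr_ge0.
  rewrite /fubini_G /=; apply: eq_integral => r _.
  under eq_integral do rewrite EFinM.
  rewrite ge0_integralZT//; [by rewrite intE| |by move=> t; rewrite lee_fin].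
  have tr : measurable_fun setT (fun t : T => t + r) by exact: measurable_translation.
  have := measurableT_comp mp tr; have := measurableT_comp mq tr => h1 h2.
  by rewrite /E; mfun.
have mu_ : measurable_fun setT u.
  apply: (@measurable_Rint _ _ T T _ lam (fun z => K z.2 * F2 (z.1 + z.2))).
  by apply: measM => //; exact: (measurableT_comp mF2 maddT).
have mw_ : measurable_fun setT w.
  by apply: (@measurable_Rint _ _ T T _ lam (fun z => K z.2 * E z.2 z.1)); apply: measM.
have u0 t : 0 <= u t.
  by apply: Rintegral_ge0 => r _; rewrite mulr_ge0// addr_ge0// sqr_ge0.
have w0 t : 0 <= w t by apply: Rintegral_ge0 => r _; rewrite mulr_ge0.
have iu : intg lam u by apply: ge0_intg => //; rewrite intu.
have wy : (\int[lam]_t (w t)%:E < +oo)%E.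
  rewrite intw; apply: (@le_lt_trans _ _ (\int[lam]_r (4%:E * N * (poisson e r)%:E))%E).
    apply: ge0_le_integralT.
    - by apply: emeasurable_funM => //; exact: measEFin.
    - by apply: emeasurable_funM => //; exact: measEFin.
    - by move=> r; rewrite mule_ge0// lee_fin.
    - by move=> r; rewrite muleC lee_wpmul2r// lee_fin.
  rewrite -(@fineK _ N) ?ge0_fin_numE// -EFinM ge0_integralZT//; last 2 first.
  - exact: measEFin.
  - by rewrite mulr_ge0// fine_ge0.
  by rewrite integral_poisson// mule1 ltry.
have iw : intg lam w by apply: ge0_intg.
rewrite -intw -EFin_Rint; last by apply: intgZ; apply: intgB => //; exact: intgD.
rewrite -EFin_Rint// RintZ; last by apply: intgB => //; exact: intgD.
rewrite RintB//; last exact: intgD.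
rewrite RintD// -EFinM -EFinD.
have -> : \int[lam]_t u t = fine N by rewrite /Rintegral intu.
have -> : \int[lam]_t F2 t = fine N by rewrite /Rintegral intF2.
rewrite (_ : _ + _ = fine N); last by field.
by rewrite fineK ?ge0_fin_numE.
Qed.

End mollified.

Let eps (k : nat) : R := k.+1%:R^-1.

(** After rescaling, the kernel is fixed and the increment is taken at [eps k *: r], where
    continuity of translations gives pointwise convergence; the majorant is [4 N] times the
    kernel. *)
Let error_cvg : (2^-1%:E * \int[lam]_r ((poisson (eps k) r)%:E * D r) @[k --> \oo] --> 0)%E.
Proof.
rewrite -[X in _ --> X](mule0 2^-1%:E); apply: cvgeZl => //.
have e0 k : 0 < eps k by rewrite invr_gt0.
have -> : (fun k => \int[lam]_r ((poisson (eps k) r)%:E * D r))%E =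
    (fun k => \int[lam]_r ((poisson 1 r)%:E * D (eps k *: r)%R))%E.
  by apply/funext => k; exact: integral_poisson_scale.
have mZ k : measurable_fun setT (fun r : T => eps k *: r).
  apply/measurable_fun_mxP => i j; under eq_fun do rewrite mxE.
  by apply: measM => //; exact: measurable_entry.
have m1 : measurable_fun setT (@poisson R 1 n) by exact: measurable_poisson.
apply: (@ge0_dominated_cvg0 _ _ _ _ _ (fun r => (poisson 1 r)%:E * (4%:E * N))%E).
- move=> k; apply: emeasurable_funM; first exact: measEFin.
  exact: (measurableT_comp mD (mZ k)).
- by move=> k r; rewrite mule_ge0// lee_fin poisson_ge0.
- by apply: emeasurable_funM => //; exact: measEFin.
- by move=> k r; rewrite lee_wpmul2l// lee_fin poisson_ge0.
- rewrite -(@fineK _ N) ?ge0_fin_numE// -EFinM.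
  under eq_integral do rewrite muleC.
  rewrite ge0_integralZT; last 3 first.
  + exact: measEFin.
  + by move=> r; rewrite lee_fin poisson_ge0.
  + by rewrite mulr_ge0// fine_ge0.
  by rewrite integral_poisson// mule1 ltry.
- apply: aeW => r; rewrite -[X in _ --> X](mule0 (poisson 1 r)%:E).
  apply: cvgeZl => //; rewrite -[X in _ --> X]adde0.
  have ce i : (eps k *: r) i ord0 @[k --> \oo] --> 0.
    under eq_fun do rewrite mxE; rewrite -(mul0r (r i ord0)).
    by apply: cvgMl; exact: cvg_harmonic.
  by apply: cvgeD => //; exact: translation_cvg.
Qed.

(** The weights increase to 1 as [eps k] decreases, so monotone convergence applies without knowing
    that the limit is finite. *)
Let main_cvg : (\int[lam]_xi (expw (eps k) xi * (A xi ^+ 2 + B xi ^+ 2))%:E @[k --> \oo] -->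
  \int[lam]_xi (A xi ^+ 2 + B xi ^+ 2)%:E)%E.
Proof.
have AB0 xi : 0 <= A xi ^+ 2 + B xi ^+ 2 by rewrite addr_ge0// sqr_ge0.
have cvg_exp (xi : T) : expw (eps k) xi @[k --> \oo] --> (1 : R).
  rewrite /expw; elim: (index_enum _) => [|i s IH].
    by under eq_fun do rewrite big_nil; exact: cvg_cst.
  have c1 : expR (- (eps k * `|xi i ord0|)) @[k --> \oo] --> (1 : R).
    rewrite -[X in _ --> X]expR0; apply: continuous_cvg; first exact: continuous_expR.
    rewrite -oppr0; apply: cvgN; rewrite -(mul0r `|xi i ord0|).
    by apply: cvgMl; exact: cvg_harmonic.
  have : expR (- (eps k * `|xi i ord0|)) * \prod_(i0 <- s) expR (- (eps k * `|xi i0 ord0|))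
      @[k --> \oo] --> (1 * 1 : R) by exact: cvgM.
  by rewrite mulr1; apply: cvg_eq1 => k; rewrite big_cons.
have -> : (\int[lam]_xi (A xi ^+ 2 + B xi ^+ 2)%:E = \int[lam]_xi
    limn (fun k => (expw (eps k) xi * (A xi ^+ 2 + B xi ^+ 2))%:E))%E.
  apply: eq_integral => xi _; apply/esym/cvg_lim => //; apply/fine_cvgP; split; first by near=> k.
  have : expw (eps k) xi * (A xi ^+ 2 + B xi ^+ 2) @[k --> \oo] -->
      1 * (A xi ^+ 2 + B xi ^+ 2) by apply: cvgMl; exact: cvg_exp.
  by rewrite mul1r.
apply: (@cvg_monotone_convergence _ _ _ lam setT measurableT
  (fun k xi => (expw (eps k) xi * (A xi ^+ 2 + B xi ^+ 2))%:E)).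
- by move=> k; apply: measEFin; have := @measurable_expw R (eps k) n => h; mfun.
- by move=> k xi _; rewrite lee_fin mulr_ge0// expw_ge0.
- move=> xi _ k l kl; rewrite lee_fin ler_wpM2r//; apply: ler_prod => i _.
  rewrite expR_ge0 ler_expR lerN2 ler_wpM2r//=.
  by rewrite lef_pV2 ?posrE// ler_nat.
Unshelve. all: by end_near.
Qed.

Theorem plancherel :
  (\int[lam]_xi (fourier_re p q xi ^+ 2 + fourier_im p q xi ^+ 2)%:E =
   sqint lam p + sqint lam q)%E.
Proof.
have e0 k : 0 < eps k by rewrite invr_gt0.
(* By [plancherel_mollified] the sum of the two sequences is constantly [N], and the second one
   tends to 0. *)
have cN : (N @[k --> \oo] --> \int[lam]_xi (A xi ^+ 2 + B xi ^+ 2)%:E)%E.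
  have d0 : ((\int[lam]_xi (A xi ^+ 2 + B xi ^+ 2)%:E) +? 0)%E by rewrite fin_num_adde_defl.
  have : ((\int[lam]_xi (expw (eps k) xi * (A xi ^+ 2 + B xi ^+ 2))%:E +
      2^-1%:E * \int[lam]_r ((poisson (eps k) r)%:E * D r)) @[k --> \oo] -->
    \int[lam]_xi (A xi ^+ 2 + B xi ^+ 2)%:E + 0)%E by exact: cvgeD.
  by rewrite adde0; apply: cvg_eq1 => k; rewrite -(plancherel_mollified (e0 k)).
exact: (cvg_unique _ cN (cvg_cst N)).
Qed.

End plancherel.

(** * Square-integrable complex functions *)

Section complex_arith.
Context {R : rcfType}.
Implicit Types (a b z : R[i]).
Local Notation Re := (@complex.Re R).
Local Notation Im := (@complex.Im R).

Lemma ReD a b : Re (a + b) = Re a + Re b. Proof. by case: a b => [? ?] []. Qed.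
Lemma ImD a b : Im (a + b) = Im a + Im b. Proof. by case: a b => [? ?] []. Qed.
Lemma ReN a : Re (- a) = - Re a. Proof. by case: a. Qed.
Lemma ImN a : Im (- a) = - Im a. Proof. by case: a. Qed.
Lemma ReB a b : Re (a - b) = Re a - Re b. Proof. by rewrite ReD ReN. Qed.
Lemma ImB a b : Im (a - b) = Im a - Im b. Proof. by rewrite ImD ImN. Qed.
Lemma ReM a b : Re (a * b) = Re a * Re b - Im a * Im b. Proof. by case: a b => [? ?] []. Qed.
Lemma ImM a b : Im (a * b) = Re a * Im b + Im a * Re b. Proof. by case: a b => [? ?] []. Qed.
Lemma ReJ a : Re (conjc a) = Re a. Proof. by case: a. Qed.
Lemma ImJ a : Im (conjc a) = - Im a. Proof. by case: a. Qed.

Lemma conjcD a b : conjc (a + b) = conjc a + conjc b.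
Proof. by case: a b => [? ?] [? ?] /=; congr (_ +i* _)%C; rewrite opprD. Qed.
Lemma conjcN a : conjc (- a) = - conjc a. Proof. by case: a. Qed.
Lemma conjcM a b : conjc (a * b) = conjc a * conjc b.
Proof. by case: a b => [? ?] [? ?]; congr (_ +i* _)%C => /=; ring. Qed.

Lemma complex_ext a b : Re a = Re b -> Im a = Im b -> a = b.
Proof. by case: a b => [? ?] [? ?] /= -> ->. Qed.

Lemma Re_sum (I : Type) (s : seq I) (P : pred I) (F : I -> R[i]) :
  Re (\sum_(i <- s | P i) F i) = \sum_(i <- s | P i) Re (F i).
Proof. exact: (big_morph _ ReD). Qed.

Lemma Im_sum (I : Type) (s : seq I) (P : pred I) (F : I -> R[i]) :
  Im (\sum_(i <- s | P i) F i) = \sum_(i <- s | P i) Im (F i).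
Proof. exact: (big_morph _ ImD). Qed.

Definition nsq z : R := Re z ^+ 2 + Im z ^+ 2.

Lemma nsq_ge0 z : 0 <= nsq z. Proof. by rewrite addr_ge0// sqr_ge0. Qed.
Lemma nsqM a b : nsq (a * b) = nsq a * nsq b.
Proof. by rewrite /nsq ReM ImM; ring. Qed.
Lemma nsqN a : nsq (- a) = nsq a. Proof. by rewrite /nsq ReN ImN !sqrrN. Qed.
Lemma nsqJ a : nsq (conjc a) = nsq a. Proof. by rewrite /nsq ReJ ImJ sqrrN. Qed.
Lemma nsqR (x : R) : nsq x%:C%C = x ^+ 2. Proof. by rewrite /nsq /= expr0n/= addr0. Qed.
Lemma nsq0 : nsq 0 = 0. Proof. by rewrite (nsqR 0) expr0n. Qed.
Lemma nsq_nat n : nsq n%:R = n%:R ^+ 2.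
Proof. by rewrite -(rmorph_nat (real_complex R)) nsqR. Qed.
Lemma nsq_eq0 z : nsq z = 0 -> z = 0.
Proof.
move/eqP; rewrite paddr_eq0 ?sqr_ge0// !sqrf_eq0 => /andP[/eqP a /eqP b].
exact: complex_ext.
Qed.

Lemma normc_sqr z : Normc.normc z ^+ 2 = nsq z.
Proof. by case: z => a b; rewrite /Normc.normc sqr_sqrtr// addr_ge0// sqr_ge0. Qed.

Lemma mulJ z : z * conjc z = (nsq z)%:C%C.
Proof. by apply: complex_ext; rewrite ?ReM ?ImM ReJ ImJ /nsq /=; ring. Qed.

Lemma mulRe (x : R) z : Re (x%:C%C * z) = x * Re z. Proof. by rewrite ReM /= mul0r subr0. Qed.

Lemma nsqD a b : nsq (a + b) = nsq a + nsq b + 2 * Re (a * conjc b).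
Proof. by rewrite /nsq ReD ImD ReM ReJ ImJ; ring. Qed.

Lemma nsqD_le (e : R) a b : 0 < e -> nsq (a + b) <= (1 + e) * nsq a + (1 + e^-1) * nsq b.
Proof.
move=> e0; have h (x y : R) : (x + y) ^+ 2 <= (1 + e) * x ^+ 2 + (1 + e^-1) * y ^+ 2.
  rewrite -subr_ge0 (_ : _ - _ = (e * x - y) ^+ 2 / e); last by field; rewrite gt_eqF.
  by rewrite divr_ge0 ?sqr_ge0// ltW.
by rewrite /nsq ReD ImD !mulrDr addrACA lerD.
Qed.

Lemma nsqD_le2 a b : nsq (a + b) <= 2 * (nsq a + nsq b).
Proof. by have := @nsqD_le 1 a b ltr01; rewrite invr1 -mulrDr. Qed.

(** The optimisation step of Cauchy-Schwarz, with [P = |f|^2], [Q = |g|^2], [S = |<f, g>|^2]: take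
    [s = 1 / Q], or a large [s] when [Q = 0]. It serves for finite sums, for integrals and for the
    orthogonality of a projection. *)
Lemma le_of_quadratic (P S Q : R) : 0 <= P -> 0 <= S -> 0 <= Q ->
  (forall s, 0 <= P - 2 * s * S + s ^+ 2 * S * Q) -> S <= P * Q.
Proof.
move=> P0 S0 Q0 h; have [Q1|Q1] := eqVneq Q 0; last first.
  have {}Q0 : 0 < Q by rewrite lt_def Q1.
  have := h Q^-1; rewrite (_ : _ + _ = P - S / Q); last by field.
  by rewrite subr_ge0 ler_pdivrMr.
have [->|S1] := eqVneq S 0; first by rewrite mulr_ge0.
have := h ((P + 1) / (2 * S)); rewrite Q1 mulr0 addr0.
rewrite (_ : _ - _ = -1); last by field.
by rewrite oppr_ge0 ler10.
Qed.

Lemma cauchy_schwarz_sum (I : Type) (s : seq I) (a b : I -> R[i]) :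
  nsq (\sum_(i <- s) a i * b i) <= (\sum_(i <- s) nsq (a i)) * (\sum_(i <- s) nsq (b i)).
Proof.
set S := \sum_(i <- s) a i * b i.
apply: le_of_quadratic; [by apply: sumr_ge0 => i _; exact: nsq_ge0|exact: nsq_ge0|
  by apply: sumr_ge0 => i _; exact: nsq_ge0|move=> t].
rewrite (_ : _ + _ = \sum_(i <- s) nsq (a i - t%:C%C * S * conjc (b i))).
  by apply: sumr_ge0 => i _; exact: nsq_ge0.
under [in RHS]eq_bigr => i _ do rewrite nsqD nsqN !nsqM nsqJ nsqR.
rewrite [in RHS]big_split/= [X in _ = X + _]big_split/= -!mulr_sumr -Re_sum addrAC;
    congr (_ + _ + _).
rewrite -mulrA -mulrN; congr (_ * _).
transitivity (Re (- (t%:C%C * conjc S) * S)).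
  rewrite mulNr ReN -mulrA mulRe; congr (- (_ * _)).
  by rewrite mulrC mulJ.
have -> : - (t%:C%C * conjc S) * S = \sum_(i <- s) - (t%:C%C * conjc S) * (a i * b i).
  by rewrite -mulr_sumr.
congr Re; apply: eq_bigr => i _.
by rewrite conjcN !conjcM conjcK conjc_real; ring.
Qed.

End complex_arith.

Lemma measurable_eq d d' (T : measurableType d) (T' : measurableType d') (f g : T -> T') :
  f =1 g -> measurable_fun setT g -> measurable_fun setT f.
Proof. by move=> /funext ->. Qed.

Section complex_measurable.
Context d (T : measurableType d) (R : realType).
Implicit Types f g : T -> R[i].

Definition cmeas f := measurable_fun setT (fun t => complex.Re (f t)) /\
  measurable_fun setT (fun t => complex.Im (f t)).

Lemma cmeasD f g : cmeas f -> cmeas g -> cmeas (fun t => f t + g t).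
Proof.
move=> [f1 f2] [g1 g2]; split.
  by apply: (measurable_eq (fun t => ReD (f t) (g t))); mfun.
by apply: (measurable_eq (fun t => ImD (f t) (g t))); mfun.
Qed.

Lemma cmeasM f g : cmeas f -> cmeas g -> cmeas (fun t => f t * g t).
Proof.
move=> [f1 f2] [g1 g2]; split.
  by apply: (measurable_eq (fun t => ReM (f t) (g t))); mfun.
by apply: (measurable_eq (fun t => ImM (f t) (g t))); mfun.
Qed.

Lemma cmeasN f : cmeas f -> cmeas (fun t => - f t).
Proof.
move=> [f1 f2]; split.
  by apply: (measurable_eq (fun t => ReN (f t))); mfun.
by apply: (measurable_eq (fun t => ImN (f t))); mfun.
Qed.

Lemma cmeasJ f : cmeas f -> cmeas (fun t => conjc (f t)).
Proof.
move=> [f1 f2]; split; first by apply: (measurable_eq (fun t => ReJ (f t))); mfun.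
by apply: (measurable_eq (fun t => ImJ (f t))); mfun.
Qed.

Lemma cmeas_cst (c : R[i]) : cmeas (fun=> c).
Proof. by split; exact: measurable_cst. Qed.

Lemma cmeas_sum (I : Type) (s : seq I) (P : pred I) (F : I -> T -> R[i]) :
  (forall i, cmeas (F i)) -> cmeas (fun t => \sum_(i <- s | P i) F i t).
Proof.
move=> h; elim: s => [|i s IH].
  by under eq_fun do rewrite big_nil; exact: cmeas_cst.
under eq_fun do rewrite big_cons.
by case: (P i) => //; exact: cmeasD.
Qed.

Lemma cmeas_comp d' (T' : measurableType d') (h : T' -> T) f :
  cmeas f -> measurable_fun setT h -> measurable_fun setT (fun t => complex.Re (f (h t))) /\
      measurable_fun setT (fun t => complex.Im (f (h t))).
Proof. by move=> [f1 f2] mh; split; [exact: (measurableT_comp f1)|exact: (measurableT_comp f2)].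
    Qed.

Lemma cmeas_nsq f : cmeas f -> measurable_fun setT (fun t => nsq (f t)).
Proof. by move=> [f1 f2]; rewrite /nsq; mfun. Qed.

Variable mu : {measure set T -> \bar R}.

Definition n2 f : \bar R := (\int[mu]_t (nsq (f t))%:E)%E.

Lemma n2_ge0 f : (0 <= n2 f)%E.
Proof. by apply: integral_ge0 => t _; rewrite lee_fin nsq_ge0. Qed.

Lemma n2_sqint f : cmeas f ->
  (n2 f = sqint mu (fun t => complex.Re (f t)) + sqint mu (fun t => complex.Im (f t)))%E.
Proof. by move=> [f1 f2]; rewrite /sqint -ge0_integralDT; try (by mfun); try ge0. Qed.

Definition l2 f := cmeas f /\ (n2 f < +oo)%E.

Lemma l2Z (c : R[i]) f : l2 f -> l2 (fun t => c * f t).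
Proof.
move=> [mf fy]; split; first by apply: cmeasM => //; exact: cmeas_cst.
rewrite /n2; under eq_integral do rewrite nsqM EFinM.
rewrite ge0_integralZT; last 3 first.
- by apply: measEFin; exact: cmeas_nsq.
- by move=> t; rewrite lee_fin nsq_ge0.
- exact: nsq_ge0.
by rewrite lte_mul_pinfty// lee_fin nsq_ge0.
Qed.

Lemma l2D f g : l2 f -> l2 g -> l2 (fun t => f t + g t).
Proof.
move=> [mf fy] [mg gy]; split; first exact: cmeasD.
apply: (@le_lt_trans _ _ (2%:E * (n2 f + n2 g))%E).
  have m1 := cmeas_nsq mf; have m2 := cmeas_nsq mg; have m3 := cmeas_nsq (cmeasD mf mg).
  rewrite /n2 -ge0_integralDT; last 4 first.
  - exact: measEFin.
  - exact: measEFin.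
  - by move=> t; rewrite lee_fin nsq_ge0.
  - by move=> t; rewrite lee_fin nsq_ge0.
  rewrite -ge0_integralZT//; last 2 first.
  - by apply: emeasurable_funD; exact: measEFin.
  - by move=> t; rewrite -EFinD lee_fin addr_ge0// nsq_ge0.
  apply: ge0_le_integralT.
  - exact: measEFin.
  - by apply: measurable_funeM; apply: emeasurable_funD; exact: measEFin.
  - by move=> t; rewrite lee_fin nsq_ge0.
  - by move=> t; rewrite -EFinD -EFinM lee_fin nsqD_le2.
by rewrite lte_mul_pinfty// lte_add_pinfty.
Qed.

Lemma l2N f : l2 f -> l2 (fun t => - f t).
Proof. by move=> /(l2Z (-1)); under eq_fun do rewrite mulN1r. Qed.

Lemma l2B f g : l2 f -> l2 g -> l2 (fun t => f t - g t).
Proof. by move=> lf lg; apply: l2D => //; exact: l2N. Qed.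

Lemma l20 : l2 (fun=> 0).
Proof.
by split; [exact: cmeas_cst|rewrite /n2; under eq_integral do rewrite nsq0; rewrite integral0].
Qed.

Lemma l2_sum (I : Type) (s : seq I) (P : pred I) (F : I -> T -> R[i]) :
  (forall i, l2 (F i)) -> l2 (fun t => \sum_(i <- s | P i) F i t).
Proof.
move=> h; elim: s => [|i s IH].
  by under eq_fun do rewrite big_nil; exact: l20.
under eq_fun do rewrite big_cons.
by case: (P i) => //; exact: l2D.
Qed.

(** The real value of [n2], meaningful for [l2] functions: algebra is done with [rn], Tonelli and
    convergence arguments with [n2]. *)
Definition rn f : R := fine (n2 f).

Lemma EFin_rn f : l2 f -> (rn f)%:E = n2 f.
Proof. by move=> [_ fy]; rewrite fineK// ge0_fin_numE// n2_ge0. Qed.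

Lemma rn_ge0 f : 0 <= rn f. Proof. by apply: fine_ge0; exact: n2_ge0. Qed.

Lemma intg_nsq f : l2 f -> intg mu (fun t => nsq (f t)).
Proof.
move=> [mf fy]; apply: ge0_intg => //; first exact: cmeas_nsq.
by move=> t; exact: nsq_ge0.
Qed.

Lemma rnE f : l2 f -> rn f = \int[mu]_t nsq (f t).
Proof. by []. Qed.

(** Convertible to [L2inner] when [mu] is Lebesgue measure. *)
Definition ip f g : R[i] := ((\int[mu]_t complex.Re (f t * conjc (g t))) +i*
   (\int[mu]_t complex.Im (f t * conjc (g t))))%C.

Lemma intg_mulJ f g : l2 f -> l2 g ->
  intg mu (fun t => complex.Re (f t * conjc (g t))) /\
  intg mu (fun t => complex.Im (f t * conjc (g t))).
Proof.
move=> lf lg; have [mf _] := lf; have [mg _] := lg.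
have [m1 m2] := cmeasM mf (cmeasJ mg).
have i1 := intgD (intg_nsq lf) (intg_nsq lg).
have xy (x y u v : R) : `|x * u + y * v| <= (x ^+ 2 + y ^+ 2) + (u ^+ 2 + v ^+ 2).
  have hn (w z : R) : - z <= w -> w <= z -> `|w| <= z by move=> ? ?; rewrite ler_norml; apply/andP.
  have h1 := sqr_ge0 (x + u); have h2 := sqr_ge0 (x - u).
  have h3 := sqr_ge0 (y + v); have h4 := sqr_ge0 (y - v).
  have h5 := sqr_ge0 x; have h6 := sqr_ge0 y; have h7 := sqr_ge0 u; have h8 := sqr_ge0 v.
  by apply: hn; nra.
split; apply: le_intg i1 => // t.
- by rewrite ReM ReJ ImJ mulrN opprK; exact: xy.
- rewrite ImM ReJ ImJ; apply: (le_trans (xy _ _ _ _)).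
  by rewrite /nsq sqrrN [X in _ + X <= _]addrC.
Qed.

Lemma ipDl f f' g : l2 f -> l2 f' -> l2 g -> ip (fun t => f t + f' t) g = ip f g + ip f' g.
Proof.
move=> lf lf' lg; have [i1 i2] := intg_mulJ lf lg; have [i3 i4] := intg_mulJ lf' lg.
apply: complex_ext; rewrite ?ReD ?ImD /ip /= -RintD//; apply: eq_Rintegral => t _.
  by rewrite mulrDl ReD.
by rewrite mulrDl ImD.
Qed.

Lemma ipJ f g : l2 f -> l2 g -> conjc (ip f g) = ip g f.
Proof.
move=> lf lg; have [i1 i2] := intg_mulJ lf lg.
apply: complex_ext; rewrite ?ReJ ?ImJ /ip /=.
  by apply: eq_Rintegral => t _; rewrite !ReM !ReJ !ImJ; ring.
rewrite -RintN//; apply: eq_Rintegral => t _; rewrite !ImM !ReJ !ImJ; ring.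
Qed.

Lemma ipZl c f g : l2 f -> l2 g -> ip (fun t => c * f t) g = c * ip f g.
Proof.
move=> lf lg; have [i1 i2] := intg_mulJ lf lg.
apply: complex_ext.
  rewrite ReM /ip /= -!RintZ// -RintB; [|exact: intgZ..].
  by apply: eq_Rintegral => t _; rewrite -mulrA ReM.
rewrite ImM /ip /= -!RintZ// -RintD; [|exact: intgZ..].
by apply: eq_Rintegral => t _; rewrite -mulrA ImM.
Qed.

Lemma ipDr f g g' : l2 f -> l2 g -> l2 g' -> ip f (fun t => g t + g' t) = ip f g + ip f g'.
Proof.
move=> lf lg lg'; rewrite -ipJ//; last exact: l2D.
by rewrite ipDl// conjcD !ipJ.
Qed.

Lemma ipZr c f g : l2 f -> l2 g -> ip f (fun t => c * g t) = conjc c * ip f g.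
Proof. by move=> lf lg; rewrite -ipJ//; [rewrite ipZl// conjcM ipJ|exact: l2Z]. Qed.

Lemma ip0l g : l2 g -> ip (fun=> 0) g = 0.
Proof.
move=> lg; rewrite -[RHS](mul0r (ip (fun=> 0) g)) -ipZl//; last exact: l20.
by congr ip; apply/funext => t; rewrite mul0r.
Qed.

Lemma ip0r g : l2 g -> ip g (fun=> 0) = 0.
Proof. by move=> lg; rewrite -ipJ ?ip0l ?conjc0//; exact: l20. Qed.

Lemma ip_suml (I : Type) (s : seq I) (F : I -> T -> R[i]) g :
  (forall i, l2 (F i)) -> l2 g -> ip (fun t => \sum_(i <- s) F i t) g = \sum_(i <- s) ip (F i) g.
Proof.
move=> lF lg; elim: s => [|i s IH].
  by rewrite big_nil; under eq_fun do rewrite big_nil; exact: ip0l.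
rewrite big_cons -IH -ipDl//; last exact: l2_sum.
by under eq_fun do rewrite big_cons.
Qed.

Lemma ip_sumr (I : Type) (s : seq I) (F : I -> T -> R[i]) g :
  (forall i, l2 (F i)) -> l2 g -> ip g (fun t => \sum_(i <- s) F i t) = \sum_(i <- s) ip g (F i).
Proof.
move=> lF lg; elim: s => [|i s IH].
  by rewrite big_nil; under eq_fun do rewrite big_nil; exact: ip0r.
rewrite big_cons -IH -ipDr//; last exact: l2_sum.
by under eq_fun do rewrite big_cons.
Qed.

Lemma ipNr f g : l2 f -> l2 g -> ip f (fun t => - g t) = - ip f g.
Proof.
move=> lf lg; have := ipZr (-1) lf lg; under eq_fun do rewrite mulN1r.
by move=> ->; rewrite conjcN conjc1 mulN1r.
Qed.

Lemma ipBr f g g' : l2 f -> l2 g -> l2 g' -> ip f (fun t => g t - g' t) = ip f g - ip f g'.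
Proof. by move=> lf lg lg'; rewrite ipDr ?ipNr//; exact: l2N. Qed.

Lemma ipBl f g g' : l2 f -> l2 g -> l2 g' -> ip (fun t => g t - g' t) f = ip g f - ip g' f.
Proof. by move=> lf lg lg'; rewrite -ipJ ?ipBr ?conjcD ?conjcN ?ipJ//; exact: l2B. Qed.

Lemma ip_self f : l2 f -> ip f f = (rn f)%:C%C.
Proof.
move=> lf; apply: complex_ext => /=; rewrite ?rnE//; last first.
  by under eq_Rintegral do rewrite mulJ /=; rewrite /Rintegral integral0.
by apply: eq_Rintegral => t _; rewrite mulJ.
Qed.

Lemma rnD f g : l2 f -> l2 g ->
  rn (fun t => f t + g t) = rn f + rn g + 2 * complex.Re (ip f g).
Proof.
move=> lf lg; have lfg := l2D lf lg.
have [i1 _] := intg_mulJ lf lg; have i2 := intg_nsq lf; have i3 := intg_nsq lg.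
rewrite !rnE// /ip /= -RintZ// -RintD// -RintD//; [|exact: intgD|exact: intgZ].
by apply: eq_Rintegral => t _; rewrite nsqD.
Qed.

Lemma rnZ c f : l2 f -> rn (fun t => c * f t) = nsq c * rn f.
Proof.
move=> lf; rewrite !rnE -?RintZ//; [|exact: intg_nsq|exact: l2Z].
by apply: eq_Rintegral => t _; rewrite nsqM.
Qed.

Lemma rnN f : l2 f -> rn (fun t => - f t) = rn f.
Proof. by move=> lf; rewrite /rn /n2; under eq_integral do rewrite nsqN. Qed.

Lemma rnB f g : l2 f -> l2 g ->
  rn (fun t => f t - g t) = rn f + rn g - 2 * complex.Re (ip f g).
Proof. by move=> lf lg; rewrite rnD ?rnN ?ipNr ?ReN ?mulrN//; exact: l2N. Qed.

Lemma rnC f g : rn (fun t => f t - g t) = rn (fun t => g t - f t).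
Proof. by rewrite /rn /n2; under eq_integral do rewrite -nsqN opprB. Qed.

Lemma cauchy_schwarz f g : l2 f -> l2 g -> nsq (ip f g) <= rn f * rn g.
Proof.
move=> lf lg; apply: le_of_quadratic; rewrite ?nsq_ge0 ?rn_ge0// => t.
have := rn_ge0 (fun x => f x - (t%:C%C * ip f g) * g x).
rewrite rnB//; last exact: l2Z.
rewrite rnZ// ipZr// nsqM nsqR conjcM conjc_real.
rewrite -[_ * _ * ip f g]mulrA mulRe [conjc _ * _]mulrC mulJ /=.
by rewrite mulrA addrAC.
Qed.

Lemma rnD_le (e : R) f g : 0 < e -> l2 f -> l2 g ->
  rn (fun t => f t + g t) <= (1 + e) * rn f + (1 + e^-1) * rn g.
Proof.
move=> e0 lf lg; have i2 := intg_nsq lf; have i3 := intg_nsq lg.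
rewrite !rnE//; last exact: l2D.
rewrite -!RintZ// -RintD; [|exact: intgZ..].
apply: le_Rintegral => // [||t _]; last exact: nsqD_le.
- by apply: intg_nsq; exact: l2D.
- by apply: intgD; exact: intgZ.
Qed.

End complex_measurable.

(** * Completeness of the space of square-integrable functions *)

Section sqint_complete.
Context d (T : measurableType d) (R : realType) (mu : {measure set T -> \bar R}).

(* Cauchy-Schwarz with weights [2^-i]: it gives a single pointwise majorant for
   the increments of a rapidly converging subsequence. *)
Let sqr_telescope (w : nat -> R) (j m : nat) :
  (\sum_(0 <= i < m) w (j + i)%N) ^+ 2 <= \sum_(0 <= i < m) 2 ^+ i.+1 * w (j + i)%N ^+ 2.
Proof.
elim: m j => [|m IH] j; first by rewrite !big_nil expr0n.
rewrite !big_nat_recl//= addn0.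
have -> : \sum_(0 <= i < m) w (j + i.+1)%N = \sum_(0 <= i < m) w (j.+1 + i)%N.
  by apply: eq_bigr => i _; rewrite addnS.
have -> : \sum_(0 <= i < m) 2 ^+ i.+2 * w (j + i.+1)%N ^+ 2 =
    2 * \sum_(0 <= i < m) 2 ^+ i.+1 * w (j.+1 + i)%N ^+ 2.
  by rewrite mulr_sumr; apply: eq_bigr => i _; rewrite addnS exprS mulrA.
have := IH j.+1; set A := \sum_(_ <= _ < _) _; set B := \sum_(_ <= _ < _) _ => AB.
have := sqr_ge0 (w j - A); rewrite expr1; nra.
Qed.

(** Along a subsequence [v] with increments of square norm at most [4^-j], the weighted sum [W] of
    squared increments has integral at most [4]. Where [W] is finite [v] is Cauchy, and
    [(f - v j)^2 <= 2^-j W] holds everywhere, trivially where [W] is infinite; this gives both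
    integrability of the limit and convergence. *)
Lemma sqint_complete (u : nat -> T -> R) :
  (forall k, measurable_fun setT (u k)) -> (forall k, sqint mu (u k) < +oo)%E ->
  (forall e, 0 < e -> exists K, forall m n, (K <= m)%N -> (K <= n)%N ->
    (sqint mu (fun x => u m x - u n x)%R <= e%:E)%E) ->
  exists f, [/\ measurable_fun setT f, (sqint mu f < +oo)%E &
    forall e, 0 < e -> exists K, forall m, (K <= m)%N ->
      (sqint mu (fun x => u m x - f x)%R <= e%:E)%E].
Proof.
move=> mu_ uy cu.
have e4 j : 0 < 4^-1 ^+ j :> R by rewrite exprn_gt0.
have /choice[K hK] j := cu _ (e4 j).
(* Summing the [K i] makes [k] nondecreasing and at least [K j]; adding [j] makes it unbounded. *)
pose k j := (\sum_(i < j.+1) K i + j)%N.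
have jk j : (j <= k j)%N by rewrite leq_addl.
have Kk j : (K j <= k j)%N by rewrite /k big_ord_recr/= -addnA -addnCA leq_addr.
have kS j : (k j <= k j.+1)%N by rewrite /k [in leqRHS]big_ord_recr/= leq_add// leq_addr.
pose v j := u (k j); pose w j x := v j.+1 x - v j x.
have mw j : measurable_fun setT (w j) by apply: measB; exact: mu_.
have wle j : (sqint mu (w j) <= (4^-1 ^+ j)%:E)%E.
  by apply: hK => //; exact: leq_trans (Kk j) (kS j).
pose a j x := 2 ^+ j.+1 * w j x ^+ 2.
have a0 j x : 0 <= a j x by rewrite mulr_ge0 ?sqr_ge0 ?exprn_ge0.
have ma j : measurable_fun setT (EFin \o a j) by apply: measEFin; rewrite /a; mfun.
pose W x := (\sum_(0 <= i <oo) (a i x)%:E)%E.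
have W0 x : (0 <= W x)%E by apply: nneseries_ge0 => i _ _; rewrite lee_fin.
have mW : measurable_fun setT W by apply: (@ge0_emeasurable_sum _ _ _ setT (fun i x =>
    (a i x)%:E) xpredT); [move=> i x _ _; rewrite lee_fin|move=> i _; exact: ma].
have intW : (\int[mu]_x W x <= 4%:E)%E.
  rewrite integral_nneseries//; last by move=> i x _; rewrite lee_fin.
  apply: lime_le; first by apply: is_cvg_nneseries => i _ _; apply: integral_ge0 => x _;
      rewrite lee_fin.
  apply: nearW => m; apply: (@le_trans _ _ (\sum_(0 <= i < m) (2 * 2^-1 ^+ i)%:E)%E).
    apply: lee_sum => i _; under eq_integral do rewrite EFinM.
    rewrite ge0_integralZT; [|by apply: measEFin; mfun|by move=> x;
        rewrite lee_fin sqr_ge0|exact: exprn_ge0].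
    apply: (@le_trans _ _ ((2 ^+ i.+1)%:E * (4^-1 ^+ i)%:E)%E).
      by apply: lee_wpmul2l; [rewrite lee_fin exprn_ge0|exact: wle].
    by rewrite -EFinM lee_fin exprS -mulrA -exprMn (_ : 2 * 4^-1 = 2^-1 :> R)//; lra.
  rewrite sumEFin lee_fin -mulr_sumr.
  have -> : \sum_(0 <= i < m) 2^-1 ^+ i = 2 - 2 * 2^-1 ^+ m :> R.
    elim: m => [|m IH]; first by rewrite big_nil expr0; lra.
    by rewrite big_nat_recr//= IH exprS; lra.
  by have : 0 <= 2^-1 ^+ m :> R by [rewrite exprn_ge0]; lra.
have vW j m x : (((v (j + m)%N x - v j x) ^+ 2)%:E <= (2^-1 ^+ j)%:E * W x)%E.
  have -> : v (j + m)%N x - v j x = \sum_(0 <= i < m) w (j + i)%N x.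
    elim: m => [|m IH]; first by rewrite big_nil addn0 subrr.
    by rewrite big_nat_recr//= -IH addnS /w addrC addrA subrK.
  have h1 := sqr_telescope (fun i => w i x) j m.
  apply: (@le_trans _ _ ((2^-1 ^+ j)%:E * (\sum_(0 <= i < j + m) (a i x))%:E)%E).
    rewrite -EFinM lee_fin (le_trans h1)// mulr_sumr.
    rewrite [leRHS](@big_cat_nat _ _ _ j)//= ?leq_addr//.
    rewrite -[leLHS]add0r lerD//; first by apply: sumr_ge0 => i _; rewrite mulr_ge0// exprn_ge0.
    have -> : \sum_(j <= i < j + m) 2^-1 ^+ j * a i x = \sum_(0 <= i < m) 2^-1 ^+ j * a (i + j)%N x.
      by rewrite -{1}[j]add0n big_addn addKn.
    apply: ler_sum => i _; rewrite /a [leRHS]mulrA (addnC i).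
    have -> : 2^-1 ^+ j * 2 ^+ (j + i).+1 = 2 ^+ i.+1 :> R.
      by rewrite -addnS exprD mulrA -exprMn mulVf// expr1n mul1r.
    exact: lexx.
  apply: lee_wpmul2l; first by rewrite lee_fin exprn_ge0.
  rewrite -sumEFin; apply: nneseries_lim_ge => i _ _; by rewrite lee_fin.
pose E := [set x | (W x < +oo)%E].
have mE : measurable E.
  rewrite /E -[X in measurable X]setTI; exact: emeasurable_fun_infty_o.
have cv x : cvgn (fun j => v j x * \1_E x).
  rewrite indicE; case: (boolP (x \in E)) => xE; last first.
    by under eq_fun do rewrite mulr0; exact: is_cvg_cst.
  under eq_fun do rewrite mulr1.
  move: xE; rewrite inE => xE.
  have Wf : W x = (fine (W x))%:E by rewrite fineK// ge0_fin_numE.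
  apply/cauchy_cvgP/cauchy_exP => _/posnumP[e].
  have [J hJ] : exists J : nat, 2^-1 ^+ J * fine (W x) < e%:num ^+ 2.
    have c0 : 2^-1 ^+ j * fine (W x) @[j --> \oo] --> (0 * fine (W x)).
      by apply: cvgMl; apply: cvg_expr; rewrite ger0_norm// invf_lt1// ltr1n.
    have := cvgr_lt _ c0 (e%:num ^+ 2); rewrite mul0r => /(_ _)[]//.
    by move=> J _ /(_ J (leqnn J)); exists J.
  exists (v J x); exists J => //= j /= Jj.
  have := vW J (j - J)%N x; rewrite subnKC// Wf -EFinM lee_fin => h1.
  have := le_lt_trans h1 hJ.
  move=> h2; rewrite /ball /= distrC -(@ltr_pXn2r _ 2)// ?nnegrE//.
  by rewrite real_normK ?num_real.
(* The indicator makes the sequence converge at every point, so that [f] is measurable as an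
   everywhere limit. *)
pose f x := limn (fun j => v j x * \1_E x).
have mf : measurable_fun setT f.
  apply: (@measurable_fun_cvg _ _ _ _ (fun j x => v j x * \1_E x)) => [j|x _]; last exact: cv.
  by apply: measM; [exact: mu_|exact: measurable_indic].
have fW j x : (((f x - v j x) ^+ 2)%:E <= (2^-1 ^+ j)%:E * W x)%E.
  have [xE|] := boolP (x \in E); last first.
    rewrite notin_setE /E /= => /negP; rewrite -leNgt leye_eq => /eqP ->.
    by rewrite gt0_muley ?leey// lte_fin exprn_gt0.
  have Wf : W x = (fine (W x))%:E by rewrite fineK// ge0_fin_numE//; move: xE; rewrite inE.
  rewrite Wf -EFinM lee_fin.
  have c1 : (v (j + m)%N x - v j x) ^+ 2 @[m --> \oo] --> (f x - v j x) ^+ 2.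
    rewrite expr2; under eq_fun do rewrite expr2.
    have c2 : v (j + m)%N x - v j x @[m --> \oo] --> f x - v j x.
      apply: cvgB; last exact: cvg_cst.
      have c3 : v i x @[i --> \oo] --> f x.
        have := cv x; rewrite /f (_ : (fun j => v j x * \1_E x) = v^~ x)//.
        by apply/funext => i; rewrite indicE xE mulr1.
      have := c3; rewrite -(cvg_shiftn j); apply: cvg_eq1 => m /=.
      by rewrite addnC.
    exact: cvgM.
  rewrite -(cvg_lim (@Rhausdorff R) c1); apply: limr_le; first by apply/cvg_ex; eexists; exact: c1.
  by apply: nearW => m /=; have := vW j m x; rewrite Wf.
have fv j : (sqint mu (fun x => f x - v j x)%R <= (2^-1 ^+ j * 4)%:E)%E.
  apply: (@le_trans _ _ (\int[mu]_x ((2^-1 ^+ j)%:E * W x))%E).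
    apply: ge0_le_integralT => //; first by apply: measEFin; apply: measX; apply: measB => //;
        exact: mu_.
    - exact: measurable_funeM.
    - by move=> x; rewrite lee_fin sqr_ge0.
  rewrite ge0_integralZT// ?exprn_ge0// EFinM.
  by apply: lee_wpmul2l => //; rewrite lee_fin exprn_ge0.
exists f; split => //.
- rewrite (_ : f = fun x => v 0%N x + (f x - v 0%N x)); last by apply/funext => x;
    rewrite addrC subrK.
  apply: (le_lt_trans (sqintD _ _ _)); [exact: mu_|by apply: measB => //; exact: mu_|].
  by rewrite lte_mul_pinfty// lte_add_pinfty//; [exact: uy|exact: le_lt_trans (fv _) (ltry _)].
- move=> e e0; have [K1 hK1] := cu _ (divr_gt0 e0 (ltr0n R 4)).
  have [J hJ] : exists J : nat, forall j, (J <= j)%N -> 2^-1 ^+ j * 4 < e / 4.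
    have c0 : 2^-1 ^+ j * 4 @[j --> \oo] --> (0 * 4 : R).
      by apply: cvgMl; apply: cvg_expr; rewrite ger0_norm// invf_lt1// ltr1n.
    have := cvgr_lt _ c0 (e / 4); rewrite mul0r => /(_ _ (divr_gt0 e0 (ltr0n R 4)))[J _ h].
    by exists J => j; exact: h.
  exists K1 => m Km; pose j := (J + K1)%N.
  have -> : (fun x => u m x - f x) = (fun x => (u m x - v j x) - (f x - v j x)).
    by apply/funext => x; rewrite opprB addrA subrK.
  apply: (le_trans (sqintB_le _ _ _)); [by apply: measB; exact: mu_|by apply: measB => //;
      exact: mu_|].
  rewrite (_ : e = 2 * (e / 4 + e / 4)); last by field.
  rewrite EFinM; apply: lee_wpmul2l; first by rewrite lee_fin.
  rewrite [leRHS]EFinD; apply: leeD.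
    by apply: hK1 => //; exact: leq_trans (leq_addl _ _) (jk _).
  by apply: (le_trans (fv _)); rewrite lee_fin ltW// hJ// leq_addr.
Qed.

End sqint_complete.

(** * Orthogonal projection onto the closure of a subspace *)

Section hilbert.
Context d (T : measurableType d) (R : realType) (mu : {measure set T -> \bar R}).
Local Notation l2 := (l2 mu).
Local Notation rn := (rn mu).
Local Notation ip := (ip mu).
Implicit Types f g q : T -> R[i].

Lemma l2_complete (f : nat -> T -> R[i]) : (forall k, l2 (f k)) ->
  (forall e, 0 < e -> exists K, forall m n, (K <= m)%N -> (K <= n)%N ->
    rn (fun x => f m x - f n x) <= e) ->
  exists2 h, l2 h & forall e, 0 < e -> exists K, forall m, (K <= m)%N ->
    rn (fun x => f m x - h x) <= e.
Proof.
move=> lf cf.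
have n2B m n : (n2 mu (fun x => f m x - f n x)%R =
    sqint mu (fun x => complex.Re (f m x) - complex.Re (f n x))%R +
    sqint mu (fun x => complex.Im (f m x) - complex.Im (f n x))%R)%E.
  rewrite n2_sqint; last by have [] := l2B (lf m) (lf n).
  congr (_ + _)%E; apply: eq_integral => x _; first by rewrite ReB.
  by rewrite ImB.
have cn e : 0 < e -> exists K, forall m n, (K <= m)%N -> (K <= n)%N ->
    (n2 mu (fun x => f m x - f n x)%R <= e%:E)%E.
  move=> /cf[K hK]; exists K => m n Km Kn.
  by rewrite -EFin_rn ?lee_fin ?hK//; exact: l2B.
have fin k : (sqint mu (fun x => complex.Re (f k x)) < +oo)%E /\
    (sqint mu (fun x => complex.Im (f k x)) < +oo)%E.
  have [mf] := lf k; rewrite n2_sqint// => h; split; apply: le_lt_trans h.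
    by rewrite leeDl// sqint_ge0.
  by rewrite leeDr// sqint_ge0.
have [u [mu_ uy hu]] := sqint_complete (fun k => (lf k).1.1) (fun k => (fin k).1)
  (fun e e0 => let: ex_intro K hK := cn e e0 in ex_intro _ K (fun m n Km Kn =>
    le_trans (leeDl _ (sqint_ge0 mu _)) (eq_ind _ (fun z => (z <=
        e%:E)%E) (hK m n Km Kn) _ (n2B m n)))).
have [v [mv vy hv]] := sqint_complete (fun k => (lf k).1.2) (fun k => (fin k).2)
  (fun e e0 => let: ex_intro K hK := cn e e0 in ex_intro _ K (fun m n Km Kn =>
    le_trans (leeDr _ (sqint_ge0 mu _)) (eq_ind _ (fun z => (z <=
        e%:E)%E) (hK m n Km Kn) _ (n2B m n)))).
have lh : l2 (fun x => u x +i* v x)%C.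
  split; first by split.
  by rewrite n2_sqint /=; [rewrite lte_add_pinfty|split].
exists (fun x => u x +i* v x)%C => // e e0.
have [K1 h1] := hu _ (divr_gt0 e0 (ltr0n R 2)).
have [K2 h2] := hv _ (divr_gt0 e0 (ltr0n R 2)).
exists (maxn K1 K2) => m; rewrite geq_max => /andP[m1 m2].
have lfh := l2B (lf m) lh.
rewrite -lee_fin EFin_rn// n2_sqint; last by case: lfh.
rewrite (splitr e) EFinD; apply: leeD.
  by apply: le_trans (h1 _ m1); rewrite /sqint; under eq_integral do rewrite ReB.
by apply: le_trans (h2 _ m2); rewrite /sqint; under eq_integral do rewrite ImB.
Qed.

Lemma nsq_eq0_small (z : R[i]) (C : R) : (forall e, 0 < e -> nsq z <= C * e) -> z = 0.
Proof.
move=> h; apply: nsq_eq0; apply/eqP; rewrite eq_le nsq_ge0 andbT.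
apply/ler_addgt0Pl => e e0; rewrite addr0.
have C0 : 0 < `|C| + 1 by rewrite ltr_wpDl.
apply: (le_trans (h (e / (`|C| + 1)) _)); first by rewrite divr_gt0.
rewrite mulrCA -[leRHS]mulr1 ler_wpM2l ?(ltW e0)// ler_pdivrMr// mul1r.
by rewrite (le_trans (ler_norm _))// lerDl.
Qed.

Lemma parallelogram f g : l2 f -> l2 g ->
  rn (fun t => f t - g t) = 2 * rn f + 2 * rn g - rn (fun t => f t + g t).
Proof. by move=> lf lg; rewrite rnB// rnD//; ring. Qed.

(** A minimising sequence is Cauchy by the parallelogram law applied to midpoints, which stay in
    [V]. Since [V] need not be closed, the limit [p] lies in its closure, and the sequence [q]
    records this. *)
Lemma projection (V : (T -> R[i]) -> Prop) f :
  l2 f -> (forall v, V v -> l2 v) -> V (fun=> 0) ->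
  (forall u v, V u -> V v -> V (fun t => u t + v t)) ->
  (forall c u, V u -> V (fun t => c * u t)) ->
  exists p, [/\ l2 p, (forall v, V v -> ip (fun t => f t - p t) v = 0) &
    exists2 q : nat -> T -> R[i], (forall k, V (q k)) &
      forall e, 0 < e -> exists K, forall m, (K <= m)%N -> rn (fun t => q m t - p t) <= e].
Proof.
move=> lf Vl2 V0 VD VZ.
pose S : set R := [set rn (fun t => f t - v t) | v in V].
have S_inf : has_inf S.
  split; first by exists (rn (fun t => f t - 0)), (fun=> 0).
  by exists 0 => _ [v _ <-]; exact: rn_ge0.
have inf_le v : V v -> inf S <= rn (fun t => f t - v t).
  by move=> Vv; apply: ge_inf; [exact: S_inf.2|exists v].
have /choice[q hq] (k : nat) : exists q, V q /\ rn (fun t => f t - q t) <= inf S + k.+1%:R^-1.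
  have k0 : 0 < k.+1%:R^-1 :> R by [].
  have [_ [v Vv <-] h] := inf_adherent k0 S_inf.
  by exists v; split => //; exact: ltW.
have Vq k : V (q k) by case: (hq k).
have lq k : l2 (q k) by exact: Vl2.
have lfq k : l2 (fun t => f t - q k t) by exact: l2B.
have cauchy m n : rn (fun t => q m t - q n t) <= 2 * m.+1%:R^-1 + 2 * n.+1%:R^-1.
  have -> : (fun t => q m t - q n t) = (fun t => (f t - q n t) - (f t - q m t)).
    by apply/funext => t; ring.
  rewrite parallelogram//.
  have Vm : V (fun t => 2^-1 * (q n t + q m t)) by apply: (VZ 2^-1); exact: VD.
  have -> : (fun t => f t - q n t + (f t - q m t)) =
      (fun t => 2 * (f t - 2^-1 * (q n t + q m t))).
    by apply/funext => t; field.
  rewrite rnZ; last by apply: l2B => //; exact: Vl2.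
  rewrite nsq_nat (_ : 2%:R ^+ 2 = 4); last by ring.
  move: (inf_le _ Vm) (hq m).2 (hq n).2.
  set x := rn _; set y := rn _; set z := rn _; set a := m.+1%:R^-1; set b := n.+1%:R^-1.
  move: x y z a b (inf S) => x y z a b i; lra.
have small (e : R) : 0 < e -> exists K : nat, forall m, (K <= m)%N -> m.+1%:R^-1 <= e.
  move=> e0; have := cvgr_lt _ (@cvg_harmonic R) e e0 => -[K _ hK].
  by exists K => m Km; apply/ltW; exact: hK.
have [p lp hp] : exists2 h, l2 h & forall e, 0 < e -> exists K, forall m, (K <= m)%N ->
    rn (fun x => q m x - h x) <= e.
  apply: l2_complete => // e e0; have [K hK] := small _ (divr_gt0 e0 (ltr0n R 4)).
  exists K => m n Km Kn; apply: (le_trans (cauchy m n)).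
  by move: (hK _ Km) (hK _ Kn); set a := m.+1%:R^-1; set b := n.+1%:R^-1; move: a b => a b; lra.
exists p; split => //; last by exists q.
move=> v Vv; have lv := Vl2 _ Vv.
(* [q k] is minimal up to [1 / (k + 1)]: moving it by multiples of [v] cannot gain more, which by
   [le_of_quadratic] makes the residual almost orthogonal to [v]. *)
have qv k : nsq (ip (fun t => f t - q k t) v) <= k.+1%:R^-1 * rn v.
  apply: le_of_quadratic; rewrite ?nsq_ge0 ?rn_ge0// => s.
  pose c := s%:C%C * ip (fun t => f t - q k t) v.
  have Vc : V (fun t => q k t + c * v t) by apply: VD => //; exact: VZ.
  have := inf_le _ Vc; have := (hq k).2.
  have -> : (fun t => f t - (q k t + c * v t)) = (fun t => (f t - q k t) - c * v t).
    by apply/funext => t; ring.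
  rewrite (rnB (lfq k) (l2Z c lv)) rnZ// ipZr// nsqM nsqR conjcM conjc_real.
  rewrite -[_ * _ * ip _ v]mulrA mulRe [conjc _ * _]mulrC mulJ /=.
  set a := k.+1%:R^-1; set b := nsq _; set y := rn v.
  move: (rn _) (inf S) a b y => x i a b y; lra.
apply: (@nsq_eq0_small _ (4 * rn v)) => e e0.
have [K1 h1] := small _ e0; have [K2 h2] := hp _ e0.
pose k := maxn K1 K2.
have -> : ip (fun t => f t - p t) v = ip (fun t => f t - q k t) v + ip (fun t => q k t - p t) v.
  rewrite -ipDl//; last exact: l2B.
  by congr ip; apply/funext => t; rewrite addrA subrK.
apply: (le_trans (nsqD_le2 _ _)).
have e1 := qv k; have e2 := cauchy_schwarz (l2B (lq k) lp) lv.
have h4 := h1 k (leq_maxl _ _); have h3 := h2 k (leq_maxr _ _).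
have v0 := rn_ge0 mu v.
have e3 := ler_wpM2r v0 h3; have e4 := ler_wpM2r v0 h4.
rewrite -mulrA [rn v * e]mulrC.
move: e1 e2 e3 e4; set a := k.+1%:R^-1 * rn v; set b := nsq _; set c := nsq _.
set x := rn _ * rn v; move: (e * rn v) a b c x => y a b c x; lra.
Qed.

End hilbert.

(** * The norm of the definitions and integrals of squared moduli *)

Section L2_bridge.
Context {R : realType} {d : nat}.
Local Notation lam := (@lebesgue_cV R d).

Lemma L2norm_sqr (f : 'cV[R]_d -> R[i]) : (L2norm f ^+ 2 = n2 lam f)%E.
Proof.
have sqr (x : \bar R) : (0 <= x -> x ^+ 2 = x `^ 2)%E.
  case: x => [r r0||]//; first by rewrite poweR_EFin powR_mulrn// EFin_expe.
  by rewrite poweRyr// expe2 mulyy.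
rewrite sqr ?Lnorm_ge0// /L2norm poweR_Lnorm//.
apply: eq_integral => t _ /=.
by rewrite powR_mulrn// real_normK ?num_real// normc_sqr.
Qed.

Lemma L2P (f : 'cV[R]_d -> R[i]) : L2 f <-> l2 lam f.
Proof.
split=> [[mr mi fy]|[[mr mi] fy]].
  by split; [split|rewrite -L2norm_sqr expe2 lte_mul_pinfty// ?ge0_fin_numE// Lnorm_ge0].
split => //; rewrite ltey; apply/negP => /eqP h; move: fy.
by rewrite -L2norm_sqr h expe2 mulyy.
Qed.

End L2_bridge.

(** * Lebesgue measure of a stacked column as a product *)

Section product_decomposition.
Context {R : realType}.
Local Notation lam := (@lebesgue_cV R).

(** The identity typechecks because [n.+1 + m] and [(n + m).+1] are convertible; it drives the
    induction on the upper block in [ge0_integral_col_mx]. *)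
Lemma col_mx_cV_cons n m (a : R) (x : 'cV[R]_n) (xi : 'cV[R]_m) :
  col_mx (cV_cons (a, x)) xi = cV_cons (a, col_mx x xi) :> 'cV[R]_(n + m).+1.
Proof.
apply/matrixP => i j; rewrite ord1; case: (@unliftP (n + m).+1 ord0 i) => [k|] ->.
  rewrite cV_consS; case: (split_ordP k) => l ->.
    rewrite col_mxEu -(cV_consS a x l) (_ : lift ord0 _ = lshift m (lift ord0 l)).
      exact: (col_mxEu (cV_cons (a, x)) xi (lift ord0 l) ord0).
    exact: val_inj.
  rewrite (_ : lift ord0 _ = @rshift n.+1 m l); last exact: val_inj.
  have -> : col_mx x xi (rshift n l) ord0 = xi l ord0 by exact: col_mxEd.
  exact: (col_mxEd (cV_cons (a, x)) xi l ord0).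
rewrite cV_cons0 (_ : ord0 = @lshift n.+1 m ord0); last exact: val_inj.
rewrite -[RHS](cV_cons0 a x).
exact: (col_mxEu _ xi ord0 ord0).
Qed.

Lemma measurable_col_mx d (S : measurableType d) n m (f : S -> 'cV[R]_n) (g : S -> 'cV[R]_m) :
  measurable_fun setT f -> measurable_fun setT g ->
  measurable_fun setT (fun s => col_mx (f s) (g s)).
Proof.
move=> /measurable_fun_mxP mf /measurable_fun_mxP mg; apply/measurable_fun_mxP => i j.
case: (split_ordP i) => k ->.
  by apply: (measurable_eq (fun s => col_mxEu (f s) (g s) k j)); exact: mf.
by apply: (measurable_eq (fun s => col_mxEd (f s) (g s) k j)); exact: mg.
Qed.

Lemma ge0_integral_col_mx n m (h : 'cV[R]_(n + m) -> \bar R) :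
  measurable_fun setT h -> (forall z, 0 <= h z)%E ->
  (\int[lam (n + m)]_z h z = \int[lam n]_x \int[lam m]_xi h (col_mx x xi))%E.
Proof.
elim: n h => [|n IH] h mh h0.
  rewrite ge0_integral_cV0; apply: eq_integral => xi _; congr h.
  apply/matrixP => i j; case: (@split_ordP 0 m i) => k; first by case: k.
  by move=> ->; rewrite col_mxEd; congr (xi _ _); apply: val_inj.
have mK : measurable_fun setT (fun x => \int[lam m]_xi h (col_mx x xi))%E.
  apply: (@measurable_fun_fubini_tonelli_F _ _ 'cV[R]_n.+1 'cV[R]_m _ (lam m) (fun z =>
      h (col_mx z.1 z.2))) => //.
  by apply: (measurableT_comp mh); apply: measurable_col_mx; mfun.
rewrite [RHS]ge0_integral_cV_cons//; last by move=> x; apply: integral_ge0.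
rewrite (@ge0_integral_cV_cons _ (n + m) h)//; apply: eq_integral => a _.
rewrite (IH (fun w => h (cV_cons (a, w)))).
- apply: eq_integral => x _; apply: eq_integral => xi _; congr h.
  by rewrite col_mx_cV_cons.
- by apply: (measurableT_comp mh); exact: (measurableT_comp (@measurable_cV_cons _ _)).
- by move=> w; exact: h0.
Qed.

End product_decomposition.

(** * Time-frequency shifts and Moyal's identity *)

Section time_frequency.
Context {R : realType}.
Local Notation lam := (@lebesgue_cV R).
Local Notation e := (@expi2pi R).

Lemma expi2piD (a b : R) : e (a + b) = e a * e b.
Proof. by apply: complex_ext; rewrite ?ReM ?ImM /= mulrDr ?cosD ?sinD; ring. Qed.

Lemma expi2pi0 : e 0 = 1.
Proof. by apply: complex_ext; rewrite /= mulr0 ?cos0 ?sin0. Qed.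

Lemma expi2piJ (a : R) : conjc (e a) = e (- a).
Proof. by apply: complex_ext; rewrite ?ReJ ?ImJ /= mulrN ?cosN ?sinN. Qed.

Lemma nsq_expi2pi (a : R) : nsq (e a) = 1.
Proof. by rewrite /nsq /= cos2Dsin2. Qed.

Lemma expi2piNK (a : R) : e (- a) * e a = 1.
Proof. by rewrite -expi2piD addNr expi2pi0. Qed.

Lemma expi2pi_nat (k : nat) : e k%:R = 1.
Proof.
elim: k => [|k IH]; first exact: expi2pi0.
rewrite -natr1 expi2piD IH mul1r; apply: complex_ext; rewrite /= mulr1 mulr_natl.
  by rewrite cos2pi.
by rewrite sin2pi.
Qed.

Lemma expi2pi_int (k : int) : e k%:~R = 1.
Proof.
case: k => k; first exact: expi2pi_nat.
by rewrite NegzE mulrNz -expi2piJ expi2pi_nat conjc1.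
Qed.

Lemma cmeas_expi2pi d (S : measurableType d) (f : S -> R) : measurable_fun setT f ->
  cmeas (fun s => e (f s)).
Proof. by move=> mf; split => /=; mfun. Qed.

Lemma mulmx_dot d (x y : 'cV[R]_d) : (x^T *m y) ord0 ord0 = dot x y.
Proof. by rewrite mxE; apply: eq_bigr => i _; rewrite mxE. Qed.

Lemma dotDl d (x y z : 'cV[R]_d) : dot (x + y) z = dot x z + dot y z.
Proof. by rewrite /dot -big_split; apply: eq_bigr => i _; rewrite mxE mulrDl. Qed.

Lemma dotDr d (x y z : 'cV[R]_d) : dot x (y + z) = dot x y + dot x z.
Proof. by rewrite /dot -big_split; apply: eq_bigr => i _; rewrite mxE mulrDr. Qed.

Lemma dotNl d (x y : 'cV[R]_d) : dot (- x) y = - dot x y.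
Proof. by rewrite /dot -sumrN; apply: eq_bigr => i _; rewrite mxE mulNr. Qed.

Lemma dotNr d (x y : 'cV[R]_d) : dot x (- y) = - dot x y.
Proof. by rewrite /dot -sumrN; apply: eq_bigr => i _; rewrite mxE mulrN. Qed.

Lemma tf_shiftE d (z : 'cV[R]_(d + d)) f t :
  tf_shift z f t = e (dot (dsubmx z) t) * f (t - usubmx z).
Proof. by rewrite /tf_shift mulmx_dot. Qed.

Context {d : nat}.
Implicit Types (z w : 'cV[R]_(d + d)) (f g : 'cV[R]_d -> R[i]).
Local Notation T := 'cV[R]_d.
Local Notation l2 := (l2 (lam d)).
Local Notation n2 := (n2 (lam d)).
Local Notation rn := (rn (lam d)).
Local Notation ip := (ip (lam d)).

Lemma dsubmxD z w : dsubmx (z + w) = dsubmx z + dsubmx w.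
Proof. by apply/matrixP => i j; rewrite !mxE. Qed.
Lemma usubmxD z w : usubmx (z + w) = usubmx z + usubmx w.
Proof. by apply/matrixP => i j; rewrite !mxE. Qed.
Lemma dsubmxN z : dsubmx (- z) = - dsubmx z.
Proof. by apply/matrixP => i j; rewrite !mxE. Qed.
Lemma usubmxN z : usubmx (- z) = - usubmx z.
Proof. by apply/matrixP => i j; rewrite !mxE. Qed.

(** The symplectic form, with the sign for which [pi(z) pi(w) = e(symp z w) pi(w) pi(z)]. *)
Definition symp z w : R := dot (dsubmx z) (usubmx w) - dot (dsubmx w) (usubmx z).

Lemma sympDl z z' w : symp (z + z') w = symp z w + symp z' w.
Proof. by rewrite /symp dsubmxD usubmxD dotDl dotDr; ring. Qed.

Lemma sympDr z w w' : symp z (w + w') = symp z w + symp z w'.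
Proof. by rewrite /symp dsubmxD usubmxD dotDl dotDr; ring. Qed.

Lemma sympNr z w : symp z (- w) = - symp z w.
Proof. by rewrite /symp dsubmxN usubmxN dotNl dotNr; ring. Qed.

Lemma tf_shiftM z w f t :
  tf_shift z (tf_shift w f) t = e (- dot (dsubmx w) (usubmx z)) * tf_shift (z + w) f t.
Proof.
rewrite !tf_shiftE dsubmxD usubmxD opprD addrA !mulrA -!expi2piD; congr (e _ * _).
by rewrite dotDl dotDr dotNr; ring.
Qed.

Lemma tf_shiftC z w f t :
  tf_shift z (tf_shift w f) t = e (symp z w) * tf_shift w (tf_shift z f) t.
Proof.
rewrite !tf_shiftM (addrC w z) mulrA -expi2piD; congr (e _ * _); rewrite /symp; ring.
Qed.

Lemma tf_shiftZ z c f : tf_shift z (fun t => c * f t) = (fun t => c * tf_shift z f t).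
Proof. by apply/funext => t; rewrite !tf_shiftE mulrCA. Qed.

Lemma tf_shiftB z f g : tf_shift z (fun t => f t - g t) = (fun t => tf_shift z f t -
    tf_shift z g t).
Proof. by apply/funext => t; rewrite !tf_shiftE mulrBr. Qed.

Lemma tf_shift_sum z (I : Type) (s : seq I) (F : I -> T -> R[i]) :
  tf_shift z (fun t => \sum_(i <- s) F i t) = (fun t => \sum_(i <- s) tf_shift z (F i) t).
Proof. by apply/funext => t; rewrite !tf_shiftE mulr_sumr; apply: eq_bigr => i _;
    rewrite tf_shiftE. Qed.

Lemma tf_shift0 f : tf_shift 0 f = f.
Proof.
apply/funext => t; rewrite tf_shiftE (_ : dsubmx 0 = 0); last by apply/matrixP => i j; rewrite !mxE.
rewrite (_ : usubmx 0 = 0); last by apply/matrixP => i j; rewrite !mxE.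
rewrite subr0 /dot big1 ?expi2pi0 ?mul1r// => i _; by rewrite mxE mul0r.
Qed.

(* the inverse, hence the adjoint, of [tf_shift z] *)
Definition tf_adj z f : T -> R[i] :=
  fun t => e (- dot (dsubmx z) (usubmx z)) * tf_shift (- z) f t.

Lemma tf_adjK z f : tf_shift z (tf_adj z f) = f.
Proof.
apply/funext => t; rewrite /tf_adj tf_shiftZ tf_shiftM subrr dsubmxN dotNl opprK.
by rewrite mulrA expi2piNK mul1r tf_shift0.
Qed.

Lemma tf_shiftK z f : tf_adj z (tf_shift z f) = f.
Proof.
apply/funext => t; rewrite /tf_adj tf_shiftM addNr usubmxN dotNr opprK.
by rewrite mulrA expi2piNK mul1r tf_shift0.
Qed.

Lemma measurable_usubmx d' (S : measurableType d') (h : S -> 'cV[R]_(d + d)) :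
  measurable_fun setT h -> measurable_fun setT (fun s => usubmx (h s)).
Proof.
move=> /measurable_fun_mxP mh; apply/measurable_fun_mxP => i j.
by apply: (measurable_eq (fun s => mxE _ _ i j)); exact: mh.
Qed.

Lemma measurable_dsubmx d' (S : measurableType d') (h : S -> 'cV[R]_(d + d)) :
  measurable_fun setT h -> measurable_fun setT (fun s => dsubmx (h s)).
Proof.
move=> /measurable_fun_mxP mh; apply/measurable_fun_mxP => i j.
by apply: (measurable_eq (fun s => mxE _ _ i j)); exact: mh.
Qed.

Lemma measurable_cVD d' (S : measurableType d') n (h k : S -> 'cV[R]_n) :
  measurable_fun setT h -> measurable_fun setT k -> measurable_fun setT (fun s => h s + k s).
Proof.
move=> /measurable_fun_mxP mh /measurable_fun_mxP mk; apply/measurable_fun_mxP => i j.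
by apply: (measurable_eq (fun s => mxE _ _ i j)); apply: measD; [exact: mh|exact: mk].
Qed.

Lemma measurable_cVN d' (S : measurableType d') n (h : S -> 'cV[R]_n) :
  measurable_fun setT h -> measurable_fun setT (fun s => - h s).
Proof.
move=> /measurable_fun_mxP mh; apply/measurable_fun_mxP => i j.
by apply: (measurable_eq (fun s => mxE _ _ i j)); apply: measN; exact: mh.
Qed.

Lemma cmeas_tf_shift d' (S : measurableType d') (h : S -> 'cV[R]_(d + d)) (k : S -> T) f :
  measurable_fun setT h -> measurable_fun setT k -> cmeas f ->
  cmeas (fun s => tf_shift (h s) f (k s)).
Proof.
move=> mh mk mf; rewrite (_ : (fun s => _) = (fun s => e (dot (dsubmx (h s)) (k s)) * f (k s -
    usubmx (h s)))).
  apply: cmeasM.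
    by apply: cmeas_expi2pi; apply: measurable_dot => //; exact: measurable_dsubmx.
  exact: (cmeas_comp mf (measurable_cVD mk (measurable_cVN (measurable_usubmx mh)))).
by apply/funext => s; rewrite tf_shiftE.
Qed.

Lemma n2_tf_shift z f : cmeas f -> n2 (tf_shift z f) = n2 f.
Proof.
move=> mf; rewrite /n2; under eq_integral do rewrite tf_shiftE nsqM nsq_expi2pi mul1r.
rewrite (ge0_integral_translation (- usubmx z) (f := fun t => (nsq (f t))%:E))//.
  by apply: measEFin; exact: cmeas_nsq.
by move=> t; rewrite lee_fin nsq_ge0.
Qed.

Lemma l2_tf_shift z f : l2 f -> l2 (tf_shift z f).
Proof.
by move=> [mf fy]; split; rewrite ?n2_tf_shift//; apply: cmeas_tf_shift => //; mfun.
Qed.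

Lemma rn_tf_shift z f : l2 f -> rn (tf_shift z f) = rn f.
Proof. by move=> [mf _]; rewrite /rn n2_tf_shift. Qed.

Lemma l2_tf_adj z f : l2 f -> l2 (tf_adj z f).
Proof. by move=> lf; apply: l2Z; exact: l2_tf_shift. Qed.

Lemma rn_tf_adj z f : l2 f -> rn (tf_adj z f) = rn f.
Proof.
by move=> lf; rewrite rnZ ?nsq_expi2pi ?mul1r ?rn_tf_shift//; exact: l2_tf_shift.
Qed.

Lemma ip_tf_shift z f g : l2 f -> l2 g -> ip (tf_shift z f) (tf_shift z g) = ip f g.
Proof.
move=> lf lg; have [m1 m2] := cmeasM lf.1 (cmeasJ lg.1).
have h (t : T) : tf_shift z f t * conjc (tf_shift z g t) =
    f (t - usubmx z) * conjc (g (t - usubmx z)).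
  by rewrite !tf_shiftE conjcM mulrACA mulJ nsq_expi2pi mul1r.
apply: complex_ext; rewrite /ip /=; under eq_Rintegral do rewrite h; congr fine.
  exact: (integral_translation (- usubmx z) (measEFin m1)).
exact: (integral_translation (- usubmx z) (measEFin m2)).
Qed.

Lemma ip_tf_adj z f g : l2 f -> l2 g -> ip (tf_adj z f) g = ip f (tf_shift z g).
Proof. by move=> lf lg; rewrite -(ip_tf_shift z) ?tf_adjK//; exact: l2_tf_adj. Qed.

Lemma ip_tf_shift_adj z f g : l2 f -> l2 g -> ip (tf_shift z f) g = ip f (tf_adj z g).
Proof. by move=> lf lg; rewrite -[in LHS](tf_adjK z g) ip_tf_shift//; exact: l2_tf_adj. Qed.

Lemma cmeas_ip_tf_shift d' (S : measurableType d') (h : S -> 'cV[R]_(d + d)) f g :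
  measurable_fun setT h -> l2 f -> l2 g -> cmeas (fun u => ip f (tf_shift (h u) g)).
Proof.
move=> mh lf lg.
have [m1 m2] : cmeas (fun u : S * T => f u.2 * conjc (tf_shift (h u.1) g u.2)).
  apply: cmeasM; first by apply: (cmeas_comp lf.1); mfun.
  apply: cmeasJ; apply: cmeas_tf_shift; [|by mfun|exact: lg.1].
  by apply: (measurableT_comp mh); mfun.
split; rewrite /ip /=.
  exact: (@measurable_Rint _ _ S T _ (lam d) (fun u => complex.Re (f u.2 * conjc (tf_shift (h
      u.1) g u.2)))).
exact: (@measurable_Rint _ _ S T _ (lam d) (fun u => complex.Im (f u.2 * conjc (tf_shift (h u.1)
    g u.2)))).
Qed.

End time_frequency.

Section moyal.
Context {R : realType} {d : nat}.
Local Notation lam := (@lebesgue_cV R).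
Local Notation T := 'cV[R]_d.
Local Notation l2 := (l2 (lam d)).
Local Notation n2 := (n2 (lam d)).
Local Notation ip := (ip (lam d)).
Variables (I : Type) (s : seq I) (w g : I -> T -> R[i]).
Hypotheses (lw : forall i, l2 (w i)) (lg : forall i, l2 (g i)).

Let F (x t : T) : R[i] := \sum_(i <- s) w i t * conjc (g i (t - x)).

Let cF d' (S : measurableType d') (h k : S -> T) :
  measurable_fun setT h -> measurable_fun setT k -> cmeas (fun u => F (h u) (k u)).
Proof.
move=> mh mk; apply: cmeas_sum => i; apply: cmeasM.
  exact: (cmeas_comp (lw i).1 mk).
exact: (cmeasJ (cmeas_comp (lg i).1 (measurable_cVD mk (measurable_cVN mh)))).
Qed.

Let lgt x i : l2 (fun t => g i (t - x)).
Proof.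
have mg := (lg i).1; have mt := @measurable_translation R d (- x).
split; first exact: (cmeas_comp mg mt).
rewrite /n2 (ge0_integral_translation (- x) (f := fun t => (nsq (g i t))%:E)) ?(lg i).2//.
  by apply: measEFin; exact: cmeas_nsq.
by move=> t; rewrite lee_fin nsq_ge0.
Qed.

Let tf_col x xi i : tf_shift (col_mx x xi) (g i) = fun t => expi2pi (dot xi t) * g i (t - x).
Proof. by apply/funext => t; rewrite tf_shiftE col_mxKd col_mxKu. Qed.

Let iF x : intg (lam d) (fun t => complex.Re (F x t)) /\ intg (lam d) (fun t => complex.Im (F x t)).
Proof.
split.
  under [X in intg _ X]funext do rewrite Re_sum.
  by apply: intg_sum => i; have [] := intg_mulJ (lw i) (lgt x i).
under [X in intg _ X]funext do rewrite Im_sum.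
by apply: intg_sum => i; have [] := intg_mulJ (lw i) (lgt x i).
Qed.

Let coef (z : 'cV[R]_(d + d)) : R[i] := \sum_(i <- s) ip (w i) (tf_shift z (g i)).

Let nsq_coef x xi : nsq (coef (col_mx x xi)) =
  fourier_re (fun t => complex.Re (F x t)) (fun t => complex.Im (F x t)) xi ^+ 2 +
  fourier_im (fun t => complex.Re (F x t)) (fun t => complex.Im (F x t)) xi ^+ 2.
Proof.
have lt i := l2_tf_shift (col_mx x xi) (lg i).
have h t : \sum_(i <- s) w i t * conjc (tf_shift (col_mx x xi) (g i) t) =
    F x t * expi2pi (- dot xi t).
  rewrite /F mulr_suml; apply: eq_bigr => i _.
  by rewrite tf_col conjcM expi2piJ mulrA mulrAC.
rewrite /nsq /coef; congr (_ ^+ 2 + _ ^+ 2).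
  rewrite Re_sum /ip /= -Rint_sum; last by move=> i; have [] := intg_mulJ (lw i) (lt i).
  apply: eq_Rintegral => t _; rewrite -Re_sum h ReM /= mulrN cosN sinN; ring.
rewrite Im_sum /ip /= -Rint_sum; last by move=> i; have [] := intg_mulJ (lw i) (lt i).
apply: eq_Rintegral => t _; rewrite -Im_sum h ImM /= mulrN cosN sinN; ring.
Qed.

Let mcoef d' (S : measurableType d') (h : S -> 'cV[R]_(d + d)) :
  measurable_fun setT h -> measurable_fun setT (fun u => (nsq (coef (h u)))%:E).
Proof.
by move=> mh; apply: measEFin; apply: cmeas_nsq; apply: cmeas_sum => i; exact: cmeas_ip_tf_shift.
Qed.

Let G (t u : T) : R[i] := \sum_(i <- s) w i t * conjc (g i u).

Let cG d' (S : measurableType d') (h k : S -> T) :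
  measurable_fun setT h -> measurable_fun setT k -> measurable_fun setT (fun u =>
      (nsq (G (h u) (k u)))%:E).
Proof.
move=> mh mk; apply: measEFin; apply: cmeas_nsq; apply: cmeas_sum => i; apply: cmeasM.
  exact: (cmeas_comp (lw i).1 mh).
exact: (cmeasJ (cmeas_comp (lg i).1 mk)).
Qed.

Let M : \bar R := (\int[lam d]_u \int[lam d]_t (nsq (G t u))%:E)%E.

(** Finiteness of [M] makes [F x] square-integrable for almost every [x], which Plancherel's theorem
    requires. *)
Let My : (M < +oo)%E.
Proof.
(* [C] is the number of terms, the constant in [|sum_i x_i|^2 <= C sum_i |x_i|^2]. *)
pose C : R := \sum_(i <- s) nsq (1 : R[i]).
pose K := \sum_(i <- s) (rn (lam d) (w i) * rn (lam d) (g i)).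
suff : (M <= (C * K)%:E)%E by move=> h; exact: (le_lt_trans h (ltry _)).
have C0 : 0 <= C by apply: sumr_ge0 => i _; exact: nsq_ge0.
have h t u : nsq (G t u) <= C * \sum_(i <- s) nsq (w i t) * nsq (g i u).
  have := cauchy_schwarz_sum s (fun i => w i t * conjc (g i u)) (fun i => 1).
  rewrite mulrC; under eq_bigr do rewrite mulr1.
  by under [X in _ * X]eq_bigr do rewrite nsqM nsqJ.
have mn i : measurable_fun setT (fun t => nsq (w i t)) by exact: cmeas_nsq (lw i).1.
have mn' i : measurable_fun setT (fun t => nsq (g i t)) by exact: cmeas_nsq (lg i).1.
have s0 t u : 0 <= \sum_(i <- s) nsq (w i t) * nsq (g i u).
  by apply: sumr_ge0 => i _; rewrite mulr_ge0 ?nsq_ge0.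
have inner u : (\int[lam d]_t (nsq (G t u))%:E <=
    (C * \sum_(i <- s) rn (lam d) (w i) * nsq (g i u))%:E)%E.
  apply: (@le_trans _ _ (\int[lam d]_t (C * \sum_(i <- s) nsq (w i t) * nsq (g i u))%:E)%E).
    apply: ge0_le_integralT.
    - by apply: cG; mfun.
    - by apply: measEFin; apply: measM => //; apply: meassum => i _; apply: measM.
    - by move=> t; rewrite lee_fin nsq_ge0.
    - by move=> t; rewrite lee_fin.
  have ii i : intg (lam d) (fun t => nsq (w i t) * nsq (g i u)).
    under [X in intg _ X]funext do rewrite mulrC.
    by apply: intgZ; exact: intg_nsq.
  rewrite -EFin_Rint; last by apply: intgZ; exact: intg_sum.
  rewrite lee_fin RintZ; last exact: intg_sum.
  rewrite ler_wpM2l// Rint_sum//; apply: ler_sum => i _.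
  under eq_Rintegral do rewrite mulrC.
  by rewrite RintZ; [rewrite mulrC|exact: intg_nsq].
apply: (@le_trans _ _ (\int[lam d]_u (C * \sum_(i <- s) rn (lam d) (w i) * nsq (g i u))%:E)%E).
  apply: ge0_le_integralT => //.
  - apply: (@measurable_fun_fubini_tonelli_G _ _ T T _ (lam d) (fun z =>
      (nsq (G z.1 z.2))%:E)) => //.
      by apply: cG; mfun.
    by move=> z; rewrite lee_fin nsq_ge0.
  - by apply: measEFin; apply: measM => //; apply: meassum => i _; apply: measM.
  - by move=> u; apply: integral_ge0 => t _; rewrite lee_fin nsq_ge0.
have ii i : intg (lam d) (fun u => rn (lam d) (w i) * nsq (g i u)).
  by apply: intgZ; exact: intg_nsq.
rewrite -EFin_Rint; last by apply: intgZ; exact: intg_sum.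
rewrite lee_fin RintZ; last exact: intg_sum.
rewrite ler_wpM2l// Rint_sum//; apply: ler_sum => i _.
by rewrite RintZ//; exact: intg_nsq.
Qed.

Let intF : (\int[lam d]_x \int[lam d]_t (nsq (F x t))%:E = M)%E.
Proof.
have FG x t : F x (t + x) = G (t + x) t by rewrite /F addrK.
transitivity (\int[lam d]_x \int[lam d]_t (nsq (G (t + x)%R t))%:E)%E.
  apply: eq_integral => x _; under [RHS]eq_integral do rewrite -FG.
  rewrite (ge0_integral_translation x (f := fun t => (nsq (F x t))%:E))//.
    by apply: measEFin; apply: cmeas_nsq; apply: cF; mfun.
  by move=> t; rewrite lee_fin nsq_ge0.
rewrite (@fubini_tonelli _ _ T T _ (lam d) (lam d) (fun z => (nsq (G (z.2 + z.1) z.2))%:E));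
    last 2 first.
- by apply: cG; [apply: measurable_cVD|]; mfun.
- by move=> z; rewrite lee_fin nsq_ge0.
apply: eq_integral => u _; rewrite /fubini_G /=; under eq_integral do rewrite addrC.
rewrite (ge0_integral_translation u (f := fun t => (nsq (G t u))%:E))//.
  by apply: cG; mfun.
by move=> t; rewrite lee_fin nsq_ge0.
Qed.

(* For fixed [x], the inner sum is the Fourier transform of [F x] in [xi]; the
   substitution [u = t - x] does the rest. *)
Theorem moyal : (\int[lam (d + d)]_z (nsq (\sum_(i <- s) ip (w i) (tf_shift z (g i))))%:E =
  \int[lam d]_u \int[lam d]_t (nsq (\sum_(i <- s) w i t * conjc (g i u)))%:E)%E.
Proof.
rewrite -/M -intF ge0_integral_col_mx; last 2 first.
- by apply: mcoef; mfun.
- by move=> z; rewrite lee_fin nsq_ge0.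
have mI : measurable_fun setT (fun x => \int[lam d]_t (nsq (F x t))%:E)%E.
  have m1 : measurable_fun setT (fun z : T * T => (nsq (F z.1 z.2))%:E).
    by apply: measEFin; apply: cmeas_nsq; apply: cF; mfun.
  have p1 (z : T * T) : (0 <= (nsq (F z.1 z.2))%:E)%E by rewrite lee_fin nsq_ge0.
  exact: (@measurable_fun_fubini_tonelli_F _ _ T T R (lam d) _ m1 p1).
apply: ge0_ae_eq_integral; [exact: measurableT| |exact: mI|..].
- have m1 : measurable_fun setT (fun z : T * T => (nsq (coef (col_mx z.1 z.2)))%:E).
    by apply: mcoef; apply: measurable_col_mx; mfun.
  have p1 (z : T * T) : (0 <= (nsq (coef (col_mx z.1 z.2)))%:E)%E by rewrite lee_fin nsq_ge0.
  exact: (@measurable_fun_fubini_tonelli_F _ _ T T R (lam d) _ m1 p1).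
- by move=> x _; apply: integral_ge0 => t _; rewrite lee_fin nsq_ge0.
- by move=> x _; apply: integral_ge0 => t _; rewrite lee_fin nsq_ge0.
have : {ae lam d, forall x, (\int[lam d]_t (nsq (F x t))%:E < +oo)%E}.
  apply: (@ge0_ae_lty _ T R (lam d) (fun x => \int[lam d]_t (nsq (F x t))%:E)%E mI).
    by move=> x; apply: integral_ge0 => t _; rewrite lee_fin nsq_ge0.
  by rewrite intF.
apply: filterS => x Fy _ /=.
have cFx : cmeas (F x) by apply: cF; mfun.
have [m1 m2] := cFx; have [i1 i2] := iF x.
have e1 := n2_sqint (lam d) cFx.
have [p2 q2] : (sqint (lam d) (fun t => complex.Re (F x t)) < +oo)%E /\
    (sqint (lam d) (fun t => complex.Im (F x t)) < +oo)%E.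
  have Fy' := Fy; rewrite [X in (X < _)%E]e1 in Fy'.
  by split; apply: le_lt_trans Fy'; [apply: leeDl|apply: leeDr]; exact: sqint_ge0.
rewrite [RHS]e1 -(plancherel m1 m2 i1 i2 p2 q2).
by apply: eq_integral => xi _; rewrite -nsq_coef.
Qed.

End moyal.

Section moyal_rank_one.
Context {R : realType} {d : nat}.
Local Notation lam := (@lebesgue_cV R).

Lemma moyal1 (w g : 'cV[R]_d -> R[i]) : l2 (lam d) w -> l2 (lam d) g ->
  (\int[lam (d + d)]_z (nsq (ip (lam d) w (tf_shift z g)))%:E = n2 (lam d) w * n2 (lam d) g)%E.
Proof.
move=> lw lg; have := @moyal R d unit [:: tt] (fun=> w) (fun=> g) (fun=> lw) (fun=> lg).
under eq_integral do rewrite big_seq1.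
move=> ->; rewrite -(EFin_rn lw) /n2 -ge0_integralZT; last 3 first.
- by apply: measEFin; exact: cmeas_nsq lg.1.
- by move=> t; rewrite lee_fin nsq_ge0.
- exact: rn_ge0.
apply: eq_integral => u _; rewrite (EFin_rn lw) /n2 muleC -ge0_integralZT; last 3 first.
- by apply: measEFin; exact: cmeas_nsq lw.1.
- by move=> t; rewrite lee_fin nsq_ge0.
- exact: nsq_ge0.
by apply: eq_integral => t _; rewrite big_seq1 nsqM nsqJ mulrC.
Qed.

End moyal_rank_one.

(** * Unordered sums over a countable index *)

Section countable_esum.
Context {R : realType} (K : countType).

(** Turns a family over [K] into a sequence through its pickling codes, with 0 at the numbers that
    code nothing, so that results on series apply. *)
Definition enumerate (F : K -> \bar R) (n : nat) : \bar R :=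
  if pickle_inv n is Some k then F k else 0%E.

Lemma enumerate_ge0 F n : (forall k, 0 <= F k)%E -> (0 <= enumerate F n)%E.
Proof. by move=> F0; rewrite /enumerate; case: pickle_inv. Qed.

Lemma esum_enumerate F : (forall k, 0 <= F k)%E ->
  (\esum_(k in [set: K]) F k = \sum_(0 <= n <oo) enumerate F n)%E.
Proof.
move=> F0; rewrite nneseries_esumT; last by move=> n; exact: enumerate_ge0.
transitivity (\esum_(n in @classical_sets.image K nat [set: K]%classic (@choice.pickle K))
    enumerate F n)%E.
  rewrite esum_image; last by move=> x y _ _; exact: (pcan_inj (@choice.pickleK K)).
  by apply: eq_esum => k _; rewrite /enumerate pickleK_inv.
rewrite esum_mkcond; apply: eq_esum => n _; case: ifPn => //.
rewrite notin_setE /enumerate => h; case E: (pickle_inv n) => [k|]//.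
by exfalso; apply: h; exists k => //; have := @pickle_invK K n; rewrite E.
Qed.

Context d (T : measurableType d) (mu : {measure set T -> \bar R}).

Lemma measurable_esum (F : K -> T -> \bar R) : (forall k, measurable_fun setT (F k)) ->
  (forall k x, 0 <= F k x)%E -> measurable_fun setT (fun x => \esum_(k in [set: K]) F k x)%E.
Proof.
move=> mF F0; apply: (measurable_eq (fun x => esum_enumerate (F0 ^~ x))).
apply: (@ge0_emeasurable_sum _ _ _ setT (fun n x => enumerate (F ^~ x) n) xpredT).
  by move=> n x _ _; exact: enumerate_ge0.
by move=> n _; rewrite /enumerate; case: pickle_inv => [k|]; [exact: mF|exact: measurable_cst].
Qed.

Lemma integral_esum (F : K -> T -> \bar R) : (forall k, measurable_fun setT (F k)) ->
  (forall k x, 0 <= F k x)%E ->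
  (\int[mu]_x (\esum_(k in [set: K]) F k x) = \esum_(k in [set: K]) \int[mu]_x F k x)%E.
Proof.
move=> mF F0; rewrite esum_enumerate; last by move=> k; exact: integral_ge0.
under eq_integral do rewrite esum_enumerate//.
rewrite integral_nneseries//.
- apply: eq_eseriesr => n _; rewrite /enumerate; case: pickle_inv => [k|]//.
  by rewrite integral0.
- by move=> n; rewrite /enumerate; case: pickle_inv => [k|]; [exact: mF|exact: measurable_cst].
- by move=> n x _; exact: enumerate_ge0.
Qed.

End countable_esum.

Lemma esumZl {R : realType} (K : countType) (c : R) (F : K -> \bar R) :
  0 <= c -> (forall k, 0 <= F k)%E ->
  (\esum_(k in [set: K]) (c%:E * F k) = c%:E * \esum_(k in [set: K]) F k)%E.
Proof.
move=> c0 F0; rewrite !esum_enumerate//; last by move=> k; rewrite mule_ge0// lee_fin.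
rewrite -nneseriesZl; last by move=> n _; exact: enumerate_ge0.
apply: eq_eseriesr => n _; rewrite /enumerate; case: pickle_inv => [k|]//.
by rewrite mule0.
Qed.

(** * Cells of a lattice and characters of the adjoint lattice *)

Section lattice_cells.
Context {R : realType} {n : nat} (A : 'M[R]_n).
Hypothesis uA : A \in unitmx.
Local Notation T := 'cV[R]_n.
Local Notation lam := (@lebesgue_cV R n).

Definition lpoint (k : 'cV[int]_n) : T := A *m map_mx intr k.

Lemma lpointN k : lpoint (- k) = - lpoint k.
Proof. by rewrite /lpoint map_mxN mulmxN. Qed.

Definition lcoords (z : T) : T := invmx A *m z.

Lemma coordsK : cancel lcoords (mulmx A). Proof. by move=> z; rewrite /lcoords mulKVmx. Qed.

Lemma coords_lpoint k : lcoords (lpoint k) = map_mx intr k.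
Proof. by rewrite /lcoords /lpoint mulKmx. Qed.

Lemma coordsD z w : lcoords (z + w) = lcoords z + lcoords w.
Proof. by rewrite /lcoords mulmxDr. Qed.

Lemma coords_sub z k i : lcoords (z - lpoint k) i ord0 = lcoords z i ord0 - (k i ord0)%:~R.
Proof. by rewrite coordsD -lpointN coords_lpoint !mxE mulrNz. Qed.

Lemma lpoint_inj : injective lpoint.
Proof.
move=> k l /(congr1 lcoords); rewrite !coords_lpoint => /matrixP h.
by apply/matrixP => i j; have := h i j; rewrite !mxE => /intr_inj.
Qed.

Lemma esum_lattice (F : T -> \bar R) :
  (\esum_(z in lattice A) F z = \esum_(k in [set: 'cV[int]_n]) F (lpoint k))%E.
Proof. by rewrite /lattice -/lpoint esum_image// => k l _ _; exact: lpoint_inj. Qed.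

(** Half-open, so that the translates tile the space without overlap; centred, so that the origin,
    where the kernels concentrate, is interior. *)
Definition in_cell (z : T) : bool :=
  [forall i, (- 2^-1 <= lcoords z i ord0) && (lcoords z i ord0 < 2^-1)].

Definition cellind (z : T) : R := (in_cell z)%:R.

Lemma cell_ge0 z : 0 <= cellind z. Proof. exact: ler0n. Qed.

Lemma measurable_coords i : measurable_fun setT (fun z => lcoords z i ord0).
Proof.
apply: (measurable_eq (fun z => mxE _ _ i ord0)).
by apply: meassum => j _; apply: measM; [exact: measurable_cst|exact: measurable_entry].
Qed.

Lemma cellE z : cellind z = \1_[set z | in_cell z] z.
Proof. by rewrite indicE /cellind mem_setE. Qed.

Lemma measurable_cell : measurable_fun setT cellind.
Proof.
rewrite (_ : cellind = \1_[set z | in_cell z]); last by apply/funext => z; exact: cellE.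
apply: measurable_indic.
rewrite (_ : [set z | in_cell z] = \bigcap_(i in [set: 'I_n])
    ((fun z => lcoords z i ord0) @^-1` `[- 2^-1, 2^-1[%classic)).
  apply: fin_bigcap_measurable => // i _; rewrite -[X in measurable X]setTI.
  by apply: measurable_coords => //; exact: measurable_itv.
apply/seteqP; split => [z /forallP h i _ /=|z h]; first by rewrite in_itv /= h.
by apply/forallP => i; have := h i I; rewrite /= in_itv.
Qed.

(** Exactly one translate contains [z], the one obtained by rounding each lattice coordinate to the
    nearest integer: [k0] is the floor of the coordinate plus one half. *)
Lemma esum_cell z : (\esum_(k in [set: 'cV[int]_n]) (cellind (z - lpoint k)%R)%:E = 1)%E.
Proof.
pose k0 : 'cV[int]_n := \col_i Num.floor (lcoords z i ord0 + 2^-1).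
transitivity (\esum_(k in [set k0]) (1 : \bar R))%E; last by rewrite esum_set1.
rewrite [RHS]esum_mkcond; apply: eq_esum => k _.
have -> : (k \in [set k0]) = (k == k0) by apply/idP/eqP; rewrite inE.
have h : in_cell (z - lpoint k) = (k == k0).
  apply/forallP/eqP => [h|-> i]; last first.
    have := floor_itv (lcoords z i ord0 + 2^-1); rewrite intrD => /andP[h1 h2].
    rewrite coords_sub [k0 _ _]mxE; move: h1 h2; set x := lcoords _ _ _; set y := _%:~R;
        move: x y => x y h1 h2.
    by apply/andP; split; lra.
  apply/matrixP => i j; rewrite ord1 [RHS]mxE; apply/esym/floor_def.
  have := h i; rewrite coords_sub intrD; set x := lcoords _ _ _; set y := _%:~R.
  move: x y => x y /andP[h1 h2].
  by apply/andP; split; lra.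
by rewrite /cellind h; case: ifP.
Qed.

Let mc (t : T) : measurable_fun setT (fun z : T => (cellind (z + t)%R)%:E).
Proof. by apply: measEFin; apply: (measurableT_comp measurable_cell);
    exact: measurable_translation. Qed.

(** The integrand is multiplied by the partition of unity of [esum_cell], and each piece is
    translated back to the cell. *)
Lemma unfolding (H : T -> R) : measurable_fun setT H -> (forall z, 0 <= H z) ->
  (\int[lam]_z (H z)%:E = \int[lam]_z ((cellind z)%:E * \esum_(l in lattice A) (H (z + l)%R)%:E))%E.
Proof.
move=> mH H0.
have mHt k : measurable_fun setT (fun z : T => (H (z + lpoint k)%R)%:E).
  by apply: measEFin; apply: (measurableT_comp mH); exact: measurable_translation.
transitivity (\int[lam]_z \esum_(k in [set: 'cV[int]_n]) ((H z)%:E * (cellind (z -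
    lpoint k)%R)%:E))%E.
  by apply: eq_integral => z _; rewrite esumZl ?esum_cell ?mule1// => k; rewrite lee_fin cell_ge0.
rewrite integral_esum; last 2 first.
- by move=> k; apply: emeasurable_funM; [exact: measEFin|exact: mc].
- by move=> k z; rewrite mule_ge0// lee_fin ?cell_ge0.
transitivity (\esum_(k in [set: 'cV[int]_n]) \int[lam]_z ((cellind z)%:E * (H (z +
    lpoint k)%R)%:E))%E.
  apply: eq_esum => k _.
  rewrite -(ge0_integral_translation (lpoint k) (f := fun z => (H z)%:E * (cellind (z -
      lpoint k)%R)%:E)%E).
  - by apply: eq_integral => z _; rewrite addrK muleC.
  - by apply: emeasurable_funM; [exact: measEFin|exact: mc].
  - by move=> z; rewrite mule_ge0// lee_fin ?cell_ge0.
rewrite -integral_esum.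
- apply: eq_integral => z _; rewrite esum_lattice esumZl// ?cell_ge0// => k.
  by rewrite lee_fin.
- by move=> k; apply: emeasurable_funM => //; apply: measEFin; exact: measurable_cell.
- by move=> k z; rewrite mule_ge0// lee_fin ?cell_ge0.
Qed.

(** The translated cell is another fundamental domain: unfolding its integral onto the original cell
    leaves [h z] times a sum of cell indicators equal to 1. *)
Lemma integral_cell_translation (h : T -> R) (t : T) :
  measurable_fun setT h -> (forall z, 0 <= h z) ->
  (forall z l, lattice A l -> h (z + l) = h z) ->
  (\int[lam]_z (cellind z * h (z + t)%R)%:E = \int[lam]_z (cellind z * h z)%:E)%E.
Proof.
move=> mh h0 ph.
rewrite -(ge0_integral_translation (- t) (f := fun z => (cellind z * h (z + t)%R)%:E));
    last 2 first.
- by apply: measEFin; apply: measM; [exact: measurable_cell|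
    apply: (measurableT_comp mh); exact: measurable_translation].
- by move=> z; rewrite lee_fin mulr_ge0// cell_ge0.
rewrite (unfolding (H := fun z => cellind (z - t) * h (z - t + t))); last 2 first.
- apply: measM; first by apply: (measurableT_comp measurable_cell); exact: measurable_translation.
  by under eq_fun do rewrite subrK.
- by move=> z; rewrite mulr_ge0// cell_ge0.
apply: eq_integral => z _; rewrite EFinM; congr (_ * _)%E.
have ph' l : lattice A l -> h (z + l - t + t) = h z by move=> Al; rewrite subrK ph.
transitivity (\esum_(l in lattice A) ((h z)%:E * (cellind (z - t + l)%R)%:E))%E.
  by apply: eq_esum => l Al; rewrite ph'// EFinM muleC addrAC.
rewrite (@reindex_esum R T T (lattice A) (lattice A) -%R).
  rewrite esum_lattice esumZl//; last by move=> k; rewrite lee_fin cell_ge0.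
  by rewrite esum_cell mule1.
split; first by move=> _ [k _ <-]; exists (- k) => //; exact: lpointN.
  by move=> x y _ _ /oppr_inj.
by move=> _ [k _ <-]; exists (lpoint (- k)); [exists (- k)|rewrite /= lpointN opprK].
Qed.

(** If the cell were null, unfolding the constant 1 would make the whole space null, although it
    contains a cube of measure 1. *)
Lemma cell_mass_gt0 : (0 < \int[lam]_z (cellind z)%:E)%E.
Proof.
rewrite lt_neqAle integral_ge0 ?andbT; last by move=> z _; rewrite lee_fin cell_ge0.
apply/negP => /eqP/esym h.
have : (\int[lam]_z (1 : R)%:E = 0)%E.
  rewrite (unfolding (H := fun=> 1))//.
  have : {ae lam, forall z, [set: T] z -> (cellind z)%:E = 0%E}.
    apply/(@ae_eq_integral_abs _ _ _ lam setT measurableT (fun z => (cellind z)%:E)).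
      by apply: measEFin; exact: measurable_cell.
    by rewrite -[RHS]h; apply: eq_integral => z _; rewrite gee0_abs// lee_fin cell_ge0.
  move=> cell0.
  have mF : measurable_fun setT (fun z => (cellind z)%:E * \esum_(l in lattice A) (1 : R)%:E)%E.
    rewrite esum_lattice; apply: emeasurable_funM; last exact: measurable_cst.
    by apply: measEFin; exact: measurable_cell.
  rewrite (ge0_ae_eq_integral (g := cst 0%E) measurableT mF)//; first exact: integral0.
    by move=> z _; rewrite mule_ge0// ?lee_fin ?cell_ge0//; apply: esum_ge0 => l _; rewrite lee_fin.
  by apply: filterS cell0 => z h0 _; rewrite (h0 I) mul0e.
pose B := [set z : T | forall i, `[0, 1]%classic (z i ord0)].
have mB : measurable B.
  rewrite (_ : B = \bigcap_(i in [set: 'I_n]) ((fun z : T => z i ord0) @^-1` `[0, 1]%classic)).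
    apply: fin_bigcap_measurable => // i _; rewrite -[X in measurable X]setTI.
    by apply: measurable_entry => //; exact: measurable_itv.
  by apply/seteqP; split => [z h' i _|z h' i]; exact: h'.
rewrite integral_cst// mul1e => h1.
have : (lam B <= lam setT)%E by apply: le_measure; rewrite ?inE//; exact: measurableT.
have -> : lam B = (\prod_(i < n) lebesgue_measure `[0%R, 1%R]%classic)%E.
  by apply: (@lebesgue_cV_box R n (fun=> `[0, 1]%classic)) => i; exact: measurable_itv.
rewrite h1.
rewrite big1; first by rewrite lee_fin ler10.
by move=> i _; rewrite lebesgue_measure_itv /= lte_fin ltr01 oppr0 adde0.
Qed.

(** Lattice coordinates in the cell have modulus at most [1 / 2], so the cell lies in the cube of
    half-width [C], the sum of the moduli of the entries of [A]. *)
Lemma cell_mass_lty : (\int[lam]_z (cellind z)%:E < +oo)%E.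
Proof.
pose C : R := \sum_i \sum_j `|A i j|.
have C0 : 0 <= C by apply: sumr_ge0 => i _; apply: sumr_ge0.
pose B := [set z : T | forall i, `[- C, C]%classic (z i ord0)].
have mB : measurable B.
  rewrite (_ : B = \bigcap_(i in [set: 'I_n]) ((fun z : T => z i ord0) @^-1` `[- C, C]%classic)).
    apply: fin_bigcap_measurable => // i _; rewrite -[X in measurable X]setTI.
    by apply: measurable_entry => //; exact: measurable_itv.
  by apply/seteqP; split => [z h i _|z h i]; exact: h.
have cB z : cellind z <= \1_B z.
  rewrite /cellind indicE; case: (boolP (in_cell z)) => [/forallP h|_]; last exact: ler0n.
  rewrite mem_set// => i /=; rewrite in_itv/= -ler_norml -[z](coordsK z) mxE.
  apply: (le_trans (ler_norm_sum _ _ _)).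
  apply: (@le_trans _ _ (\sum_j `|A i j|)).
    apply: ler_sum => j _; rewrite normrM ler_piMr// ler_norml.
    have /andP[h1 h2] := h j; apply/andP; split; lra.
  rewrite /C [leRHS](bigD1 i)//= lerDl; apply: sumr_ge0 => k _; exact: sumr_ge0.
apply: (@le_lt_trans _ _ (\int[lam]_z (\1_B z)%:E)%E).
  apply: ge0_le_integralT.
  - by apply: measEFin; exact: measurable_cell.
  - by apply: measEFin; exact: measurable_indic.
  - by move=> z; rewrite lee_fin cell_ge0.
  - by move=> z; rewrite lee_fin.
rewrite integral_indic// setIT.
have lB : lam B = (\prod_(i < n) lebesgue_measure `[(- C)%R, C]%classic)%E.
  by apply: (@lebesgue_cV_box R n (fun=> `[- C, C]%classic)) => i; exact: measurable_itv.
apply: (@eq_ind_r _ _ (fun x : \bar R => (x < +oo)%E) _ _ lB).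
suff : ((\prod_(i < n) lebesgue_measure `[(- C)%R, C]%classic)%E \is a fin_num).
  by rewrite ge0_fin_numE//; apply: prode_ge0 => i _; exact: measure_ge0.
apply: (big_ind (fun x : \bar R => x \is a fin_num)) => //= [x y x0 y0|i _]; first exact: fin_numM.
by rewrite ge0_fin_numE ?lebesgue_itv_lty.
Qed.

Definition cell_mass : R := fine (\int[lam]_z (cellind z)%:E).

Lemma EFin_cell_mass : (cell_mass%:E = \int[lam]_z (cellind z)%:E)%E.
Proof.
rewrite fineK// ge0_fin_numE ?cell_mass_lty//.
by apply: integral_ge0 => z _; rewrite lee_fin cell_ge0.
Qed.

Lemma cell_mass_pos : 0 < cell_mass.
Proof. by rewrite -lte_fin EFin_cell_mass cell_mass_gt0. Qed.

Lemma intg_cell : intg lam cellind.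
Proof. by apply: ge0_intg; [exact: measurable_cell|exact: cell_ge0|exact: cell_mass_lty]. Qed.

End lattice_cells.

Section dual_lattice.
Context {R : realType} {d : nat} (A : 'M[R]_(d + d)).
Hypothesis uA : A \in unitmx.
Local Notation N := (d + d)%N.
Local Notation T := 'cV[R]_(d + d).
Local Notation lam := (@lebesgue_cV R (d + d)).
Local Notation e := (@expi2pi R).

Definition apoint (k : 'cV[int]_(d + d)) : T := sympl_mx *m invmx A^T *m map_mx intr k.

Lemma apointD k l : apoint (k + l) = apoint k + apoint l.
Proof. by rewrite /apoint map_mxD mulmxDr. Qed.

Lemma apointN k : apoint (- k) = - apoint k.
Proof. by rewrite /apoint map_mxN mulmxN. Qed.

(** [sympl_mx] turns the symplectic form into a dot product and [invmx A^T] moves onto [z]: points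
    of the adjoint lattice are exactly the integer frequencies in lattice coordinates. *)
Lemma symp_apoint (z : T) k : symp z (apoint k) = dot (lcoords A z) (map_mx intr k).
Proof.
rewrite /symp /apoint -mulmxA; set u := invmx A^T *m _.
have -> : sympl_mx *m u = col_mx (dsubmx u) (- usubmx u).
  rewrite /sympl_mx -[u in LHS]vsubmxK mul_block_col !mul0mx mul1mx add0r addr0.
  by rewrite mulNmx mul1mx.
rewrite col_mxKu col_mxKd dotNl opprK addrC.
have -> : dot (usubmx u) (usubmx z) + dot (dsubmx z) (dsubmx u) = dot z u.
  rewrite /dot big_split_ord /=; congr (_ + _); apply: eq_bigr => i _; rewrite !mxE//.
  by rewrite mulrC.
by rewrite -!mulmx_dot /u mulmxA -trmx_inv -trmx_mul.
Qed.

Lemma symp_lattice (z : T) k : lattice A z -> exists m : int, symp z (apoint k) = m%:~R.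
Proof.
move=> [l _ <-]; rewrite symp_apoint -/(lpoint A l) coords_lpoint//.
exists (\sum_i l i ord0 * k i ord0); rewrite /dot rmorph_sum/=; apply: eq_bigr => i _.
by rewrite !mxE rmorphM.
Qed.

Lemma expi2pi_symp_lattice (z w : T) k : lattice A w ->
  e (symp (z + w) (apoint k)) = e (symp z (apoint k)).
Proof.
by move=> /(symp_lattice k)[m hm]; rewrite sympDl hm expi2piD expi2pi_int mulr1.
Qed.

(** Move by [1 / (2 k_i)] along a lattice coordinate with [k_i != 0]. Such a half period kills the
    mean of a nontrivial character and also separates the points [apoint k]. *)
Lemma half_period k : k != 0 -> exists t : T, symp t (apoint k) = 2^-1.
Proof.
move=> k0; have [i ki] : exists i, k i ord0 != 0.
  apply/not_existsP => h; move/eqP: k0; apply; apply/matrixP => i j.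
  by rewrite ord1 [RHS]mxE; apply/eqP/negPn/negP; exact: h.
have kR : (k i ord0)%:~R != 0 :> R by rewrite intr_eq0.
exists (A *m ((2 * (k i ord0)%:~R)^-1 *: delta_mx i ord0)).
rewrite symp_apoint /lcoords mulKmx// /dot (bigD1 i)//= big1 => [|j ji].
  by rewrite !mxE !eqxx/= mulr1 addr0; field.
by rewrite !mxE (negbTE ji) /= mulr0 mul0r.
Qed.

(** For distinct [k] and [l] with the same image, a half period [t] of [k - l] would satisfy
    [symp t 0 = 1 / 2], whereas additivity forces [symp t 0 = 0]. *)
Lemma apoint_inj : injective apoint.
Proof.
move=> k l kl; apply/eqP; rewrite -subr_eq0; apply/negPn/negP => /half_period[t].
rewrite apointD apointN kl subrr; have := sympDr t 0 0; rewrite addr0 => E h.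
by move: E; rewrite h; lra.
Qed.

Local Notation c := (cellind A).

Lemma measurable_symp w : measurable_fun setT (fun z : T => symp z w).
Proof.
rewrite /symp; apply: measB; apply: measurable_dot; rewrite -/setT.
- by apply: measurable_dsubmx; mfun.
- by mfun.
- by mfun.
- by apply: measurable_usubmx; mfun.
Qed.

Lemma intg_cellM (f : T -> R) (C : R) : measurable_fun setT f -> (forall z, `|f z| <= C) ->
  intg lam (fun z => c z * f z).
Proof.
move=> mf fC; apply: (@le_intg _ _ _ _ _ (fun z => C * c z)).
- by apply: measM => //; exact: measurable_cell.
- move=> z; rewrite normrM ger0_norm ?cell_ge0// mulrC ler_wpM2r ?cell_ge0//.
- by apply: intgZ; exact: intg_cell.
Qed.

Let mcos th w : measurable_fun setT (fun z : T => cos (2 * pi * symp z w + th)).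
Proof. by have := measurable_symp w => h; mfun. Qed.

Let cos_norm (x : R) : `|cos x| <= 1. Proof. by rewrite ler_norml cos_geN1 cos_le1. Qed.

Let icos th w : intg lam (fun z => c z * cos (2 * pi * symp z w + th)).
Proof. by apply: (@intg_cellM _ 1) => //; exact: mcos. Qed.

(* Translating by half a period of the character flips the sign of the cosine
   and leaves the integral over a cell unchanged. *)
Let Rint_cell_cos (th : R) k : k != 0 ->
  \int[lam]_z (c z * cos (2 * pi * symp z (apoint k) + th)) = 0.
Proof.
move=> /half_period[t ht].
(* The added 1 makes [h] nonnegative, as [integral_cell_translation] demands; its contributions
   cancel at the end. *)
pose h z := 1 + cos (2 * pi * symp z (apoint k) + th).
have mh : measurable_fun setT h by rewrite /h; apply: measD => //; exact: mcos.
have h0 z : 0 <= h z by rewrite /h -lerBlDl sub0r cos_geN1.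
have period z l : lattice A l -> h (z + l) = h z.
  move=> Al; have := expi2pi_symp_lattice z k Al => E.
  have /= e1 := congr1 (@complex.Re R) E; have /= e2 := congr1 (@complex.Im R) E.
  by rewrite /h cosD [in RHS]cosD e1 e2.
have := integral_cell_translation uA t mh h0 period.
have ht2 z : h (z + t) = 1 - cos (2 * pi * symp z (apoint k) + th).
  rewrite /h sympDl ht mulrDr (_ : 2 * pi / 2 = pi); last by field.
  by rewrite addrAC cosDpi.
under eq_integral do rewrite ht2.
have ic := intg_cell uA; have ik := icos th (apoint k).
rewrite -EFin_Rint; last first.
  by under [X in intg _ X]funext do rewrite mulrBr mulr1; exact: intgB.
rewrite -EFin_Rint; last first.
  by under [X in intg _ X]funext do rewrite mulrDr mulr1; exact: intgD.
under [in LHS]eq_Rintegral do rewrite mulrBr mulr1.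
under [in RHS]eq_Rintegral do rewrite mulrDr mulr1.
by rewrite RintB// RintD// => -[]; lra.
Qed.

(** A trigonometric polynomial, periodic under [lattice A]. The minus sign is the one produced by
    exchanging [pi(z)] and [pi(mu)] in the second, conjugate-linear, argument of [ip]. *)
Definition trig (s : seq 'cV[int]_(d + d)) (b : 'cV[int]_(d + d) -> R[i]) (z : T) : R[i] :=
  \sum_(k <- s) b k * e (- symp z (apoint k)).

Lemma cmeas_trig s b : cmeas (trig s b).
Proof.
apply: cmeas_sum => k; apply: cmeasM; first exact: cmeas_cst.
by apply: cmeas_expi2pi; apply: measN; exact: measurable_symp.
Qed.

Lemma trig_period s b z l : lattice A l -> trig s b (z + l) = trig s b z.
Proof.
move=> Al; apply: eq_bigr => k _; congr (_ * _).
by rewrite -expi2piJ expi2pi_symp_lattice// expi2piJ.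
Qed.

(** The characters indexed by distinct [k] are orthogonal on the cell, since their quotients are
    nontrivial characters and have mean 0. The double sum is real, so only the real parts [X k l]
    are integrated. *)
Lemma parseval s b : uniq s ->
  (\int[lam]_z (c z * nsq (trig s b z))%:E = (cell_mass A * \sum_(k <- s) nsq (b k))%:E)%E.
Proof.
move=> us.
pose X k l z := c z * complex.Re (b k * e (- symp z (apoint k))
    * conjc (b l * e (- symp z (apoint l)))).
(* The sine is written as a cosine of phase [- pi / 2], so that [Rint_cell_cos] covers both
   terms. *)
have XE k l z : X k l z = complex.Re (b k * conjc (b l)) * (c z * cos (2 * pi * symp z (apoint (l
    - k)) + 0)) -
    complex.Im (b k * conjc (b l)) * (c z * cos (2 * pi * symp z (apoint (l - k)) + - (pi / 2))).
  rewrite /X conjcM expi2piJ opprK mulrACA -expi2piD apointD apointN sympDr sympNr [_ +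
      symp _ _]addrC ReM /=.
  by rewrite addr0 [cos (_ - pi / 2)]cosB cos_pihalf sin_pihalf mulr0 add0r mulr1; ring.
have iX k l : intg lam (X k l).
  by under [X in intg _ X]funext do rewrite XE; apply: intgB; exact: intgZ.
have X0 k l : k != l -> \int[lam]_z X k l z = 0.
  move=> kl; under eq_Rintegral do rewrite XE.
  rewrite RintB; [|exact: intgZ..]; rewrite !RintZ// !Rint_cell_cos ?mulr0 ?subrr//.
    by rewrite subr_eq0 eq_sym.
  by rewrite subr_eq0 eq_sym.
have X1 k : \int[lam]_z X k k z = cell_mass A * nsq (b k).
  transitivity (\int[lam]_z (nsq (b k) * c z)).
    by apply: eq_Rintegral => z _; rewrite /X mulJ /= nsqM nsq_expi2pi mulr1 mulrC.
  by rewrite RintZ 1?mulrC//; exact: intg_cell.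
have E z : c z * nsq (trig s b z) = \sum_(k <- s) \sum_(l <- s) X k l z.
  have -> : nsq (trig s b z) = complex.Re (trig s b z * conjc (trig s b z)) by rewrite mulJ.
  rewrite /trig mulr_suml Re_sum mulr_sumr; apply: eq_bigr => k _.
  rewrite (big_morph _ (@conjcD R) (@conjc0 R)) mulr_sumr Re_sum mulr_sumr.
  by apply: eq_bigr => l _.
under eq_integral do rewrite E.
rewrite -EFin_Rint; last by apply: intg_sum => k; exact: intg_sum.
congr EFin; rewrite Rint_sum; last by move=> k; exact: intg_sum.
rewrite mulr_sumr; apply: eq_big_seq => k ks; rewrite Rint_sum// -X1.
rewrite (bigD1_seq k)//= big1 ?addr0// => l lk; apply: X0; by rewrite eq_sym.
Qed.

End dual_lattice.

(** * Trigonometric polynomials concentrating at the origin *)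

Section concentration.
Context {R : realType} {d : nat} (A : 'M[R]_(d + d)).
Hypothesis uA : A \in unitmx.
Local Notation N := (d + d)%N.
Local Notation T := 'cV[R]_(d + d).
Local Notation lam := (@lebesgue_cV R (d + d)).
Local Notation e := (@expi2pi R).
Local Notation trig := (trig A).
Local Notation apoint := (apoint A).
Local Notation coords := (lcoords A).

Definition trig_poly (a : T -> R[i]) : Prop := exists s b, uniq s /\ a =1 trig s b.

(** Repeated frequencies are merged by adding their coefficients, which restores the uniqueness that
    [parseval] requires. *)
Lemma trig_poly_pairs (l : seq ('cV[int]_(d + d) * R[i])) :
  trig_poly (fun z => \sum_(p <- l) p.2 * e (- symp z (apoint p.1))).
Proof.
exists (undup [seq p.1 | p <- l]), (fun k => \sum_(p <- l | p.1 == k) p.2).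
split; first exact: undup_uniq.
move=> z; rewrite /trig; under [RHS]eq_bigr do rewrite mulr_suml.
rewrite (exchange_big_dep predT)//=; apply: eq_big_seq => p pl.
rewrite -big_filter (eq_filter (a2 := pred1 p.1)); last by move=> k /=; rewrite eq_sym.
rewrite filter_pred1_uniq ?undup_uniq//; first by rewrite big_seq1.
by rewrite mem_undup map_f.
Qed.

Lemma trig_polyM a b : trig_poly a -> trig_poly b -> trig_poly (fun z => a z * b z).
Proof.
move=> [s [f [_ af]]] [t [g [_ bg]]].
have [u [h [uu hh]]] := trig_poly_pairs [seq (k + l, f k * g l) | k <- s, l <- t].
exists u, h; split => // z; rewrite -hh af bg /trig mulr_suml big_allpairs_dep /=.
apply: eq_bigr => k _; rewrite mulr_sumr; apply: eq_bigr => l _.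
by rewrite apointD sympDr (opprD (symp _ _)) expi2piD mulrACA.
Qed.

Lemma trig_poly1 : trig_poly (fun=> 1).
Proof.
have [s [b [us h]]] := trig_poly_pairs [:: (0, 1)].
exists s, b; split => // z; rewrite -h big_seq1 /= symp_apoint// (_ : dot _ _ = 0).
  by rewrite oppr0 expi2pi0 mulr1.
by rewrite /dot big1// => i _; rewrite !mxE mulr0.
Qed.

Lemma trig_poly_prod (I : Type) (s : seq I) (F : I -> T -> R[i]) :
  (forall i, trig_poly (F i)) -> trig_poly (fun z => \prod_(i <- s) F i z).
Proof.
move=> h; elim: s => [|i s IH].
  have [t [b [ut E]]] := trig_poly1.
  by exists t, b; split => // z; rewrite big_nil; exact: E.
have [t [b [ut E]]] := trig_polyM (h i) IH.
by exists t, b; split => // z; rewrite big_cons; exact: E.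
Qed.

Let half (i : 'I_N) (z : T) : R[i] := 2^-1 * 1 + 2^-1 * e (coords z i ord0).

Let trig_poly_half i : trig_poly (half i).
Proof.
(* The frequency is [- delta_mx i ord0] because of the minus sign in [trig]. *)
have [s [b [us h]]] := trig_poly_pairs [:: (0, 2^-1); (- delta_mx i ord0, 2^-1)].
exists s, b; split => // z; rewrite -h big_cons big_seq1 /= !symp_apoint//.
have -> : dot (coords z) (map_mx intr (0 : 'cV[int]_N)) = 0.
  by rewrite map_mx0 /dot big1// => j _; rewrite [X in _ * X]mxE mulr0.
have -> : dot (coords z) (map_mx intr (- delta_mx i ord0 : 'cV[int]_N)) = - coords z i ord0.
  rewrite map_mxN dotNr map_delta_mx /dot (bigD1 i)//= big1 => [|j ji].
    by rewrite addr0 [X in _ * X]mxE !eqxx mulr1.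
  by rewrite [X in _ * X]mxE (negbTE ji) mulr0.
by rewrite oppr0 opprK expi2pi0.
Qed.

(** The square of [cos (pi * x)], that is, the squared modulus of [half]. *)
Let v (x : R) : R := (1 + cos (2 * pi * x)) / 2.

Let nsq_half i z : nsq (half i z) = v (coords z i ord0).
Proof.
rewrite /half mulr1 -[X in X + _]mulr1 -mulrDr nsqM.
have -> : nsq (2^-1 : R[i]) = 4^-1.
  by rewrite (_ : 2^-1 = (2^-1 : R)%:C%C :> R[i]) ?nsqR ?expr2;
      [by field|rewrite fmorphV rmorph_nat].
rewrite nsqD nsq_expi2pi (nsq_nat 1) mul1r expi2piJ /= /v mulrN cosN expr1n; by field.
Qed.

Let v_ge0 x : 0 <= v x.
Proof. by rewrite /v divr_ge0// -lerBlDl sub0r cos_geN1. Qed.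

Let v_le1 x : v x <= 1.
Proof. by rewrite /v ler_pdivrMr// mul1r; have := cos_le1 (2 * pi * x); lra. Qed.

Let vN x : v `|x| = v x.
Proof. by case: (leP 0 x) => [/ger0_norm ->|/ltr0_norm ->]//; rewrite /v mulrN cosN. Qed.

Let v_anti x y : 0 <= x -> x <= y -> y <= 2^-1 -> v y <= v x.
Proof.
move=> x0 xy y2; rewrite /v ler_pM2r ?invr_gt0// lerD2l leNgt ltr_cos ?in_itv/=.
- by rewrite -leNgt ler_pM2l// mulr_gt0// pi_gt0.
- by apply/andP; split; [rewrite !mulr_ge0 ?pi_ge0 ?(le_trans x0 xy)|rewrite mulrAC ler_piMl
    ?pi_ge0//; lra].
- by apply/andP; split; [rewrite !mulr_ge0 ?pi_ge0|rewrite mulrAC ler_piMl ?pi_ge0//; lra].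
Qed.

Let v_lt1 x : 0 < x -> x <= 2^-1 -> v x < 1.
Proof.
move=> x0 x2; rewrite /v ltr_pdivrMr// mul1r.
suff : cos (2 * pi * x) < 1 by lra.
rewrite -[ltRHS](@cos0 R) ltr_cos ?in_itv/= ?lexx ?pi_ge0//.
  by rewrite !mulr_gt0// pi_gt0.
by apply/andP; split; [rewrite !mulr_ge0 ?pi_ge0 ?(ltW x0)|rewrite mulrAC ler_piMl ?pi_ge0//; lra].
Qed.

(** Near the origin all [N] coordinate factors together still exceed a single factor at a positive
    distance from it. *)
Let v_near (q : R) : q < 1 -> exists2 t, 0 < t <= 2^-1 & q < v t ^+ N.
Proof.
move=> q1; have c1 : v x ^+ N @[x --> 0] --> (1 : R).
  have -> : 1 = v 0 ^+ N by rewrite /v mulr0 cos0 (_ : (1 + 1) / 2 = 1) ?expr1n//; field.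
  have : {for 0, continuous (fun x => v x ^+ N)}.
    rewrite /v; apply: ctsX; apply: ctsM; last exact: cvg_cst.
    apply: ctsD; first exact: cvg_cst.
    apply: (cts_comp (@continuous_cos R)); apply: ctsM; [exact: cvg_cst|exact: cvg_id].
  by [].
have [r /= r0 hr] : nbhs_ball (0 : R) (fun x => q < v x ^+ N).
  by apply/nbhs_ballP; exact: cvgr_gt c1 _ q1.
exists (Num.min (r / 2) 2^-1); first by rewrite lt_min divr_gt0// invr_gt0 ltr0n ge_min lexx orbT.
apply: hr; rewrite /ball /= sub0r normrN gtr0_norm; last by rewrite lt_min divr_gt0// invr_gt0
    ltr0n.
by rewrite gt_min; apply/orP; left; rewrite ltr_pdivrMr// mulr2n mulrDr mulr1 ltrDl.
Qed.

Definition far (r : R) (z : T) : R := (~~ [forall i, `|coords z i ord0| <= r])%:R.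

Lemma far_ge0 r z : 0 <= far r z. Proof. exact: ler0n. Qed.

Lemma measurable_far r : measurable_fun setT (far r).
Proof.
pose B := \bigcap_(i in [set: 'I_N]) ((fun z : T => coords z i ord0) @^-1` `[- r, r]%classic).
have mB : measurable B.
  apply: fin_bigcap_measurable => // i _; rewrite -[X in measurable X]setTI.
  by apply: measurable_coords => //; exact: measurable_itv.
apply: (@measurable_eq _ _ T R (far r) (fun z => 1 - \1_B z)).
  move=> z; rewrite /far indicE.
  have -> : (z \in B) = [forall i, `|coords z i ord0| <= r].
    apply/idP/forallP => [|h]; rewrite inE.
      by move=> h i; have := h i I; rewrite /= in_itv/= ler_norml.
    by move=> i _ /=; rewrite in_itv/= -ler_norml.
  by case: [forall i, _]; rewrite ?subrr ?subr0.
by apply: measB => //; exact: measurable_indic.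
Qed.

Local Notation c := (cellind A).

(* [|trig s b|^2 = prod_i cos(pi s_i)^(2M)]; its total mass is bounded below on
   the shrunken cell of [(2 t) A]. *)
Lemma concentrating_kernel (r rho : R) : 0 < r -> 0 < rho -> exists s b,
  [/\ uniq s, 0 < \sum_(k <- s) nsq (b k) &
    (\int[lam]_z (c z * nsq (trig s b z) * far r z)%:E <=
     rho%:E * \int[lam]_z (c z * nsq (trig s b z))%:E)%E].
Proof.
(* [v] decreases only up to [1 / 2], the extreme coordinate of a cell, hence the truncation of
   [r]. *)
move=> r0 rho0; pose r' := Num.min r 2^-1.
have r'0 : 0 < r' by rewrite lt_min r0 invr_gt0 ltr0n.
have r'2 : r' <= 2^-1 by rewrite ge_min lexx orbT.
(* [q] bounds the factor of a coordinate exceeding [r'], and [p] below bounds the whole product from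
   below when all coordinates are at most [t] in modulus. Since [q < p], high powers separate the
   two regions. *)
set q := v r'; have q1 : q < 1 by exact: v_lt1.
have [t /andP[t0 t2] qt] := v_near q1.
set p := v t ^+ N in qt.
have q0 : 0 <= q by exact: v_ge0.
have p0 : 0 < p by exact: le_lt_trans qt.
pose A' := (2 * t) *: A.
have t20 : 2 * t != 0 by rewrite mulf_neq0// gt_eqF.
have uA' : A' \in unitmx by rewrite /A' unitmxZ ?unitfE.
have cA' z i : lcoords A' z i ord0 = coords z i ord0 / (2 * t).
  by rewrite /lcoords /A' invmxZ// -scalemxAl mxE mulrC.
set m := cell_mass A; set m' := cell_mass A'.
have m0 : 0 < m by exact: cell_mass_pos.
have m'0 : 0 < m' by exact: cell_mass_pos.
(* Equivalently [q^M m < rho p^M m'], the comparison of the bounds [upper] and [lower] below. *)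
have [M hM] : exists M : nat, (q / p) ^+ M * m < rho * m'.
  have c0 : (q / p) ^+ M * m @[M --> \oo] --> (0 * m : R).
    by apply: cvgMl; apply: cvg_expr; rewrite ger0_norm ?divr_ge0 ?(ltW p0)// ltr_pdivrMr ?mul1r.
  have := cvgr_lt _ c0 (rho * m'); rewrite mul0r => /(_ _ (mulr_gt0 rho0 m'0))[M _ h].
  by exists M; apply: h => /=.
have [s [b [us hs]]] : trig_poly (fun z => \prod_(i <- index_enum 'I_N)
    \prod_(j <- index_enum 'I_M) half i z).
  by apply: trig_poly_prod => i; apply: trig_poly_prod => _; exact: trig_poly_half.
have nsq1 : nsq (1 : R[i]) = 1 by rewrite (nsq_nat 1) expr1n.
have wE z : nsq (trig s b z) = \prod_i v (coords z i ord0) ^+ M.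
  rewrite -hs (big_morph _ (@nsqM R) nsq1); apply: eq_bigr => i _.
  rewrite (big_morph _ (@nsqM R) nsq1) nsq_half.
  by rewrite prodr_const card_ord.
have w0 z : 0 <= nsq (trig s b z) by exact: nsq_ge0.
have mw : measurable_fun setT (fun z => nsq (trig s b z)).
  by apply: cmeas_nsq; exact: cmeas_trig.
have mc : measurable_fun setT c by exact: measurable_cell.
have upper : (\int[lam]_z (c z * nsq (trig s b z) * far r z)%:E <= (q ^+ M * m)%:E)%E.
  rewrite EFinM EFin_cell_mass// -ge0_integralZT; last 3 first.
  - exact: measEFin.
  - by move=> z; rewrite lee_fin cell_ge0.
  - exact: exprn_ge0.
  apply: ge0_le_integralT.
  - by apply: measEFin; apply: measM; [exact: measM|exact: measurable_far].
  - by apply: measurable_funeM; exact: measEFin.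
  - by move=> z; rewrite lee_fin !mulr_ge0// ?cell_ge0 ?far_ge0.
  move=> z; rewrite -EFinM lee_fin /cellind /far.
  case: (boolP (in_cell A z)) => [/forallP inc|_]; last by rewrite !mul0r mulr0.
  case: (boolP [forall i, _]) => [_|]; first by rewrite mulr0 mulr1 exprn_ge0.
  case/forallPn => i; rewrite -ltNge => ri.
  rewrite mul1r !mulr1 wE (bigD1 i)//= -[leRHS]mulr1; apply: ler_pM.
  - exact: exprn_ge0.
  - by apply: prodr_ge0 => j _; exact: exprn_ge0.
  - rewrite lerXn2r ?nnegrE// -vN; apply: v_anti; rewrite ?(ltW r'0)//.
      by rewrite (le_trans _ (ltW ri))// ge_min lexx.
    by have /andP[h1 h2] := inc i; rewrite ler_norml h1 ltW.
  - apply: (@le_trans _ _ (\prod_(j < N | j != i) (1 : R))); last by rewrite big1.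
    by apply: ler_prod => j _; rewrite exprn_ge0//= exprn_ile1.
have lower : ((p ^+ M * m')%:E <= \int[lam]_z (c z * nsq (trig s b z))%:E)%E.
  rewrite EFinM EFin_cell_mass// -ge0_integralZT; last 3 first.
  - by apply: measEFin; exact: measurable_cell.
  - by move=> z; rewrite lee_fin cell_ge0.
  - by rewrite exprn_ge0// ltW.
  apply: ge0_le_integralT.
  - by apply: measurable_funeM; apply: measEFin; exact: measurable_cell.
  - by apply: measEFin; exact: measM.
  - by move=> z; rewrite -EFinM lee_fin mulr_ge0 ?cell_ge0// exprn_ge0// ltW.
  move=> z; rewrite -EFinM lee_fin /cellind.
  case: (boolP (in_cell A' z)) => [/forallP inc|_]; last by rewrite mulr0 mulr_ge0.
  have st i : - t <= coords z i ord0 < t.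
    have := inc i; rewrite cA' ler_pdivlMr ?mulr_gt0// ltr_pdivrMr ?mulr_gt0//.
    by rewrite mulNr mulKf// pnatr_eq0.
  rewrite (_ : in_cell A z); last first.
    by apply/forallP => i; have /andP[h1 h2] := st i; apply/andP; split; lra.
  rewrite mulr1 mul1r wE /p -exprM mulnC exprM -[N in _ ^+ N]card_ord -prodr_const.
  apply: ler_prod => i _; rewrite exprn_ge0//= lerXn2r ?nnegrE// -[leRHS]vN.
  apply: v_anti => //; have /andP[h1 h2] := st i; rewrite ler_norml; apply/andP; split => //.
  exact: ltW.
exists s, b; split => //.
  move: lower; rewrite parseval// lee_fin => lower.
  by rewrite -(pmulr_rgt0 _ m0); apply: lt_le_trans lower; exact: mulr_gt0 (exprn_gt0 M p0) m'0.
apply: (le_trans upper); apply: (@le_trans _ _ (rho%:E * (p ^+ M * m')%:E)%E).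
  rewrite -EFinM lee_fin; move: (ltW hM); rewrite expr_div_n mulrAC ler_pdivrMr ?(exprn_gt0 M p0)//.
  by rewrite -mulrA [m' * _]mulrC.
by apply: lee_wpmul2l => //; rewrite lee_fin ltW.
Qed.

End concentration.

(** * Strong continuity of time-frequency shifts *)

Section strong_continuity.
Context {R : realType} {d : nat}.
Local Notation lam := (@lebesgue_cV R d).
Local Notation T := 'cV[R]_d.
Local Notation e := (@expi2pi R).

Lemma cvg_dot n (x y : nat -> 'cV[R]_n) (x0 y0 : 'cV[R]_n) :
  (forall i, x k i ord0 @[k --> \oo] --> x0 i ord0) ->
  (forall i, y k i ord0 @[k --> \oo] --> y0 i ord0) ->
  dot (x k) (y k) @[k --> \oo] --> dot x0 y0.
Proof.
move=> cx cy; rewrite /dot; elim: (index_enum _) => [|i s IH].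
  by under eq_fun do rewrite big_nil; rewrite big_nil; exact: cvg_cst.
under eq_fun do rewrite big_cons; rewrite big_cons; apply: cvgD => //.
by apply: cvgM.
Qed.

Lemma nsq_expi2pi_sub1 (a : R) : nsq (e a - 1) = 2 - 2 * cos (2 * pi * a).
Proof.
rewrite nsqD nsq_expi2pi nsqN (nsq_nat 1) expr1n conjcN conjc1 mulrN1 ReN /=; ring.
Qed.

(** With [a] the phase, [a f(t + x) - f(t)] is [a (f(t + x) - f(t)) + (a - 1) f(t)]. The first term
    tends to 0 by continuity of translations, the second by dominated convergence since
    [|a - 1|^2 <= 4]. *)
Lemma tf_adj_cvg (f : T -> R[i]) (z : nat -> 'cV[R]_(d + d)) : l2 lam f ->
  (forall i, z k i ord0 @[k --> \oo] --> 0) ->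
  n2 lam (fun t => tf_adj (z k) f t - f t) @[k --> \oo] --> 0%E.
Proof.
move=> lf cz; have [[m1 m2] fy] := lf.
pose x k := usubmx (z k); pose xi k := dsubmx (z k).
have cx i : x k i ord0 @[k --> \oo] --> 0.
  by rewrite /x; under eq_fun do rewrite mxE; exact: cz.
have cxi i : xi k i ord0 @[k --> \oo] --> 0.
  by rewrite /xi; under eq_fun do rewrite mxE; exact: cz.
pose h k t := nsq (e (- dot (xi k) (t + x k)) - 1).
have adjE k t : tf_adj (z k) f t = e (- dot (xi k) (t + x k)) * f (t + x k).
  rewrite /tf_adj tf_shiftE usubmxN opprK dsubmxN dotNl mulrA -expi2piD.
  by congr (e _ * _); rewrite dotDr opprD addrC.
have mt k : measurable_fun setT (fun t : T => t + x k) by exact: measurable_translation.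
have mh k : measurable_fun setT (h k).
  apply: cmeas_nsq; apply: cmeasD; last exact: cmeas_cst.
  apply: cmeas_expi2pi; apply: measN; apply: measurable_dot => //; exact: measurable_cst.
have h0 k t : 0 <= h k t by exact: nsq_ge0.
have mn := cmeas_nsq lf.1.
have ftr k : cmeas (fun t : T => f (t + x k) - f t).
  by apply: cmeasD; [exact: (cmeas_comp lf.1 (mt k))|apply: cmeasN; exact: lf.1].
have bound k : (n2 lam (fun t => tf_adj (z k) f t - f t)%R <=
    2%:E * (n2 lam (fun t => f (t + x k) - f t)%R + \int[lam]_t (h k t * nsq (f t))%:E))%E.
  rewrite /n2 -ge0_integralDT; last 4 first.
  - by apply: measEFin; exact: cmeas_nsq.
  - by apply: measEFin; exact: measM.
  - by move=> t; rewrite lee_fin nsq_ge0.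
  - by move=> t; rewrite lee_fin mulr_ge0 ?nsq_ge0.
  rewrite -ge0_integralZT//; last 2 first.
  - by apply: emeasurable_funD; apply: measEFin; [exact: cmeas_nsq|exact: measM].
  - by move=> t; rewrite adde_ge0// lee_fin ?mulr_ge0 ?nsq_ge0.
  apply: ge0_le_integralT.
  - apply: measEFin; apply: cmeas_nsq.
    by have [mm _] := l2B (l2_tf_adj (z k) lf) lf.
  - apply: measurable_funeM; apply: emeasurable_funD; apply: measEFin;
      [exact: cmeas_nsq|exact: measM].
  - by move=> t; rewrite lee_fin nsq_ge0.
  move=> t; rewrite -EFinD -EFinM lee_fin adjE.
  set a := e _; have -> : a * f (t + x k) - f t = a * (f (t + x k) - f t) + (a - 1) * f t by ring.
  apply: (le_trans (nsqD_le2 _ _)); rewrite !nsqM nsq_expi2pi mul1r.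
  exact: lexx.
have c1 : n2 lam (fun t => f (t + x k) - f t)%R @[k --> \oo] --> 0%E.
  have e1 k : (sqint lam (fun t => complex.Re (f (t + x k)) - complex.Re (f t))%R +
      sqint lam (fun t => complex.Im (f (t + x k)) - complex.Im (f t))%R =
      n2 lam (fun t => f (t + x k) - f t)%R)%E.
    rewrite n2_sqint//; congr (_ + _)%E; apply: eq_integral => t _; first by rewrite ReB.
    by rewrite ImB.
  apply: (cvg_eq1 e1); rewrite -[X in _ --> X]adde0; apply: cvgeD => //.
    apply: (translation_cvg (p := fun t => complex.Re (f t))) => //.
    by apply: le_lt_trans fy; rewrite n2_sqint// leeDl// sqint_ge0.
  apply: (translation_cvg (p := fun t => complex.Im (f t))) => //.
  by apply: le_lt_trans fy; rewrite n2_sqint// leeDr// sqint_ge0.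
have c2 : (\int[lam]_t (h k t * nsq (f t))%:E)%E @[k --> \oo] --> 0%E.
  apply: (@ge0_dominated_cvg0 _ T R lam (fun k t => (h k t * nsq (f t))%:E) (fun t =>
      4%:E * (nsq (f t))%:E)%E).
  - by move=> k; apply: measEFin; exact: measM.
  - by move=> k t; rewrite lee_fin mulr_ge0 ?nsq_ge0.
  - by apply: measurable_funeM; exact: measEFin.
  - move=> k t; rewrite -EFinM lee_fin ler_wpM2r ?nsq_ge0// /h nsq_expi2pi_sub1.
    by have := cos_geN1 (2 * pi * - dot (xi k) (t + x k)); lra.
  - rewrite ge0_integralZT//; last 2 first.
    + exact: measEFin.
    + by move=> t; rewrite lee_fin nsq_ge0.
    by rewrite lte_mul_pinfty.
  - apply: aeW => t; have c3 : h k t @[k --> \oo] --> (2 - 2 * cos (2 * pi * - 0) : R).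
      have hE k : 2 - 2 * cos (2 * pi * - dot (xi k) (t + x k)) =
          h k t by rewrite /h nsq_expi2pi_sub1.
      apply: (cvg_eq1 hE); apply: cvgB; first exact: cvg_cst.
      apply: cvgMr; apply: continuous_cvg; first exact: continuous_cos.
      apply: cvgMr; apply: cvgN.
      have -> : 0 = dot (0 : T) (t + 0) by rewrite /dot big1// => i _; rewrite mxE mul0r.
      apply: cvg_dot => i; first by rewrite mxE; exact: cxi.
      under eq_fun do rewrite mxE; rewrite mxE; apply: cvgD; first exact: cvg_cst.
      by rewrite mxE; exact: cx.
    have c4 : h k t * nsq (f t) @[k --> \oo] --> (0 : R).
      move: c3; rewrite oppr0 mulr0 cos0 mulr1 subrr => c3.
      by rewrite -(mul0r (nsq (f t))); exact: cvgMl.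
    by apply/fine_cvgP; split; [near=> k|exact: c4].
apply: (@squeeze_cvge _ _ _ _ (cst 0%E) _ (fun k => 2%:E * (n2 lam (fun t => f (t + x k) -
    f t)%R + \int[lam]_t (h k t * nsq (f t))%:E))%E).
- by apply: nearW => k; rewrite n2_ge0 bound.
- exact: cvg_cst.
- rewrite -[X in _ --> X](mule0 2%:E); apply: cvgeZl => //.
  by rewrite -[X in _ --> X]adde0; apply: cvgeD.
Unshelve. all: by end_near.
Qed.

(** Otherwise a sequence with lattice coordinates at most [1 / (k + 1)] would contradict
    [tf_adj_cvg]. Smallness is measured in lattice coordinates, as in [far]. *)
Lemma tf_adj_continuous (A : 'M[R]_(d + d)) (f : T -> R[i]) (eps : R) :
  A \in unitmx -> l2 lam f -> 0 < eps -> exists2 r, 0 < r &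
    forall z, (forall i, `|lcoords A z i ord0| <= r) -> rn lam (fun t => tf_adj z f t - f t) <= eps.
Proof.
move=> uA lf e0; apply: contrapT => hn.
have /choice[z hz] (k : nat) : exists z : 'cV[R]_(d + d),
    (forall i, `|lcoords A z i ord0| <= k.+1%:R^-1) /\
    eps < rn lam (fun t => tf_adj z f t - f t).
  apply: contrapT => hk; apply: hn; exists k.+1%:R^-1; first by [].
  move=> z hz; rewrite leNgt; apply/negP => hlt; apply: hk; exists z; split => //.
have cz i : z k i ord0 @[k --> \oo] --> 0.
  have zE k : \sum_j A i j * lcoords A (z k) j ord0 = z k i ord0.
    by rewrite -[in RHS](coordsK uA (z k)) mxE.
  apply: (cvg_eq1 zE); elim: (index_enum _) => [|j s IH].
    by under eq_fun do rewrite big_nil; exact: cvg_cst.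
  have cj : A i j * lcoords A (z k) j ord0 @[k --> \oo] --> 0.
    rewrite -(mulr0 (A i j)); apply: cvgMr; apply/norm_cvg0P.
    apply: (@squeeze_cvgr _ _ _ _ (cst 0) (fun k => k.+1%:R^-1)).
    - by apply: nearW => k; rewrite normr_ge0 (hz k).1.
    - exact: cvg_cst.
    - exact: cvg_harmonic.
  have : A i j * lcoords A (z k) j ord0 + \sum_(j <- s) A i j * lcoords A (z k) j ord0
      @[k --> \oo] --> (0 + 0 : R) by exact: cvgD.
  by rewrite addr0; apply: cvg_eq1 => k; rewrite big_cons.
have := tf_adj_cvg lf cz => /fine_cvgP[_] c0.
have [K _ hK] := cvgr_lt _ c0 _ e0.
have := hK K (leqnn K); rewrite /= => h1.
by have := lt_trans (hz K).2 h1; rewrite ltxx.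
Qed.

End strong_continuity.

(** * Frames over the lattice and finite sums over its adjoint *)

Section gabor_duality.
Context {R : realType} {d : nat} (A : 'M[R]_(d + d)).
Hypothesis uA : A \in unitmx.
Local Notation N := (d + d)%N.
Local Notation Z := 'cV[R]_(d + d).
Local Notation T := 'cV[R]_d.
Local Notation K := 'cV[int]_(d + d).
Local Notation lam := (@lebesgue_cV R d).
Local Notation Lam := (@lebesgue_cV R (d + d)).
Local Notation l2 := (l2 lam).
Local Notation n2 := (n2 lam).
Local Notation rn := (rn lam).
Local Notation ip := (ip lam).
Local Notation e := (@expi2pi R).
Local Notation apoint := (apoint A).
Local Notation trig := (trig A).
Local Notation cell := (cellind A).
Local Notation m := (cell_mass A).
Variable g : T -> R[i].
Hypothesis lg : l2 g.

Definition gsum (s : seq K) (b : K -> R[i]) : T -> R[i] :=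
  fun t => \sum_(k <- s) b k * tf_shift (apoint k) g t.

Lemma l2_gsum s b : l2 (gsum s b).
Proof. by apply: l2_sum => k; apply: l2Z; exact: l2_tf_shift. Qed.

Definition finite_riesz (a b : R) : Prop := forall s (c : K -> R[i]), uniq s ->
  a * \sum_(k <- s) nsq (c k) <= rn (gsum s c) <= b * \sum_(k <- s) nsq (c k).

Definition analysis (f : T -> R[i]) : \bar R :=
  (\esum_(l in lattice A) (nsq (ip f (tf_shift l g)))%:E)%E.

Lemma analysis_ge0 f : (0 <= analysis f)%E.
Proof. by apply: esum_ge0 => l _; rewrite lee_fin nsq_ge0. Qed.

(** [pi(z) pi(l)] and [pi(z + l)] differ by a phase, which the modulus does not see. *)
Lemma nsq_ip_shift f z l : l2 f ->
  nsq (ip f (tf_shift (z + l) g)) = nsq (ip (tf_adj z f) (tf_shift l g)).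
Proof.
move=> lf; have ls w := l2_tf_shift w lg.
rewrite ip_tf_adj//.
have -> : tf_shift z (tf_shift l g) = fun t => e (- dot (dsubmx l) (usubmx z)) * tf_shift (z +
    l) g t.
  by apply/funext => t; rewrite tf_shiftM.
by rewrite ipZr// nsqM nsqJ nsq_expi2pi mul1r.
Qed.

Section frame_to_riesz.
Variable u : T -> R[i].
Hypothesis lu : l2 u.
Variables (s : seq K) (c : K -> R[i]).
Hypothesis us : uniq s.

Let b (t : T) (k : K) : R[i] := conjc (c k) * tf_adj (apoint k) u t.
(* Moving the shifts of [gsum s c] onto [u] replaces it by the [lattice A]-periodic
   family [fz]. *)
Let fz (z : Z) (t : T) : R[i] := trig s (b t) z.

Let lfz z : l2 (fz z).
Proof.
apply: l2_sum => k; under [X in l2 X]funext do rewrite mulrC.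
by apply: l2Z; apply: l2Z; exact: l2_tf_adj.
Qed.

Let ip_gsum z : ip u (tf_shift z (gsum s c)) = ip (fz z) (tf_shift z g).
Proof.
have ls w := l2_tf_shift w lg.
have -> : tf_shift z (gsum s c) = fun t => \sum_(k <- s)
    (c k * e (symp z (apoint k))) * tf_shift (apoint k) (tf_shift z g) t.
  rewrite /gsum tf_shift_sum; apply/funext => t; apply: eq_bigr => k _.
  by rewrite tf_shiftZ tf_shiftC mulrA.
rewrite ip_sumr//; last by move=> k; apply: l2Z; exact: l2_tf_shift.
have -> : fz z = fun t => \sum_(k <- s) (conjc (c k) * e (- symp z (apoint k)))
    * tf_adj (apoint k) u t.
  by apply/funext => t; apply: eq_bigr => k _; rewrite /b mulrAC.
rewrite ip_suml//; last by move=> k; apply: l2Z; exact: l2_tf_adj.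
apply: eq_bigr => k _; rewrite ipZr//; last exact: l2_tf_shift.
rewrite ipZl//; last exact: l2_tf_adj.
by rewrite conjcM expi2piJ ip_tf_adj.
Qed.

Let fz_period z l : lattice A l -> fz (z + l) = fz z.
Proof. by move=> Al; apply/funext => t; exact: trig_period. Qed.

Let nsq_ip_gsum z l : lattice A l ->
  nsq (ip u (tf_shift (z + l) (gsum s c))) = nsq (ip (tf_adj z (fz z)) (tf_shift l g)).
Proof. by move=> Al; rewrite ip_gsum (fz_period z Al); exact: nsq_ip_shift (lfz z). Qed.

Let cfz : cmeas (fun x : Z * T => fz x.1 x.2).
Proof.
apply: cmeas_sum => k; apply: cmeasM.
  apply: cmeasM; first exact: cmeas_cst.
  by apply: (cmeas_comp (l2_tf_adj (apoint k) lu).1); mfun.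
apply: cmeas_expi2pi; apply: measN.
by apply: (measurableT_comp (measurable_symp (apoint k))); mfun.
Qed.

Let mfz : measurable_fun setT (fun x : Z * T => (cell x.1 * nsq (fz x.1 x.2))%:E).
Proof.
apply: measEFin; apply: measM; last exact: cmeas_nsq.
by apply: (measurableT_comp (measurable_cell A)); mfun.
Qed.

Let ge0_fz (x : Z * T) : (0 <= (cell x.1 * nsq (fz x.1 x.2))%:E)%E.
Proof. by rewrite lee_fin mulr_ge0 ?cell_ge0 ?nsq_ge0. Qed.

Let cell_n2 z : (\int[lam]_t (cell z * nsq (fz z t))%:E = (cell z)%:E * n2 (fz z))%E.
Proof.
rewrite /n2 -ge0_integralZT.
- by apply: eq_integral => t _; rewrite EFinM.
- by apply: measEFin; apply: cmeas_nsq; exact: (lfz z).1.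
- by move=> t; rewrite lee_fin nsq_ge0.
- exact: cell_ge0.
Qed.

(** After exchanging the integrals, [parseval] on the cell is applied for each fixed [t], the
    coefficients being [b t k]; integrating in [t] leaves [rn u] because [tf_adj] preserves
    norms. *)
Let mean_fz : (\int[Lam]_z ((cell z)%:E * n2 (fz z)) =
  (m * (\sum_(k <- s) nsq (c k)) * rn u)%:E)%E.
Proof.
transitivity (\int[lam]_t \int[Lam]_z (cell z * nsq (fz z t))%:E)%E.
  rewrite -(@fubini_tonelli _ _ Z T _ Lam lam (fun x => (cell x.1 * nsq (fz x.1 x.2))%:E)
      mfz ge0_fz).
  by apply: eq_integral => z _; rewrite -cell_n2.
have la k := l2_tf_adj (apoint k) lu.
transitivity (\int[lam]_t (m * \sum_(k <- s) nsq (c k) * nsq (tf_adj (apoint k) u t))%:E)%E.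
  apply: eq_integral => t _; rewrite /fz parseval//; congr (_ * _)%:E.
  by apply: eq_bigr => k _; rewrite /b nsqM nsqJ.
have ii k : intg lam (fun t => nsq (c k) * nsq (tf_adj (apoint k) u t)).
  by apply: intgZ; exact: intg_nsq.
rewrite -EFin_Rint; last by apply: intgZ; exact: intg_sum.
congr EFin; rewrite RintZ; last exact: intg_sum.
rewrite Rint_sum// -mulrA mulr_suml; congr (_ * _); apply: eq_bigr => k _.
rewrite RintZ; last exact: intg_nsq.
by rewrite -rnE// rn_tf_adj.
Qed.

(** Moyal's identity for the pair [u], [gsum s c], unfolded over the lattice and rewritten with
    [nsq_ip_gsum]. *)
Let mean_analysis : (\int[Lam]_z ((cell z)%:E * analysis (tf_adj z (fz z))) =
    (rn u * rn (gsum s c))%:E)%E.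
Proof.
have lG := l2_gsum s c.
rewrite EFinM (EFin_rn lu) (EFin_rn lG) -(moyal1 lu lG).
rewrite (unfolding uA (H := fun z => nsq (ip u (tf_shift z (gsum s c))))); last 2 first.
- by apply: cmeas_nsq; apply: cmeas_ip_tf_shift => //; mfun.
- by move=> z; exact: nsq_ge0.
by apply: eq_integral => z _; congr (_ * _)%E; apply: eq_esum => l Al; rewrite nsq_ip_gsum.
Qed.

Let manalysis : measurable_fun setT (fun z => (cell z)%:E * analysis (tf_adj z (fz z)))%E.
Proof.
apply: emeasurable_funM; first by apply: measEFin; exact: measurable_cell.
apply: (@measurable_eq _ _ Z _ _ (fun z => \esum_(k in [set: K]) (nsq (ip u (tf_shift (z +
    lpoint A k) (gsum s c))))%:E)%E).
  move=> z; rewrite /analysis (esum_lattice uA); apply: eq_esum => k _.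
  have Ak : lattice A (lpoint A k) by exists k.
  by rewrite (nsq_ip_gsum z Ak).
apply: measurable_esum => k; last by move=> z; rewrite lee_fin nsq_ge0.
apply: measEFin; apply: cmeas_nsq; apply: cmeas_ip_tf_shift => //; last exact: l2_gsum.
exact: measurable_translation.
Qed.

Let mn2 : measurable_fun setT (fun z => (cell z)%:E * n2 (fz z))%E.
Proof.
apply: (measurable_eq (fun z => esym (cell_n2 z))).
exact: (@measurable_fun_fubini_tonelli_F _ _ Z T R lam _ mfz ge0_fz).
Qed.

(** The frame inequality is applied to [tf_adj z (fz z)] for each [z] of the cell and averaged; both
    averages are explicit. *)
Lemma frame_lower_gsum (a : R) : 0 <= a -> (forall f, l2 f -> (a%:E * n2 f <= analysis f)%E) ->
  a * (m * (\sum_(k <- s) nsq (c k)) * rn u) <= rn u * rn (gsum s c).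
Proof.
move=> a0 h; rewrite -lee_fin -mean_analysis EFinM -mean_fz -ge0_integralZT//; last first.
  by move=> z; rewrite mule_ge0 ?n2_ge0// lee_fin cell_ge0.
apply: ge0_le_integralT; [exact: measurable_funeM|exact: manalysis|..].
- by move=> z; rewrite !mule_ge0 ?n2_ge0 ?lee_fin// cell_ge0.
- move=> z; rewrite muleCA; apply: lee_wpmul2l; first by rewrite lee_fin cell_ge0.
  apply: le_trans (h _ (l2_tf_adj z (lfz z))).
  by rewrite -!EFin_rn//; [rewrite rn_tf_adj|exact: l2_tf_adj].
Qed.

Lemma frame_upper_gsum (a : R) : 0 <= a -> (forall f, l2 f -> (analysis f <= a%:E * n2 f)%E) ->
  rn u * rn (gsum s c) <= a * (m * (\sum_(k <- s) nsq (c k)) * rn u).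
Proof.
move=> a0 h; rewrite -lee_fin -mean_analysis EFinM -mean_fz -ge0_integralZT//; last first.
  by move=> z; rewrite mule_ge0 ?n2_ge0// lee_fin cell_ge0.
apply: ge0_le_integralT; [exact: manalysis|exact: measurable_funeM|..].
- by move=> z; rewrite mule_ge0 ?analysis_ge0 ?lee_fin// cell_ge0.
- move=> z; rewrite muleCA; apply: lee_wpmul2l; first by rewrite lee_fin cell_ge0.
  apply: (le_trans (h _ (l2_tf_adj z (lfz z)))).
  by rewrite -!EFin_rn//; [rewrite rn_tf_adj|exact: l2_tf_adj].
Qed.

End frame_to_riesz.

(** The indicator of the unit cube. It serves as the probe [u], whose norm then divides out of the
    averaged inequalities. *)
Lemma exists_unit_norm : exists2 u : T -> R[i], l2 u & rn u = 1.
Proof.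
pose B := [set t : T | forall i, `[0, 1]%classic (t i ord0)].
have mB : measurable B.
  rewrite (_ : B = \bigcap_(i in [set: 'I_d]) ((fun z : T => z i ord0) @^-1` `[0, 1]%classic)).
    apply: fin_bigcap_measurable => // i _; rewrite -[X in measurable X]setTI.
    by apply: measurable_entry => //; exact: measurable_itv.
  by apply/seteqP; split => [z h' i _|z h' i]; exact: h'.
have lB : lam B = 1%E.
  transitivity (\prod_(i < d) (@lebesgue_measure R) `[0%R, 1%R]%classic)%E.
    by apply: (@lebesgue_cV_box R d (fun=> `[0, 1]%classic)) => i; exact: measurable_itv.
  by rewrite big1// => i _; rewrite lebesgue_measure_itv /= lte_fin ltr01 oppr0 adde0.
pose u (t : T) : R[i] := (\1_B t)%:C%C.
have mu : cmeas u by split => /=; [exact: measurable_indic|exact: measurable_cst].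
have nu : n2 u = 1%E.
  rewrite /n2 -lB -[in RHS](setIT B) -integral_indic//; apply: eq_integral => t _.
  by rewrite /u nsqR indicE; case: (t \in B); rewrite ?expr1n ?expr0n.
by exists u; [split => //; rewrite nu ltry|rewrite /rn nu].
Qed.

Lemma frame_finite_riesz (a b : R) : 0 < a -> 0 < b ->
  (forall f, l2 f -> (a%:E * n2 f <= analysis f)%E) ->
  (forall f, l2 f -> (analysis f <= b%:E * n2 f)%E) ->
  finite_riesz (a * m) (b * m).
Proof.
move=> a0 b0 ha hb s c us; have [u lu u1] := exists_unit_norm.
have := frame_lower_gsum lu c us (ltW a0) ha; have := frame_upper_gsum lu c us (ltW b0) hb.
by rewrite u1 !mul1r !mulr1 !mulrA => h1 h2; apply/andP.
Qed.

Section riesz_to_frame.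
Variable f : T -> R[i].
Hypothesis lf : l2 f.

Section trig_average.
Variables (s : seq K) (b : K -> R[i]).
Hypothesis us : uniq s.

Let w (k : K) (t : T) : R[i] := b k * tf_shift (apoint k) f t.
Let lw k : l2 (w k). Proof. by apply: l2Z; exact: l2_tf_shift. Qed.
Let lgk k : l2 (tf_shift (apoint k) g). Proof. exact: l2_tf_shift. Qed.

Let ip_w z k : ip (w k) (tf_shift z (tf_shift (apoint k) g)) =
  b k * e (- symp z (apoint k)) * ip f (tf_shift z g).
Proof.
have -> : tf_shift z (tf_shift (apoint k) g) =
    fun t => e (symp z (apoint k)) * tf_shift (apoint k) (tf_shift z g) t.
  by apply/funext => t; exact: tf_shiftC.
have lz := l2_tf_shift z lg; have lzk := l2_tf_shift (apoint k) lz.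
rewrite /w ipZl//; last first.
- exact: l2Z.
- exact: l2_tf_shift.
by rewrite (ipZr _ (l2_tf_shift (apoint k) lf) lzk) expi2piJ ip_tf_shift// mulrA.
Qed.

Let G (t u : T) : R[i] := \sum_(k <- s) w k t * conjc (tf_shift (apoint k) g u).

(** Moyal's identity for the finite families [w k] and [tf_shift (apoint k) g]: by [ip_w] the sum of
    inner products at [z] factors as [trig s b z] times [ip f (tf_shift z g)]. *)
Let mean : (\int[Lam]_z ((cell z * nsq (trig s b z))%:E * analysis (tf_adj z f)) =
  \int[lam]_u \int[lam]_t (nsq (G t u))%:E)%E.
Proof.
rewrite /G -(moyal s lw lgk).
pose H z := nsq (trig s b z) * nsq (ip f (tf_shift z g)).
have mH : measurable_fun setT H.
  apply: measM; apply: cmeas_nsq; first exact: cmeas_trig.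
  by apply: cmeas_ip_tf_shift => //; mfun.
have H0 z : 0 <= H z by rewrite mulr_ge0 ?nsq_ge0.
transitivity (\int[Lam]_z (H z)%:E)%E; last first.
  apply: eq_integral => z _; congr EFin; rewrite /H -nsqM; congr nsq.
  by rewrite /trig mulr_suml; apply: eq_bigr => k _; rewrite ip_w.
rewrite (unfolding uA mH H0); apply: eq_integral => z _.
rewrite EFinM -muleA; congr (_ * _)%E; rewrite /analysis !(esum_lattice uA).
have Q0 k : (0 <= (nsq (ip (tf_adj z f) (tf_shift (lpoint A k)
    g)))%:E)%E by rewrite lee_fin nsq_ge0.
rewrite -(esumZl (nsq_ge0 (trig s b z)) Q0); apply: eq_esum => k _;
    have Ak : lattice A (lpoint A k) by exists k.
by rewrite /H (trig_period uA s b z Ak) (nsq_ip_shift z (lpoint A k) lf) EFinM.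
Qed.

Let cG : cmeas (fun x : T * T => G x.1 x.2).
Proof.
apply: cmeas_sum => k; apply: cmeasM.
  by apply: (cmeas_comp (lw k).1); mfun.
by apply: cmeasJ; apply: (cmeas_comp (lgk k).1); mfun.
Qed.

(** For fixed [t], integrating [|G t u|^2] in [u] gives the squared norm of a finite sum over the
    adjoint lattice, up to conjugation. *)
Let mean2 : (\int[Lam]_z ((cell z * nsq (trig s b z))%:E * analysis (tf_adj z f)) =
  \int[lam]_t (rn (gsum s (fun k => conjc (w k t))))%:E)%E.
Proof.
rewrite mean.
have mG : measurable_fun setT (fun x : T * T => (nsq (G x.1 x.2))%:E).
  by apply: measEFin; exact: cmeas_nsq.
have G0 (x : T * T) : (0 <= (nsq (G x.1 x.2))%:E)%E by rewrite lee_fin nsq_ge0.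
rewrite -(@fubini_tonelli _ _ T T R lam lam _ mG G0); apply: eq_integral => t _.
rewrite EFin_rn; last exact: l2_gsum.
apply: eq_integral => u _; congr EFin; rewrite -nsqJ; congr nsq.
rewrite /G /gsum (big_morph _ (@conjcD R) (@conjc0 R)); apply: eq_bigr => k _.
by rewrite conjcM conjcK.
Qed.

Let iw : intg lam (fun t => \sum_(k <- s) nsq (conjc (w k t))).
Proof.
apply: intg_sum => k; under [X in intg _ X]funext do rewrite nsqJ.
exact: intg_nsq.
Qed.

Let int_w : \int[lam]_t (\sum_(k <- s) nsq (conjc (w k t))) = (\sum_(k <- s) nsq (b k)) * rn f.
Proof.
rewrite Rint_sum; last first.
  by move=> k; under [X in intg _ X]funext do rewrite nsqJ; exact: intg_nsq.
rewrite mulr_suml; apply: eq_bigr => k _; under eq_Rintegral do rewrite nsqJ.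
by rewrite -rnE// rnZ ?rn_tf_shift//; exact: l2_tf_shift.
Qed.

Let m_gsum : measurable_fun setT (fun t => (rn (gsum s (fun k => conjc (w k t))))%:E).
Proof.
have mG : measurable_fun setT (fun x : T * T => (nsq (G x.1 x.2))%:E).
  by apply: measEFin; exact: cmeas_nsq.
have G0 (x : T * T) : (0 <= (nsq (G x.1 x.2))%:E)%E by rewrite lee_fin nsq_ge0.
apply: (measurable_eq _ (@measurable_fun_fubini_tonelli_F _ _ T T R lam _ mG G0)) => t.
rewrite EFin_rn; last exact: l2_gsum.
apply: eq_integral => u _; congr EFin; rewrite -[RHS]nsqJ; congr nsq.
rewrite /G /gsum (big_morph _ (@conjcD R) (@conjc0 R)); apply: eq_bigr => k _.
by rewrite [RHS]conjcM conjcK.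
Qed.

(** The finite bound is used separately for each [t], with coefficients [conjc (w k t)], and then
    integrated in [t]. *)
Lemma trig_average_lower a B : 0 <= a -> finite_riesz a B ->
  ((a * ((\sum_(k <- s) nsq (b k)) * rn f))%:E <=
   \int[Lam]_z ((cell z * nsq (trig s b z))%:E * analysis (tf_adj z f)))%E.
Proof.
move=> a0 h; rewrite mean2 -int_w -RintZ// EFin_Rint; last exact: intgZ.
have mi := intg_measurable iw.
apply: ge0_le_integralT.
- by apply: measEFin; apply: measM.
- exact: m_gsum.
- by move=> t; rewrite lee_fin mulr_ge0// sumr_ge0// => k _; exact: nsq_ge0.
- by move=> t; rewrite lee_fin; have /andP[] := h s (fun k => conjc (w k t)) us.
Qed.

Lemma trig_average_upper a B : 0 <= B -> finite_riesz a B ->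
  (\int[Lam]_z ((cell z * nsq (trig s b z))%:E * analysis (tf_adj z f)) <=
   (B * ((\sum_(k <- s) nsq (b k)) * rn f))%:E)%E.
Proof.
move=> B0 h; rewrite mean2 -int_w -RintZ// EFin_Rint; last exact: intgZ.
have mi := intg_measurable iw.
apply: ge0_le_integralT.
- exact: m_gsum.
- by apply: measEFin; apply: measM.
- by move=> t; rewrite lee_fin rn_ge0.
- by move=> t; rewrite lee_fin; have /andP[] := h s (fun k => conjc (w k t)) us.
Qed.

End trig_average.

Lemma measurable_analysis_adj : measurable_fun setT (fun z => analysis (tf_adj z f)).
Proof.
apply: (@measurable_eq _ _ Z _ _ (fun z => \esum_(k in [set: K]) (nsq (ip f (tf_shift (z +
    lpoint A k) g)))%:E)%E).
  move=> z; rewrite /analysis (esum_lattice uA); apply: eq_esum => k _.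
  by rewrite (nsq_ip_shift z (lpoint A k) lf).
apply: measurable_esum => k; last by move=> z; rewrite lee_fin nsq_ge0.
apply: measEFin; apply: cmeas_nsq; apply: cmeas_ip_tf_shift => //.
exact: measurable_translation.
Qed.

End riesz_to_frame.

(** Finite parts of [analysis]: Cauchy-Schwarz bounds them in terms of the number of points, before
    any uniform bound is known. *)
Definition analysis_seq (L : seq Z) (f : T -> R[i]) : R := \sum_(l <- L) nsq (ip f (tf_shift l g)).

Lemma nsq_ip_le f h l : l2 f -> l2 h -> nsq (ip f (tf_shift l g)) <=
  2 * nsq (ip h (tf_shift l g)) + 2 * nsq (ip (fun t => h t - f t) (tf_shift l g)).
Proof.
move=> lf lh; have ls := l2_tf_shift l lg.
have -> : ip f (tf_shift l g) = ip h (tf_shift l g) - ip (fun t => h t - f t) (tf_shift l g).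
  by rewrite ipBl// opprB addrC subrK.
by rewrite -mulrDr (le_trans (nsqD_le2 _ _))// nsqN.
Qed.

Lemma analysis_seq_le_rn L f : l2 f -> analysis_seq L f <= (size L)%:R * rn g * rn f.
Proof.
move=> lf; rewrite /analysis_seq -sum1_size natr_sum !mulr_suml; apply: ler_sum => l _.
rewrite mul1r mulrC -(rn_tf_shift l lg); apply: cauchy_schwarz => //.
exact: l2_tf_shift.
Qed.

Lemma analysis_seq_le L f h : l2 f -> l2 h ->
  analysis_seq L f <= 2 * analysis_seq L h + 2 * analysis_seq L (fun t => h t - f t).
Proof.
move=> lf lh; rewrite /analysis_seq !mulr_sumr -big_split; apply: ler_sum => l _.
exact: nsq_ip_le.
Qed.

Lemma analysis_le f h : l2 f -> l2 h ->
  (analysis f <= 2%:E * analysis h + 2%:E * analysis (fun t => (h t - f t)%R))%E.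
Proof.
move=> lf lh; rewrite /analysis !(esum_lattice uA) -!esumZl//; last 2 first.
- by move=> k; rewrite lee_fin nsq_ge0.
- by move=> k; rewrite lee_fin nsq_ge0.
rewrite -esumD; last 2 first.
- by move=> k _; rewrite mule_ge0// lee_fin nsq_ge0.
- by move=> k _; rewrite mule_ge0// lee_fin nsq_ge0.
by apply: le_esum => k _; rewrite -!EFinM -EFinD lee_fin nsq_ip_le.
Qed.

Lemma esum_le_seq (I : choiceType) (S : set I) (F : I -> R) (x : \bar R) :
  (forall L : seq I, uniq L -> {in L, forall i, S i} -> ((\sum_(i <- L) F i)%:E <= x)%E) ->
  (\esum_(i in S) (F i)%:E <= x)%E.
Proof.
move=> h; apply: ge_ereal_sup => _ [X [finX XS] <-].
rewrite fsbig_finite//= sumEFin; apply: h; first exact: fset_uniq.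
by move=> i; rewrite in_fset_set// inE => /XS.
Qed.

Lemma seq_le_esum (I : choiceType) (S : set I) (F : I -> R) (L : seq I) :
  uniq L -> {in L, forall i, S i} -> ((\sum_(i <- L) F i)%:E <= \esum_(i in S) (F i)%:E)%E.
Proof.
move=> uL LS; apply: esum_ge; exists [set` L].
  by split; [exact: finite_seq|move=> i /= /LS].
by rewrite -sumEFin fsbig_seq.
Qed.

(* The factor [2], as in [riesz_lower_frame], comes from comparing [f] with
   [tf_adj z f] for small [z] by [|a + b|^2 <= 2 |a|^2 + 2 |b|^2]. *)
Lemma riesz_upper_frame a B f : 0 <= B -> finite_riesz a B -> l2 f ->
  (analysis f <= (2 * B / m)%:E * n2 f)%E.
Proof.
move=> B0 h lf; rewrite -EFin_rn//; apply: esum_le_seq => L uL LA.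
rewrite -/(analysis_seq L f) -EFinM lee_fin.
(* This crude constant depends on [L], but it only multiplies [eps] and [rho], which are sent to 0
   afterwards. *)
set C := (size L)%:R * rn g; have C0 : 0 <= C by rewrite mulr_ge0 ?rn_ge0.
have m0 : 0 < m by exact: cell_mass_pos.
suff step eps rho : 0 < eps -> 0 < rho ->
    analysis_seq L f <= 2 * B / m * rn f + 2 * C * eps + C * rn f * rho.
  apply/ler_addgt0Pl => x x0.
  (* Both parameters are set to [y], making the total error at most [x]; the added 1 keeps the
     denominator positive. *)
  pose y := x / (2 * C + C * rn f + 1).
  have D0 : 0 < 2 * C + C * rn f + 1 by rewrite ltr_wpDl// addr_ge0// mulr_ge0// rn_ge0.
  have y0 : 0 < y by rewrite divr_gt0.
  apply: (le_trans (step y y y0 y0)).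
  rewrite -addrA [x + _]addrC lerD2l -mulrDl /y mulrCA ler_piMr ?(ltW x0)//.
  by rewrite ler_pdivrMr// mul1r lerDl.
move=> e0 rho0.
have ce : 0 <= 2 * C * eps := mulr_ge0 (mulr_ge0 (ler0n R 2) C0) (ltW e0).
have cf : 0 <= C * rn f := mulr_ge0 C0 (rn_ge0 lam f).
have [r r0 hr] := tf_adj_continuous uA lf e0.
have [s [b [us b0 hfar]]] := concentrating_kernel uA r0 rho0.
set beta := \sum_(k <- s) nsq (b k) in b0.
have upper := trig_average_upper lf b us B0 h.
pose W z := cell z * nsq (trig s b z).
have W0 z : 0 <= W z by rewrite mulr_ge0 ?cell_ge0 ?nsq_ge0.
have mW : measurable_fun setT W.
  by apply: measM; [exact: measurable_cell|apply: cmeas_nsq; exact: cmeas_trig].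
have intW : (\int[Lam]_z (W z)%:E = (m * beta)%:E)%E by exact: parseval.
have iW : intg Lam W by apply: ge0_intg => //; rewrite intW ltry.
have ifar : intg Lam (fun z => W z * far A r z).
  apply: le_intg iW; first by apply: measM => //; exact: measurable_far.
  move=> z; rewrite normrM !ger0_norm ?far_ge0// ler_piMr//.
  by rewrite /far; case: [forall i, _].
(* Where [far] is 0, continuity controls the difference between [f] and [tf_adj z f]; where it is 1,
   the crude bound suffices alone. *)
have pointwise z : ((analysis_seq L f)%:E <= 2%:E * analysis (tf_adj z f) +
    (2 * C * eps + C * rn f * far A r z)%:E)%E.
  have la := l2_tf_adj z lf.
  have h1 := analysis_seq_le L lf la.
  have h2 : ((analysis_seq L (tf_adj z f))%:E <= analysis (tf_adj z f))%E by exact: seq_le_esum.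
  have h3 := analysis_seq_le_rn L (l2B la lf).
  have h4 := analysis_seq_le_rn L lf.
  rewrite /far; case: (boolP [forall i, _]) => [/forallP near|_] /=.
    have h5 := ler_wpM2l C0 (hr z near).
    rewrite mulr0 addr0; apply: (@le_trans _ _ (2 * analysis_seq L (tf_adj z f) + 2 * C * eps)%:E).
      rewrite lee_fin (le_trans h1)// lerD2l -mulrA ler_wpM2l//.
      exact: le_trans h3 h5.
    by rewrite EFinD EFinM leeD2r// lee_wpmul2l// lee_fin.
  rewrite mulr1; apply: (@le_trans _ _ (2 * C * eps + C * rn f)%:E).
    by rewrite lee_fin (le_trans h4)// lerDr.
  by rewrite leeDr// mule_ge0// analysis_ge0.
have mQ := measurable_analysis_adj lf.
(* The pointwise bound is integrated against [W], of total mass [m * beta], by which the result is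
   then divided. *)
have total : ((analysis_seq L f * (m * beta))%:E <=
    2%:E * (B * (beta * rn f))%:E + (2 * C * eps * (m * beta) +
        C * rn f * (rho * (m * beta)))%:E)%E.
  apply: (@le_trans _ _ (\int[Lam]_z (2%:E * ((W z)%:E * analysis (tf_adj z f)) +
      (2 * C * eps * W z + C * rn f * (W z * far A r z))%:E))%E).
    rewrite EFinM -intW -ge0_integralZT; last 3 first.
    - exact: measEFin.
    - by move=> z; rewrite lee_fin.
    - by apply: sumr_ge0 => l _; exact: nsq_ge0.
    apply: ge0_le_integralT.
    - by apply: measurable_funeM; exact: measEFin.
    - apply: emeasurable_funD; first by apply: measurable_funeM; apply: emeasurable_funM => //;
        exact: measEFin.
      apply: measEFin; apply: measD; apply: measM => //; apply: measM => //; exact: measurable_far.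
    - move=> z; rewrite mule_ge0// lee_fin//; apply: sumr_ge0 => l _; exact: nsq_ge0.
    move=> z; rewrite muleC; apply: (le_trans (lee_wpmul2l _ (pointwise z)));
        first by rewrite lee_fin.
    rewrite ge0_muleDr; last 2 first.
    - by rewrite mule_ge0// analysis_ge0.
    - by rewrite lee_fin addr_ge0// mulr_ge0// far_ge0.
    rewrite muleCA -EFinM leeD2l// lee_fin le_eqVlt; apply/orP; left; apply/eqP; ring.
  rewrite ge0_integralDT; last 4 first.
  - by apply: measurable_funeM; apply: emeasurable_funM => //; exact: measEFin.
  - by apply: measEFin; apply: measD; apply: measM => //; apply: measM => //; exact: measurable_far.
  - by move=> z; rewrite !mule_ge0 ?analysis_ge0// lee_fin.
  - by move=> z; rewrite lee_fin addr_ge0// mulr_ge0// mulr_ge0// far_ge0.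
  apply: leeD.
    rewrite ge0_integralZT//; last 2 first.
    - by apply: emeasurable_funM => //; exact: measEFin.
    - by move=> z; rewrite !mule_ge0 ?analysis_ge0// lee_fin.
    by rewrite lee_wpmul2l.
  rewrite -EFin_Rint; last by apply: intgD; apply: intgZ.
  rewrite lee_fin RintD ?RintZ//; [|exact: intgZ..].
  have -> : \int[Lam]_z W z = m * beta by rewrite /Rintegral intW.
  rewrite lerD2l ler_wpM2l ?mulr_ge0 ?rn_ge0//.
  by move: hfar; rewrite -EFin_Rint// intW -EFinM lee_fin.
move: total; rewrite -EFinM -EFinD lee_fin => total.
have mb : 0 < m * beta by rewrite mulr_gt0.
rewrite -(ler_pM2r mb) (le_trans total)// le_eqVlt; apply/orP; left; apply/eqP.
by field; rewrite gt_eqF.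
Qed.

(** The upper bound [D] replaces the crude constant: it makes [analysis f] finite and controls, over
    the whole lattice at once, both the error for [z] near 0 and the values far away. *)
Lemma riesz_lower_frame a B f : 0 <= a -> 0 <= B -> finite_riesz a B -> l2 f ->
  ((a / (2 * m))%:E * n2 f <= analysis f)%E.
Proof.
move=> a0 B0 h lf; rewrite -EFin_rn//.
have ub f' := riesz_upper_frame B0 h (f := f').
set D := 2 * B / m in ub.
have m0 : 0 < m by exact: cell_mass_pos.
have D0 : 0 <= D by rewrite divr_ge0 ?mulr_ge0// ltW.
have [q qE q0] : exists2 q : R, analysis f = q%:E & 0 <= q.
  exists (fine (analysis f)); last exact: fine_ge0 (analysis_ge0 f).
  rewrite fineK// ge0_fin_numE ?analysis_ge0//; apply: (le_lt_trans (ub f lf)).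
  by rewrite -EFin_rn// -EFinM ltry.
rewrite qE -EFinM lee_fin.
suff step eps rho : 0 < eps -> 0 < rho ->
    a / (2 * m) * rn f <= q + D * eps + D * rn f * rho.
  apply/ler_addgt0Pl => x x0.
  pose y := x / (D + D * rn f + 1).
  have E0 : 0 < D + D * rn f + 1 by rewrite ltr_wpDl// addr_ge0// mulr_ge0// rn_ge0.
  have y0 : 0 < y by rewrite divr_gt0.
  apply: (le_trans (step y y y0 y0)).
  rewrite -addrA [x + _]addrC lerD2l -mulrDl /y mulrCA ler_piMr ?(ltW x0)//.
  by rewrite ler_pdivrMr// mul1r lerDl.
move=> e0 rho0.
have ce : 0 <= 2 * D * eps := mulr_ge0 (mulr_ge0 (ler0n R 2) D0) (ltW e0).
have [r r0 hr] := tf_adj_continuous uA lf e0.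
have [s [b [us b0 hfar]]] := concentrating_kernel uA r0 rho0.
set beta := \sum_(k <- s) nsq (b k) in b0.
have lower := trig_average_lower lf b us a0 h.
pose W z := cell z * nsq (trig s b z).
have W0 z : 0 <= W z by rewrite mulr_ge0 ?cell_ge0 ?nsq_ge0.
have mW : measurable_fun setT W.
  by apply: measM; [exact: measurable_cell|apply: cmeas_nsq; exact: cmeas_trig].
have intW : (\int[Lam]_z (W z)%:E = (m * beta)%:E)%E by exact: parseval.
have iW : intg Lam W by apply: ge0_intg => //; rewrite intW ltry.
have ifar : intg Lam (fun z => W z * far A r z).
  apply: le_intg iW; first by apply: measM => //; exact: measurable_far.
  move=> z; rewrite normrM !ger0_norm ?far_ge0// ler_piMr//.
  by rewrite /far; case: [forall i, _].
have pointwise z : (analysis (tf_adj z f) <= (2 * q + 2 * D * eps + D * rn f * far A r z)%:E)%E.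
  have la := l2_tf_adj z lf; have lb := l2B lf la.
  rewrite /far; case: (boolP [forall i, _]) => [/forallP near|_] /=.
    rewrite mulr0 addr0; apply: (le_trans (analysis_le la lf)); rewrite qE.
    have hb : (analysis (fun t => (f t - tf_adj z f t)%R) <= (D * eps)%:E)%E.
      apply: (le_trans (ub _ lb)); rewrite -EFin_rn// -EFinM lee_fin ler_wpM2l//.
      by rewrite rnC; exact: hr.
    have h2 : (0 <= 2%:E :> \bar R)%E by rewrite lee_fin.
    apply: (le_trans (leeD2l _ (lee_wpmul2l h2 hb))).
    by rewrite -!EFinM -EFinD lee_fin mulrA.
  rewrite mulr1; apply: (le_trans (ub _ la)); rewrite -EFin_rn// -EFinM lee_fin rn_tf_adj//.
  by rewrite lerDr addr_ge0// mulr_ge0.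
have mQ := measurable_analysis_adj lf.
have total : a * (beta * rn f) <= (2 * q + 2 * D * eps) * (m * beta) +
    D * rn f * (rho * (m * beta)).
  rewrite -lee_fin; apply: (le_trans lower).
  apply: (@le_trans _ _ (\int[Lam]_z ((2 * q + 2 * D * eps) * W z +
      D * rn f * (W z * far A r z))%:E)%E).
    apply: ge0_le_integralT.
    - by apply: emeasurable_funM => //; exact: measEFin.
    - by apply: measEFin; apply: measD; apply: measM => //; apply: measM => //;
        exact: measurable_far.
    - by move=> z; apply: mule_ge0; [rewrite lee_fin; exact: W0|exact: analysis_ge0].
    move=> z; apply: (le_trans (lee_wpmul2l _ (pointwise z))); first by rewrite lee_fin; exact: W0.
    rewrite -EFinM lee_fin le_eqVlt /W; apply/orP; left; apply/eqP; ring.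
  rewrite -EFin_Rint; last by apply: intgD; apply: intgZ.
  rewrite lee_fin RintD ?RintZ//; [|exact: intgZ..].
  have -> : \int[Lam]_z W z = m * beta by rewrite /Rintegral intW.
  rewrite lerD2l; apply: (ler_wpM2l (mulr_ge0 D0 (rn_ge0 lam f))).
  by move: hfar; rewrite -EFin_Rint// intW -EFinM lee_fin.
have mb : 0 < 2 * (m * beta) by rewrite !mulr_gt0.
rewrite -(ler_pM2r mb).
rewrite (_ : a / (2 * m) * rn f * (2 * (m * beta)) = a * (beta * rn f)); last by field;
    rewrite gt_eqF.
apply: (le_trans total); rewrite -subr_ge0.
rewrite (_ : _ - _ = D * rn f * (rho * (m * beta))); last by ring.
apply: (mulr_ge0 (mulr_ge0 D0 (rn_ge0 lam f))).
by rewrite !mulr_ge0// ltW.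
Qed.

End gabor_duality.

(** * Riesz sequences and dual windows *)

Section riesz_sequences.
Context {R : realType} {d : nat} {I : choiceType}.
Local Notation lam := (@lebesgue_cV R d).
Local Notation T := 'cV[R]_d.
Local Notation l2 := (l2 lam).
Local Notation n2 := (n2 lam).
Local Notation rn := (rn lam).
Local Notation ip := (ip lam).
Variables (S : set I) (e : I -> T -> R[i]).
Hypothesis le : forall i, l2 (e i).

Definition lsum (L : seq I) (c : I -> R[i]) : T -> R[i] := fun t => \sum_(i <- L) c i * e i t.

Lemma l2_lsum L c : l2 (lsum L c).
Proof. by apply: l2_sum => i; exact: l2Z. Qed.

Lemma ip_lsuml L c f : l2 f -> ip (lsum L c) f = \sum_(i <- L) c i * ip (e i) f.
Proof.
move=> lf; rewrite /lsum ip_suml//; last by move=> i; exact: l2Z.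
by apply: eq_bigr => i _; rewrite ipZl.
Qed.

Lemma ip_lsumr L c f : l2 f -> ip f (lsum L c) = \sum_(i <- L) conjc (c i) * ip f (e i).
Proof.
move=> lf; rewrite /lsum ip_sumr//; last by move=> i; exact: l2Z.
by apply: eq_bigr => i _; rewrite ipZr.
Qed.

Definition l2sq (L : seq I) (c : I -> R[i]) : R := \sum_(i <- L) nsq (c i).

Lemma l2sq_ge0 L c : 0 <= l2sq L c.
Proof. by apply: sumr_ge0 => i _; exact: nsq_ge0. Qed.

Definition synthesis_bound (b : R) : Prop := forall L c, uniq L -> {in L, forall i, S i} ->
  rn (lsum L c) <= b * l2sq L c.

Definition synthesis_lower (a : R) : Prop := forall L c, uniq L -> {in L, forall i, S i} ->
  a * l2sq L c <= rn (lsum L c).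

Lemma frame_upperE B : frame_upper S e B <->
  forall f, l2 f -> (\esum_(i in S) (nsq (ip f (e i)))%:E <= B%:E * n2 f)%E.
Proof.
have E f : (\esum_(i in S) ((Normc.normc (L2inner f (e i)) ^+ 2)%R)%:E =
    \esum_(i in S) (nsq (ip f (e i)))%:E)%E.
  by apply: eq_esum => i _; rewrite normc_sqr.
split=> h f /L2P lf; first by have := h f lf; rewrite E L2norm_sqr.
by rewrite E L2norm_sqr; exact: h.
Qed.

Lemma frame_lowerE B : frame_lower S e B <->
  forall f, l2 f -> (B%:E * n2 f <= \esum_(i in S) (nsq (ip f (e i)))%:E)%E.
Proof.
have E f : (\esum_(i in S) ((Normc.normc (L2inner f (e i)) ^+ 2)%R)%:E =
    \esum_(i in S) (nsq (ip f (e i)))%:E)%E.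
  by apply: eq_esum => i _; rewrite normc_sqr.
split=> h f /L2P lf; first by have := h f lf; rewrite E L2norm_sqr.
by rewrite E L2norm_sqr; exact: h.
Qed.

Lemma bessel_finite B f L : frame_upper S e B -> l2 f -> uniq L -> {in L, forall i, S i} ->
  \sum_(i <- L) nsq (ip f (e i)) <= B * rn f.
Proof.
move=> /frame_upperE h lf uL LS; rewrite -lee_fin EFinM EFin_rn//.
by apply: le_trans (h f lf); exact: seq_le_esum.
Qed.

Lemma finite_bessel B : (forall f L, l2 f -> uniq L -> {in L, forall i, S i} ->
  \sum_(i <- L) nsq (ip f (e i)) <= B * rn f) -> frame_upper S e B.
Proof.
move=> h; apply/frame_upperE => f lf; apply: esum_le_seq => L uL LS.
by rewrite -EFin_rn// -EFinM lee_fin h.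
Qed.

Let cancel_sq (x y : R) : 0 <= x -> 0 <= y -> x ^+ 2 <= y * x -> x <= y.
Proof.
move=> x0 y0; have [->//|xn0] := eqVneq x 0.
by rewrite expr2 ler_pM2r// lt_def xn0.
Qed.

(** Expanding one factor of [ip x x] for [x = lsum L c], Cauchy-Schwarz and the Bessel bound give
    [(rn x)^2 <= l2sq L c * B * rn x]; then cancel [rn x]. *)
Lemma bessel_synthesis B : 0 <= B -> frame_upper S e B -> synthesis_bound B.
Proof.
move=> B0 hB L c uL LS; have ls := l2_lsum L c.
apply: cancel_sq; rewrite ?rn_ge0 ?mulr_ge0 ?l2sq_ge0//.
have := cauchy_schwarz_sum L c (fun i => ip (e i) (lsum L c)).
rewrite -ip_lsuml// ip_self// nsqR => h; apply: (le_trans h).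
rewrite [B * _]mulrC -mulrA ler_wpM2l ?l2sq_ge0//.
apply: le_trans (bessel_finite hB ls uL LS).
by apply: ler_sum => i _; rewrite -nsqJ ipJ.
Qed.

(** The dual computation: with coefficients [c i = ip f (e i)], pairing [f] with [lsum L c] returns
    [l2sq L c]. *)
Lemma synthesis_bessel B : 0 <= B -> synthesis_bound B -> frame_upper S e B.
Proof.
move=> B0 hB; apply: finite_bessel => f L lf uL LS.
pose c i := ip f (e i); have lc := l2_lsum L c.
apply: cancel_sq; rewrite ?mulr_ge0 ?rn_ge0 ?(l2sq_ge0 L c)//.
have := cauchy_schwarz lf lc; rewrite ip_lsumr//.
have -> : \sum_(i <- L) conjc (c i) * ip f (e i) = (l2sq L c)%:C%C.
  rewrite /l2sq rmorph_sum; apply: eq_bigr => i _.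
  by rewrite mulrC -/(c i) mulJ.
rewrite nsqR => h; apply: (le_trans h); rewrite [B * _]mulrC -mulrA ler_wpM2l ?rn_ge0//.
exact: hB.
Qed.

Lemma lsum_split (L G : seq I) (V : nmodType) (F : I -> V) : uniq L -> uniq G -> {subset L <= G} ->
  \sum_(i <- G) F i = \sum_(i <- L) F i + \sum_(i <- [seq i <- G | i \notin L]) F i.
Proof.
move=> uL uG LG; have p : perm_eq [seq i <- G | i \in L] L.
  apply: uniq_perm => //; first exact: filter_uniq.
  by move=> i; rewrite mem_filter; apply/andP/idP => [[]//|iL]; split => //; exact: LG.
by rewrite -(perm_big _ p) !big_filter; exact: bigID.
Qed.

Lemma rnB_le2 f g : l2 f -> l2 g -> rn (fun t => f t - g t) <= 2 * rn f + 2 * rn g.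
Proof.
by move=> lf lg; have := rnD_le ltr01 lf (l2N lg); rewrite invr1 rnN.
Qed.

Lemma rn_le2 f g : l2 f -> l2 g -> rn f <= 2 * rn g + 2 * rn (fun t => f t - g t).
Proof.
move=> lf lg; have := rnD_le ltr01 lg (l2B lf lg); rewrite invr1.
by under [X in rn X]funext do rewrite addrC subrK.
Qed.

Lemma lsumB (L G : seq I) c : uniq L -> uniq G -> {subset L <= G} ->
  (fun t => lsum G c t - lsum L c t) = lsum [seq i <- G | i \notin L] c.
Proof. by move=> uL uG LG; apply/funext => t; rewrite /lsum (lsum_split _ uL uG LG)
    addrAC subrr add0r. Qed.

Lemma L2norm_small (f : T -> R[i]) (x : R) : l2 f -> 0 <= x -> rn f <= x ^+ 2 ->
  (L2norm f <= x%:E)%E.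
Proof.
move=> lf x0; rewrite -lee_fin EFin_rn// -L2norm_sqr; have : (0 <= L2norm f)%E by exact: Lnorm_ge0.
case: (L2norm f) => [r||]//.
  by rewrite !lee_fin => r0; rewrite ler_sqr ?nnegrE.
Qed.

(** The sum of the series is built by completeness: what lies outside a finite set carrying almost
    all of the [l^2] mass has small norm by the synthesis bound. The limit is reached through
    [|x + y|^2 <= 2 |x|^2 + 2 |y|^2], hence the constants [a / 2] and [2 * b]. *)
Lemma finite_bounds_riesz a b : 0 < a -> 0 < b -> synthesis_lower a -> synthesis_bound b ->
  is_riesz_sequence S e.
Proof.
move=> a0 b0 ha hb; exists (a / 2), (2 * b).
split; [exact: divr_gt0|exact: mulr_gt0|move=> c cy].
have cE : (l2normsq S c = \esum_(i in S) (nsq (c i))%:E)%E.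
  by apply: eq_esum => i _; rewrite normc_sqr.
have c0 : (0 <= l2normsq S c)%E by rewrite cE; apply: esum_ge0 => i _; rewrite lee_fin nsq_ge0.
pose l := fine (l2normsq S c).
have lE : (l%:E = l2normsq S c)%E by rewrite /l fineK// ge0_fin_numE.
have finite_le L : uniq L -> {in L, forall i, S i} -> l2sq L c <= l.
  by move=> uL LS; rewrite -lee_fin lE cE; exact: seq_le_esum.
(* [F n] carries all but [1 / (n + 1)] of the squared norm of [c]. *)
have /choice[F hF] (n : nat) : exists L, [/\ uniq L, {in L, forall i, S i} & l - n.+1%:R^-1 <=
    l2sq L c].
  apply: contrapT => hn; have : (l%:E <= (l - n.+1%:R^-1)%:E)%E.
    rewrite lE cE; apply: esum_le_seq => L uL LS; rewrite lee_fin leNgt; apply/negP => h.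
    by apply: hn; exists L; split => //; exact: ltW.
  by rewrite lee_fin leNgt ltrBlDr ltrDl invr_gt0 ltr0n.
have uF n : uniq (F n) by have [] := hF n.
have SF n : {in F n, forall i, S i} by have [] := hF n.
have lF n : l - n.+1%:R^-1 <= l2sq (F n) c by have [] := hF n.
have tail n G : uniq G -> {in G, forall i, S i} -> {subset F n <= G} ->
    rn (fun t => lsum G c t - lsum (F n) c t) <= b * n.+1%:R^-1.
  move=> uG GS FG; rewrite lsumB//; set H := [seq i <- G | _].
  have uH : uniq H by exact: filter_uniq.
  have HS : {in H, forall i, S i} by move=> i; rewrite mem_filter => /andP[_]; exact: GS.
  apply: (le_trans (hb H c uH HS)); rewrite ler_pM2l//.
  have := finite_le G uG GS; rewrite /l2sq (lsum_split _ (uF n) uG FG) => h1.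
  have := lF n; rewrite /l2sq => h2.
  by rewrite -/H in h1; move: h1 h2; set x := n.+1%:R^-1; move: x => x; lra.
have small (x : R) : 0 < x -> exists K : nat, forall n, (K <= n)%N -> b * n.+1%:R^-1 <= x /\
    n.+1%:R^-1 <= x.
  move=> x0; have x1 : 0 < x / (b + 1) by rewrite divr_gt0// addr_gt0.
  have [K _ hK] := cvgr_lt _ (@cvg_harmonic R) _ x1.
  exists K => n Kn; have := hK n Kn; rewrite /= ltr_pdivlMr ?addr_gt0// => h1.
  have : 0 < n.+1%:R^-1 :> R by [].
  by move: h1; set y := n.+1%:R^-1; move: y => y h1 y0; split; nra.
have cauchy m n : rn (fun t => lsum (F m) c t - lsum (F n) c t) <= 2 * (b * m.+1%:R^-1) +
    2 * (b * n.+1%:R^-1).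
  (* The sets [F m] and [F n] need not be nested, so both sums are compared with the one over their
     union. *)
  pose U := undup (F m ++ F n).
  have uU : uniq U by exact: undup_uniq.
  have US : {in U, forall i, S i} by move=> i; rewrite mem_undup mem_cat => /orP[]; exact: SF.
  have mU : {subset F m <= U} by move=> i im; rewrite mem_undup mem_cat im.
  have nU : {subset F n <= U} by move=> i im; rewrite mem_undup mem_cat im orbT.
  have -> : (fun t => lsum (F m) c t - lsum (F n) c t) =
      fun t => (lsum U c t - lsum (F n) c t) - (lsum U c t - lsum (F m) c t).
    by apply/funext => t; ring.
  have lU k : l2 (fun t => lsum U c t - lsum (F k) c t) by apply: l2B; exact: l2_lsum.
  apply: (le_trans (rnB_le2 (lU n) (lU m))).
  by rewrite addrC lerD// ler_pM2l// tail.
have [h lh hh] : exists2 h, l2 h & forall x, 0 < x -> exists K, forall n, (K <= n)%N ->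
    rn (fun t => lsum (F n) c t - h t) <= x.
  apply: l2_complete; first by move=> k; exact: l2_lsum.
  move=> x x0; have [K hK] := small _ (divr_gt0 x0 (ltr0n R 4)).
  exists K => m n Km Kn; apply: (le_trans (cauchy m n)).
  move: (hK _ Km).1 (hK _ Kn).1; set p := b * _; set q := b * _; move: p q => p q; lra.
have both (x : R) : 0 < x -> exists n, [/\ rn (fun t => lsum (F n) c t - h t) <= x,
    b * n.+1%:R^-1 <= x & n.+1%:R^-1 <= x].
  move=> x0; have [K1 h1] := hh _ x0; have [K2 h2] := small _ x0.
  exists (maxn K1 K2); have [] := h2 _ (leq_maxr K1 K2); split => //.
  exact: h1 (leq_maxl _ _).
exists h; split; first exact/L2P.
- have lS (G : {fset I}) : l2 (fun t => h t - \sum_(i <- G | i \in S) c i * e i t).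
    by apply: l2B => //; apply: l2_sum => i; exact: l2Z.
  have FF : ProperFilter (@totally I) := totally_filter.
  rewrite /L2sum; apply/(@fine_cvgP _ _ (@totally I) _ _ 0); split.
    apply: nearW => G; rewrite ge0_fin_numE ?Lnorm_ge0//.
    have [_ _] := (L2P _).2 (lS G); exact.
  (* The squared norm will be bounded by twice the sum of two terms, each at most [x^2 / 4]. *)
  apply/cvgrPdist_le => x x0; have [n [n1 n2' _]] := both _ (divr_gt0 (exprn_gt0 2 x0) (ltr0n R 4)).
  exists [fset i in F n]%fset => // G /= FG.
  rewrite sub0r normrN ger0_norm; last by rewrite fine_ge0// Lnorm_ge0.
  rewrite -lee_fin fineK; last first.
    by rewrite ge0_fin_numE ?Lnorm_ge0//; have [_ _] := (L2P _).2 (lS G); exact.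
  apply: (L2norm_small (lS G)); first exact: ltW.
  pose H := [seq i <- G | i \in S].
  have uH : uniq H by rewrite filter_uniq// fset_uniq.
  have HS : {in H, forall i, S i} by move=> i; rewrite mem_filter => /andP[/set_mem].
  have FH : {subset F n <= H}.
    move=> i iF; rewrite mem_filter; apply/andP; split; first by apply/mem_set; exact: SF iF.
    by have /fsubsetP := FG; apply; rewrite !inE.
  have -> : (fun t => h t - \sum_(i <- G | i \in S) c i * e i t) =
     fun t => (h t - lsum (F n) c t) - (lsum H c t - lsum (F n) c t).
    by apply/funext => t; rewrite -big_filter -/H /lsum; ring.
  have l1 : l2 (fun t => h t - lsum (F n) c t) by apply: l2B => //; exact: l2_lsum.
  have l3 : l2 (fun t => lsum H c t - lsum (F n) c t) by apply: l2B; exact: l2_lsum.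
  apply: (le_trans (rnB_le2 l1 l3)); rewrite rnC.
  move: (tail n H uH HS FH) n1 n2'; set p := b * _; move: p => p.
  move: (rn _) (rn _) => y z; lra.
- rewrite -lE L2norm_sqr -EFin_rn// -EFinM lee_fin.
  suff : a * l <= 2 * rn h by lra.
  apply/ler_addgt0Pl => x x0.
  have x1 : 0 < x / (a + 2) by rewrite divr_gt0// addr_gt0.
  have [n [h1 _ h3]] := both _ x1.
  have h4 := ha (F n) c (uF n) (SF n).
  have h5 := rn_le2 (l2_lsum (F n) c) lh.
  have h6 : a * (l - n.+1%:R^-1) <= a * l2sq (F n) c by rewrite ler_pM2l.
  have h7 : a * n.+1%:R^-1 <= a * (x / (a + 2)) by rewrite ler_pM2l.
  have h8 : a * (x / (a + 2)) + 2 * (x / (a + 2)) = x by field; rewrite gt_eqF// addr_gt0.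
  move: h1 h5 h6 h7 h8; rewrite mulrBr; set y := n.+1%:R^-1; set z := x / _; move: y z => y z.
  lra.
- rewrite -lE L2norm_sqr -EFin_rn// -EFinM lee_fin.
  apply/ler_addgt0Pl => x x0.
  have [n [h1 _ _]] := both _ (divr_gt0 x0 (ltr0n R 2)).
  have h4 := hb (F n) c (uF n) (SF n).
  have h5 := rn_le2 lh (l2_lsum (F n) c).
  have h6 : b * l2sq (F n) c <= b * l by rewrite ler_pM2l// finite_le.
  move: h1; rewrite rnC; lra.
Qed.

(** With the coefficients set to zero outside [L], the net of partial sums is eventually the finite
    sum itself. The sum [s] granted by the definition thus differs from it by a function of norm
    zero and has the same norm. *)
Lemma riesz_finite_bounds : is_riesz_sequence S e ->
  exists a b, [/\ 0 < a, 0 < b, synthesis_lower a & synthesis_bound b].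
Proof.
move=> [a [b [a0 b0 H]]]; exists a, b.
suff key L c : uniq L -> {in L, forall i, S i} -> a * l2sq L c <= rn (lsum L c) <= b * l2sq L c.
  by split=> // L c uL LS; have /andP[] := key L c uL LS.
move=> uL LS; pose c' i := if i \in L then c i else 0.
have cE : (l2normsq S c' = (l2sq L c)%:E)%E.
  have E : l2sq L c = \sum_(i <- L) nsq (c' i).
    by apply: eq_big_seq => i iL; rewrite /c' iL.
  have -> : (l2normsq S c' = \esum_(i in S) (nsq (c' i))%:E)%E.
    by apply: eq_esum => i _; rewrite normc_sqr.
  apply/eqP; rewrite eq_le; apply/andP; split; last by rewrite E; exact: seq_le_esum.
  apply: esum_le_seq => G uG GS; rewrite lee_fin.
  rewrite (bigID (mem L)) /= [X in _ + X]big1 ?addr0; last first.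
    by move=> i /negbTE iL; rewrite /c' iL nsq0.
  have uU := undup_uniq (L ++ G).
  pose U := undup (L ++ G).
  apply: (@le_trans _ _ (\sum_(i <- L) nsq (c' i))); last by rewrite E.
  rewrite [leRHS](lsum_split (L := [seq i <- G | i \in L]) _ _ uL); last 2 first.
  - exact: filter_uniq.
  - by move=> i; rewrite mem_filter => /andP[].
  by rewrite big_filter lerDl sumr_ge0// => i _; exact: nsq_ge0.
have [s [/L2P ls sumE lo up]] := H c' (eq_ind_r (fun x => (x < +oo)%E) (ltry _) cE).
have lL := l2_lsum L c.
have near_eq : totally (fun G : {fset I} => L2norm (fun t => s t - \sum_(i <- G |
    i \in S) c' i * e i t) =
    L2norm (fun t => s t - lsum L c t)).
  exists [fset i in L]%fset => // G /= LG; congr L2norm; apply/funext => t; congr (_ - _).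
  rewrite (bigID (mem L)) /= [X in _ + X]big1 ?addr0; last first.
    by move=> i /andP[_ /negbTE iL]; rewrite /c' iL mul0r.
  rewrite (eq_bigl (mem L)); last first.
    move=> i /=; case: (boolP (i \in L)) => iL; rewrite ?andbF// andbT.
    by apply/mem_set; exact: LS.
  rewrite (eq_bigr (fun i => c i * e i t)); last by move=> i /= iL; rewrite /c' iL.
  rewrite -big_filter /lsum; apply: perm_big; apply: uniq_perm => //.
    by rewrite filter_uniq// fset_uniq.
  move=> i; rewrite mem_filter; apply/andP/idP => [[]//|iL]; split => //.
  by have /fsubsetP := LG; apply; rewrite !inE.
have d0 : L2norm (fun t => s t - lsum L c t) = 0%E.
  have FF : ProperFilter (@totally I) := totally_filter.
  have c1 := cvg_near_cst _ near_eq.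
  by apply: (cvg_unique (@ereal_hausdorff R) (c1 _)); exact: sumE.
have r0 : rn (fun t => s t - lsum L c t) = 0.
  by rewrite /rn -L2norm_sqr d0 expe2 mule0.
have ld := l2B ls lL.
have ip0 : ip s (fun t => s t - lsum L c t) = 0.
  apply: nsq_eq0; apply/eqP; rewrite eq_le nsq_ge0 andbT.
  by apply: (le_trans (cauchy_schwarz ls ld)); rewrite r0 mulr0.
have rE : rn (lsum L c) = rn s.
  have -> : lsum L c = fun t => s t - (s t - lsum L c t).
    by apply/funext => t; rewrite opprB addrC subrK.
  by rewrite rnB// ip0 r0 mulr0 subr0 addr0.
rewrite rE; move: lo up; rewrite cE L2norm_sqr -EFin_rn// -!EFinM !lee_fin => lo up.
by rewrite lo.
Qed.

End riesz_sequences.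

(** * Spans and projections onto their closures *)

Section span.
Context {R : realType} {d : nat} {I : choiceType}.
Local Notation lam := (@lebesgue_cV R d).
Local Notation T := 'cV[R]_d.
Local Notation l2 := (l2 lam).
Local Notation rn := (rn lam).
Local Notation ip := (ip lam).
Variables (e : I -> T -> R[i]).
Hypothesis le : forall i, l2 (e i).

(** Lists with possible repetitions make closure under addition mere concatenation; [span_lsum]
    merges the repeated indices afterwards. *)
Definition span (P : I -> Prop) (v : T -> R[i]) : Prop := exists2 l : seq (I * R[i]),
  (forall p, p \in l -> P p.1) & v = fun t => \sum_(p <- l) p.2 * e p.1 t.

Lemma l2_span P v : span P v -> l2 v.
Proof. by move=> [l _ ->]; apply: l2_sum => p; exact: l2Z. Qed.

Lemma span0 P : span P (fun=> 0).
Proof. by exists [::] => //; apply/funext => t; rewrite big_nil. Qed.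

Lemma spanD P u v : span P u -> span P v -> span P (fun t => u t + v t).
Proof.
move=> [l hl ->] [k hk ->]; exists (l ++ k) => [p|]; last by apply/funext => t; rewrite big_cat.
by rewrite mem_cat => /orP[]; [exact: hl|exact: hk].
Qed.

Lemma spanZ P c u : span P u -> span P (fun t => c * u t).
Proof.
move=> [l hl ->]; exists [seq (p.1, c * p.2) | p <- l].
  by move=> p /mapP [q ql ->]; exact: (hl q).
by apply/funext => t; rewrite big_map mulr_sumr; apply: eq_bigr => p _; rewrite mulrA.
Qed.

Lemma span_mem (P : I -> Prop) i : P i -> span P (e i).
Proof.
move=> Pi; exists [:: (i, 1)] => [p|]; first by rewrite inE => /eqP ->.
by apply/funext => t; rewrite big_seq1 mul1r.
Qed.

Lemma span_lsum P v : span P v -> exists L c,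
  [/\ uniq L, {in L, forall i, P i} & v = lsum e L c].
Proof.
move=> [l hl ->]; exists (undup [seq p.1 | p <- l]), (fun i => \sum_(p <- l | p.1 == i) p.2).
split; first exact: undup_uniq.
  by move=> i; rewrite mem_undup => /mapP[p pl ->]; exact: hl.
apply/funext => t; rewrite /lsum; under [RHS]eq_bigr do rewrite mulr_suml.
rewrite (exchange_big_dep predT)//=; apply: eq_big_seq => p pl.
rewrite -big_filter (eq_filter (a2 := pred1 p.1)); last by move=> k /=; rewrite eq_sym.
rewrite filter_pred1_uniq ?undup_uniq//; first by rewrite big_seq1.
by rewrite mem_undup map_f.
Qed.

Lemma span_projection P f : l2 f -> exists p, [/\ l2 p,
  (forall v, span P v -> ip (fun t => f t - p t) v = 0) &
  forall x, 0 < x -> exists2 q, span P q & rn (fun t => q t - p t) <= x].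
Proof.
move=> lf; have [p [lp op [q sq hq]]] := projection lf (@l2_span P) (span0 P) (@spanD P) (@spanZ P).
exists p; split => // x x0; have [K hK] := hq x x0.
by exists (q K) => //; exact: hK.
Qed.

Lemma orthogonal_limit f v : l2 f -> l2 v ->
  (forall x, 0 < x -> exists2 q, l2 q & ip f q = 0 /\ rn (fun t => q t - v t) <= x) -> ip f v = 0.
Proof.
move=> lf lv h; apply: (@nsq_eq0_small _ _ (rn f)) => x x0.
have [q lq [h0 h1]] := h x x0.
have -> : ip f v = ip f (fun t => v t - q t) by rewrite ipBr// h0 subr0.
apply: (le_trans (cauchy_schwarz lf (l2B lv lq))).
by rewrite ler_wpM2l ?rn_ge0// rnC.
Qed.

End span.

(** * Biorthogonal dual windows *)

Section dual_window.
Context {R : realType} {d : nat} (A : 'M[R]_(d + d)).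
Hypothesis uA : A \in unitmx.
Local Notation Z := 'cV[R]_(d + d).
Local Notation T := 'cV[R]_d.
Local Notation lam := (@lebesgue_cV R d).
Local Notation l2 := (l2 lam).
Local Notation rn := (rn lam).
Local Notation ip := (ip lam).
Local Notation S := (adjoint_lattice A).
Variable g : T -> R[i].
Hypothesis lg : l2 g.

Let lgab z : l2 (gabor g z). Proof. exact: l2_tf_shift. Qed.

Let S0 : S 0. Proof. by exists 0; rewrite ?map_mx0 ?mulmx0. Qed.
Let SD z w : S z -> S w -> S (z + w).
Proof. by move=> [k _ <-] [l _ <-]; exists (k + l) => //; rewrite map_mxD mulmxDr. Qed.
Let SN z : S z -> S (- z).
Proof. by move=> [k _ <-]; exists (- k) => //; rewrite map_mxN mulmxN. Qed.

Let vol := lattice_vol A.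

Let vol_gt0 : 0 < vol.
Proof. by rewrite /vol /lattice_vol normr_gt0 -unitfE -unitmxE. Qed.

Definition biorthogonal (gamma : T -> R[i]) : Prop := forall mu, S mu ->
  ip gamma (tf_shift mu g) = vol%:C%C *+ (mu == 0).

(** The adjoint of [pi(nu)] composed with [pi(mu)] is a phase times [pi(mu - nu)]. The phase
    multiplies 0 unless [mu = nu], when the composition is the identity. *)
Lemma biorthogonal_shift gamma mu nu : l2 gamma -> biorthogonal gamma -> S mu -> S nu ->
  ip (tf_shift nu gamma) (tf_shift mu g) = vol%:C%C *+ (mu == nu).
Proof.
move=> lga bi Smu Snu; rewrite ip_tf_shift_adj//; last exact: l2_tf_shift.
have [->|mn] := eqVneq mu nu.
  by rewrite tf_shiftK -[X in ip _ X](tf_shift0 g) bi// eqxx.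
have -> : tf_adj nu (tf_shift mu g) = fun t =>
    (expi2pi (- dot (dsubmx nu) (usubmx nu)) * expi2pi (- dot (dsubmx mu) (usubmx (- nu))))
        * tf_shift (- nu + mu) g t.
  by apply/funext => t; rewrite /tf_adj tf_shiftM mulrA.
rewrite ipZr//; last exact: l2_tf_shift.
rewrite bi; last by apply: SD => //; exact: SN.
by rewrite addrC subr_eq0 (negbTE mn) mulr0n mulr0.
Qed.

Lemma ip_lsum_biorthogonal gamma L c nu : l2 gamma -> biorthogonal gamma ->
  uniq L -> {in L, forall i, S i} -> S nu ->
  ip (lsum (gabor g) L c) (tf_shift nu gamma) = if nu \in L then c nu * vol%:C%C else 0.
Proof.
move=> lga bi uL LS Snu; have lt := l2_tf_shift nu lga.
rewrite ip_lsuml//.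
have E mu : mu \in L -> c mu * ip (gabor g mu) (tf_shift nu gamma) =
    if mu == nu then c mu * vol%:C%C else 0.
  move=> muL; rewrite -ipJ//.
  rewrite biorthogonal_shift//; last exact: LS.
  case: eqVneq => _; rewrite ?mulr1n ?mulr0n ?conjc0 ?mulr0//.
  by rewrite conjc_real.
rewrite (eq_big_seq _ E); case: ifPn => nuL.
  rewrite (bigD1_seq nu)//= eqxx big1 ?addr0// => i /negbTE ->; by [].
rewrite big1_seq// => i /= iL; case: eqVneq => // h.
by move: nuL; rewrite -h iL.
Qed.

(** Pairing a finite sum with [pi(nu) gamma] returns its coefficient times the volume, so the Bessel
    bound [C] reads [vol^2 sum |c_nu|^2 <= C |sum|^2]. *)
Lemma dual_window_bounds gamma B C : l2 gamma -> biorthogonal gamma -> 0 < B -> 0 < C ->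
  frame_upper S (gabor g) B -> frame_upper S (gabor gamma) C ->
  synthesis_lower S (gabor g) (vol ^+ 2 / C) /\ synthesis_bound S (gabor g) B.
Proof.
move=> lga bi B0 C0 hB hC; split; last exact: bessel_synthesis (ltW B0) hB.
move=> L c uL LS; rewrite mulrAC ler_pdivrMr// [leRHS]mulrC.
have lgam z : l2 (gabor gamma z) by exact: l2_tf_shift.
apply: le_trans (bessel_finite hC (l2_lsum lgab L c) uL LS).
rewrite /l2sq mulr_sumr big_seq [leRHS]big_seq; apply: ler_sum => nu nuL.
by rewrite ip_lsum_biorthogonal ?nuL//; [rewrite nsqM nsqR mulrC|exact: LS].
Qed.

(** [g0] is [g] minus its projection [p] on the closed span of the other shifts. The last conclusion
    records that [gamma] lies in the closed span of the whole family, which its Bessel bound relies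
    on. *)
Lemma exists_biorthogonal a : 0 < a -> synthesis_lower S (gabor g) a ->
  exists gamma, [/\ l2 gamma, biorthogonal gamma &
    forall x, 0 < x -> exists2 q, span (gabor g) S q & rn (fun t => q t - gamma t) <= x].
Proof.
move=> a0 ha; pose P z := S z /\ z <> 0.
have [p [lp op hp]] := span_projection lgab P lg.
pose g0 t := g t - p t; have lg0 : l2 g0 by exact: l2B.
have og (mu : Z) : S mu -> mu != 0 -> ip g0 (tf_shift mu g) = 0.
  by move=> Smu /eqP mu0; apply: op; exact: (@span_mem _ _ _ (gabor g) P mu).
have gP : gabor g 0 = g by exact: tf_shift0.
(* For [q] in the span of the other shifts, [g - q] has coefficient 1 at the origin, hence squared
   norm at least [a]; with [q] within [a / 4] of [p] this gives [a <= 2 * rn g0 + a / 2]. *)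
have n0 : 0 < rn g0.
  rewrite -(pmulr_rgt0 _ (ltr0n R 2)); apply: (@lt_le_trans _ _ (a / 2)); first by rewrite divr_gt0.
  have [q sq hq] := hp (a / 4) (divr_gt0 a0 (ltr0n R 4)).
  have [L [c [uL LP qE]]] := span_lsum sq.
  have L0 : 0 \notin L by apply/negP => /LP[_]; exact.
  pose c' z := if z == 0 then 1 else - c z.
  have E : (fun t => g t - q t) = lsum (gabor g) (0 :: L) c'.
    apply/funext => t; rewrite qE /lsum big_cons /c' eqxx mul1r gP -sumrN; congr (_ + _).
    apply: eq_big_seq => z zL; case: eqVneq => [z0|_]; first by move: L0; rewrite -z0 zL.
    by rewrite mulNr.
  have h1 : a <= rn (fun t => g t - q t).
    rewrite E; apply: (le_trans _ (ha (0 :: L) c' _ _)).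
    - rewrite /l2sq big_cons {1}/c' eqxx (nsq_nat 1) expr1n mulrDr mulr1 lerDl mulr_ge0 ?(ltW a0)//.
      by apply: sumr_ge0 => z _; exact: nsq_ge0.
    - by rewrite /= L0.
    - by move=> z; rewrite inE => /orP[/eqP ->|/LP[]].
  have lq := l2_span lgab sq.
  have h2 := rnB_le2 lg0 (l2B lq lp).
  have e1 : (fun t => g0 t - (q t - p t)) = fun t => g t - q t.
    by apply/funext => t; rewrite /g0; ring.
  rewrite e1 in h2; lra.
have ipg : ip g0 g = (rn g0)%:C%C.
  have ip0 : ip g0 p = 0.
    apply: orthogonal_limit => // x x0; have [q sq hq] := hp x x0.
    by exists q; [exact: l2_span sq|split => //; exact: op].
  rewrite -ip_self// -[LHS]subr0 -[X in _ - X]ip0 -ipBr//.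
(* Since [ip g0 g] equals [rn g0], this factor gives the inner product with [g] the value [vol]. *)
pose k : R := vol / rn g0.
exists (fun t => k%:C%C * g0 t); split; first exact: l2Z.
  move=> mu Smu; rewrite ipZl//; last exact: l2_tf_shift.
  have [->|mu0] := eqVneq mu 0.
    by rewrite tf_shift0 ipg -rmorphM /k mulfVK ?gt_eqF.
  by rewrite og// mulr0.
move=> x x0; have k0 : 0 < k by rewrite divr_gt0.
have [q sq hq] := hp (x / k ^+ 2) (divr_gt0 x0 (exprn_gt0 2 k0)).
exists (fun t => k%:C%C * (g t - q t)).
  apply: spanZ; rewrite (_ : (fun t => _) = (fun t => g t + (-1) * q t)); last first.
    by apply/funext => t; rewrite mulN1r.
  apply: spanD; first by rewrite -[X in span _ _ X]gP; exact: span_mem.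
  by apply: spanZ; have [l hl ->] := sq; exists l => // r /hl[].
have -> : (fun t => k%:C%C * (g t - q t) - k%:C%C * g0 t) = fun t => - (k%:C%C * (q t - p t)).
  by apply/funext => t; rewrite /g0; ring.
have lq := l2_span lgab sq; have lqp := l2B lq lp.
rewrite rnN; last exact: l2Z.
rewrite rnZ// nsqR; apply: (le_trans (ler_wpM2l (sqr_ge0 k) hq)).
by rewrite mulrC divfK// expf_neq0// gt_eqF.
Qed.

(** The adjoint lattice is a group and the phases go into the coefficients, so the span is
    invariant; hence every [pi(nu) gamma] lies in its closure along with [gamma]. *)
Lemma span_shift nu q : S nu -> span (gabor g) S q -> span (gabor g) S (tf_shift nu q).
Proof.
move=> Snu [l hl ->].
exists [seq (nu + p.1, p.2 * expi2pi (- dot (dsubmx p.1) (usubmx nu))) | p <- l].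
  by move=> p /mapP[r rl ->]; apply: SD => //; exact: hl.
rewrite tf_shift_sum; apply/funext => t; rewrite big_map; apply: eq_bigr => p _.
by rewrite tf_shiftZ tf_shiftM mulrA.
Qed.

(** The part of [f] orthogonal to the closed span of the shifts of [g] is orthogonal to all shifts
    of [gamma]. On the span, biorthogonality reads off the coefficients and the lower bound controls
    them, giving [vol^2 / a]; approximating the projection [q] by an element [w] of the span costs a
    factor 2 twice. *)
Lemma biorthogonal_bessel a gamma : 0 < a -> synthesis_lower S (gabor g) a ->
  l2 gamma -> biorthogonal gamma ->
  (forall x, 0 < x -> exists2 q, span (gabor g) S q & rn (fun t => q t - gamma t) <= x) ->
  frame_upper S (gabor gamma) (4 * vol ^+ 2 / a).
Proof.
move=> a0 ha lga bi happ; have lgam z : l2 (gabor gamma z) by exact: l2_tf_shift.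
apply: finite_bessel => f L lf uL LS.
have [q [lq oq hq]] := span_projection lgab S lf.
have lfq : l2 (fun t => f t - q t) by exact: l2B.
have ofq nu : S nu -> ip (fun t => f t - q t) (gabor gamma nu) = 0.
  move=> Snu; apply: orthogonal_limit => // x x0; have [w sw hw] := happ x x0.
  have lw := l2_span lgab sw.
  exists (tf_shift nu w); first exact: l2_tf_shift.
  split; first by apply: oq; exact: span_shift.
  by rewrite -tf_shiftB rn_tf_shift//; exact: l2B.
have ipf nu : S nu -> ip f (gabor gamma nu) = ip q (gabor gamma nu).
  by move=> Snu; apply/eqP; rewrite -subr_eq0 -ipBl// ofq.
have qf : rn q <= rn f.
  have o : ip (fun t => f t - q t) q = 0.
    apply: orthogonal_limit => // x x0; have [w sw hw] := hq x x0.
    by exists w; [exact: l2_span sw|split => //; exact: oq].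
  have := rnD lfq lq; rewrite o mulr0 addr0; under [X in rn X]funext do rewrite subrK.
  by have := rn_ge0 lam (fun t => f t - q t); lra.
set D := 4 * vol ^+ 2 / a.
(* [E] collects the factors of the approximation error [rn (q - w)]: [D] from replacing [rn w] by
   [rn q], and the Cauchy-Schwarz constant of the finite sum over [L]. *)
pose E := D + 2 * (size L)%:R * rn gamma.
apply/ler_addgt0Pl => x x0.
have D0 : 0 <= D by rewrite divr_ge0 ?mulr_ge0 ?sqr_ge0// ltW.
have E0 : 0 <= 2 * (size L)%:R * rn gamma by rewrite !mulr_ge0 ?rn_ge0.
have [w sw hw] := hq (x / (E + 1)) (divr_gt0 x0 (ltr_wpDl (addr_ge0 D0 E0) ltr01)).
have lw := l2_span lgab sw.
have [M [c [uM MS wE]]] := span_lsum sw.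
have hsum : \sum_(nu <- L) nsq (ip w (gabor gamma nu)) <= vol ^+ 2 / a * rn w.
  have h1 : \sum_(nu <- L) nsq (ip w (gabor gamma nu)) <= vol ^+ 2 * l2sq M c.
    have -> : \sum_(nu <- L) nsq (ip w (gabor gamma nu)) =
        \sum_(nu <- [seq i <- L | i \in M]) vol ^+ 2 * nsq (c nu).
      rewrite big_filter [RHS]big_mkcond /=; apply: eq_big_seq => nu nuL.
      rewrite wE ip_lsum_biorthogonal//; last exact: LS.
      by case: ifP => _; rewrite ?nsq0// nsqM nsqR mulrC.
    rewrite /l2sq mulr_sumr [leRHS](lsum_split (L := [seq i <- L | i \in M]) _ _ uM).
    - by rewrite lerDl; apply: sumr_ge0 => nu _; rewrite mulr_ge0 ?nsq_ge0 ?sqr_ge0.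
    - exact: filter_uniq.
    - by move=> nu; rewrite mem_filter => /andP[].
  apply: (le_trans h1); rewrite -mulrA ler_wpM2l ?sqr_ge0//.
  by rewrite mulrC ler_pdivlMr// mulrC wE; exact: ha.
have lqw : l2 (fun t => q t - w t) by exact: l2B.
have hdiff : \sum_(nu <- L) nsq (ip (fun t => q t - w t) (gabor gamma nu)) <=
    (size L)%:R * rn gamma * rn (fun t => q t - w t).
  rewrite -sum1_size natr_sum !mulr_suml; apply: ler_sum => nu _.
  rewrite mul1r mulrC -(rn_tf_shift nu lga); exact: cauchy_schwarz.
have hsplit : \sum_(nu <- L) nsq (ip f (gabor gamma nu)) <=
    2 * (vol ^+ 2 / a * rn w) + 2 * ((size L)%:R * rn gamma * rn (fun t => q t - w t)).
  apply: (@le_trans _ _ (2 * \sum_(nu <- L) nsq (ip w (gabor gamma nu)) +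
    2 * \sum_(nu <- L) nsq (ip (fun t => q t - w t) (gabor gamma nu)))).
    rewrite !mulr_sumr -big_split [leLHS]big_seq [leRHS]big_seq; apply: ler_sum => nu nuL.
    rewrite ipf; last exact: LS.
    have -> : ip q (gabor gamma nu) = ip w (gabor gamma nu) + ip (fun t => q t -
        w t) (gabor gamma nu).
      by rewrite ipBl// addrC subrK.
    by apply: (le_trans (nsqD_le2 _ _)); rewrite mulrDr.
  by rewrite lerD// ler_pM2l.
have hw2 := rn_le2 lw lq.
have v0 : 0 <= vol ^+ 2 / a by rewrite divr_ge0 ?sqr_ge0// ltW.
have h3 := ler_wpM2l v0 hw2.
have h4 := ler_wpM2l v0 qf.
have h5 := ler_wpM2l D0 hw.
have h6 := ler_wpM2l E0 hw.
have h7 : (D + 2 * (size L)%:R * rn gamma) * (x / (E + 1)) <= x.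
  rewrite mulrCA ler_piMr ?(ltW x0)// ler_pdivrMr ?mul1r; first by rewrite lerDl.
  by rewrite ltr_wpDl// addr_ge0.
have DE : D = 4 * (vol ^+ 2 / a) by rewrite /D mulrA.
rewrite rnC in hsplit.
move: hsplit h3 h4 h5 h6 h7; rewrite DE; set V := vol ^+ 2 / a; set n := (size L)%:R.
set y := x / (E + 1); set r := rn (fun t => w t - q t).
move: (rn w) (rn q) (rn f) (rn gamma) (\sum_(nu <- L) _) => rw rq rf rg z *.
lra.
Qed.

End dual_window.

(** * The three conditions and the finite bounds *)

Section equivalences.
Context {R : realType} {d : nat} (A : 'M[R]_(d + d)).
Hypothesis uA : A \in unitmx.
Local Notation Z := 'cV[R]_(d + d).
Local Notation T := 'cV[R]_d.
Local Notation K := 'cV[int]_(d + d).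
Local Notation lam := (@lebesgue_cV R d).
Local Notation l2 := (l2 lam).
Local Notation S := (adjoint_lattice A).
Variable g : T -> R[i].
Hypothesis lg : l2 g.

(** A left inverse of [apoint A], with default value 0 off the adjoint lattice. *)
Let inv (z : Z) : K := xget 0 [set k | apoint A k = z].

Let invK : cancel (apoint A) inv.
Proof.
move=> k; apply: (apoint_inj uA); rewrite /inv.
by have := @xgetPex _ 0 [set k' | apoint A k' = apoint A k]; apply; exists k.
Qed.

Let Kinv z : S z -> apoint A (inv z) = z.
Proof. by move=> [k _ <-]; rewrite -/(apoint A k) invK. Qed.

(** Fourier analysis on a cell indexes by integer vectors, the definitions by points of the adjoint
    lattice; injectivity of [apoint A] carries finite duplicate-free sums from one indexing to the
    other. *)
Lemma finite_rieszP a b : finite_riesz A g a b <->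
  synthesis_lower S (gabor g) a /\ synthesis_bound S (gabor g) b.
Proof.
split=> [h|[ha hb] s c us].
  have key L c : uniq L -> {in L, forall i, S i} ->
      a * l2sq L c <= rn lam (lsum (gabor g) L c) <= b * l2sq L c.
    move=> uL LS; have LE : [seq apoint A k | k <- [seq inv z | z <- L]] = L.
      rewrite -map_comp -[RHS]map_id; apply/eq_in_map => z zL /=.
      by apply: Kinv; exact: LS.
    have us : uniq [seq inv z | z <- L] by move: uL; rewrite -{1}LE => /map_uniq.
    have := h _ (c \o apoint A) us.
    have -> : \sum_(k <- [seq inv z | z <- L]) nsq ((c \o apoint A) k) = l2sq L c.
      by rewrite big_map; apply: eq_big_seq => z zL; rewrite /= (Kinv (LS z zL)).
    have -> // : gsum A g [seq inv z | z <- L] (c \o apoint A) = lsum (gabor g) L c.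
    apply/funext => t; rewrite /gsum big_map; apply: eq_big_seq => z zL.
    by rewrite /= (Kinv (LS z zL)).
  by split=> L c uL LS; have /andP[] := key L c uL LS.
pose L := [seq apoint A k | k <- s]; pose c' := c \o inv.
have uL : uniq L by rewrite map_inj_uniq//; exact: apoint_inj.
have LS : {in L, forall z, S z} by move=> z /mapP[k _ ->]; exists k.
have e1 : l2sq L c' = \sum_(k <- s) nsq (c k).
  by rewrite /l2sq big_map; apply: eq_bigr => k _; rewrite /c' /= invK.
have e2 : lsum (gabor g) L c' = gsum A g s c.
  apply/funext => t; rewrite /lsum big_map; apply: eq_bigr => k _.
  by rewrite /c' /= invK.
have := ha L c' uL LS; have := hb L c' uL LS; rewrite e1 e2 => -> ->; by [].
Qed.

Let m := cell_mass A.
Let m0 : 0 < m. Proof. exact: cell_mass_pos. Qed.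

Let lgab z : l2 (gabor g z). Proof. exact: l2_tf_shift. Qed.

Lemma frame_iff_finite_riesz : is_frame (lattice A) (gabor g) <->
  exists a b, [/\ 0 < a, 0 < b & finite_riesz A g a b].
Proof.
split=> [[a [b [a0 b0 /frame_lowerE ha /frame_upperE hb]]]|[a [b [a0 b0 h]]]].
  exists (a * m), (b * m); split; rewrite ?mulr_gt0//.
  exact: frame_finite_riesz.
exists (a / (2 * m)), (2 * b / m); split; rewrite ?divr_gt0 ?mulr_gt0//.
  by apply/frame_lowerE => f lf; exact: (riesz_lower_frame uA lg (ltW a0) (ltW b0) h).
by apply/frame_upperE => f lf; exact: (riesz_upper_frame uA lg (ltW b0) h).
Qed.

Lemma riesz_iff_finite_riesz : is_riesz_sequence S (gabor g) <->
  exists a b, [/\ 0 < a, 0 < b & finite_riesz A g a b].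
Proof.
split=> [/(riesz_finite_bounds lgab)[a [b [a0 b0 ha hb]]]|[a [b [a0 b0 /finite_rieszP[ha hb]]]]].
  by exists a, b; split => //; apply/finite_rieszP.
exact: finite_bounds_riesz ha hb.
Qed.

Lemma dual_window_iff_finite_riesz :
  (is_bessel S (gabor g) /\ exists gamma : T -> R[i], [/\ L2 gamma, is_bessel S (gabor gamma) &
    forall mu : Z, S mu -> L2inner gamma (tf_shift mu g) = (lattice_vol A)%:C%C *+ (mu == 0)]) <->
  exists a b, [/\ 0 < a, 0 < b & finite_riesz A g a b].
Proof.
have v0 : 0 < lattice_vol A by rewrite /lattice_vol normr_gt0 -unitfE -unitmxE.
split=> [[[B B0 hB] [gamma [/L2P lga [C C0 hC] bi]]]|[a [b [a0 b0 /finite_rieszP[ha hb]]]]].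
  exists (lattice_vol A ^+ 2 / C), B; split => //; first by rewrite divr_gt0 ?exprn_gt0.
  by apply/finite_rieszP; exact: (dual_window_bounds lg lga bi B0 C0 hB hC).
split; first by exists b => //; apply: synthesis_bessel => //; exact: ltW.
have [gamma [lga bi app]] := exists_biorthogonal uA lg a0 ha.
exists gamma; split => //; first exact/L2P.
exists (4 * lattice_vol A ^+ 2 / a); first by rewrite divr_gt0 ?mulr_gt0 ?exprn_gt0.
exact: (biorthogonal_bessel uA lg a0 ha lga bi app).
Qed.

End equivalences.

Theorem theorem4p1 (R : realType) (d : nat) (g : 'cV[R]_d -> R[i])
    (hg : L2 g) (A : 'M[R]_(d + d)) (hA : A \in unitmx) :
  [<-> is_frame (lattice A) (gabor g);
       is_bessel (adjoint_lattice A) (gabor g) /\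
       (exists gamma : 'cV[R]_d -> R[i],
          [/\ L2 gamma, is_bessel (adjoint_lattice A) (gabor gamma) &
              forall mu : 'cV[R]_(d + d), adjoint_lattice A mu ->
                L2inner gamma (tf_shift mu g) =
                  (lattice_vol A)%:C%C *+ (mu == 0)]);
       is_riesz_sequence (adjoint_lattice A) (gabor g)].
Proof.
have lg : l2 (lebesgue_cV d) g by exact/L2P.
tfae.
- by move=> /(frame_iff_finite_riesz hA lg)/(dual_window_iff_finite_riesz hA lg).
- by move=> /(dual_window_iff_finite_riesz hA lg)/(riesz_iff_finite_riesz hA lg).
- by move=> /(riesz_iff_finite_riesz hA lg)/(frame_iff_finite_riesz hA lg).
Qed.
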